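(* Let $H$ be the $7$-dimensional Heisenberg group with Lie algebra $\mathfrak h$ as in the context, let $A>0$, and let $\varphi_2=e^{127}-e^{347}-e^{567}+e^{135}-e^{146}+e^{236}+e^{245}$. The solution of the modified Laplacian coflow with constant $A$ and initial coclosed $\mathrm{G}_2$ form $\varphi_2$ is defined on a bounded interval, and is given by $\psi(t)=\star_t\varphi(t)$ with $$\varphi(t)=\frac{y(t)}{z(t)^2}e^{127}-y(t)^{-1}\big(e^{347}+e^{567}\big)+y(t)z(t)^2\big(e^{135}-e^{146}+e^{236}+e^{245}\big),$$ where $y,z$ satisfy $$y'(t)=\frac{2A\sqrt6\,y(t)z(t)^6+2z(t)^2+y(t)^2}{12\,y(t)^3z(t)^8},\qquad z'(t)=-\frac{2A\sqrt6\,y(t)z(t)^4+1}{12\,y(t)^2z(t)^7},\qquad y(0)=1,\ z(0)=1.$$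
   Context: The Heisenberg Lie algebra $\mathfrak h$ has a dual basis $\{e^1,\dots,e^7\}$ with $de^i=0$ ($1\le i\le6$) and $de^7=\frac{\sqrt6}{6}(e^{12}+e^{34}+e^{56})$, where $e^{ij\cdots}=e^i\wedge e^j\wedge\cdots$; $H$ is the simply connected Lie group with Lie algebra $\mathfrak h$ and left invariant forms are identified with $\Lambda^*\mathfrak h^*$. A left invariant $\mathrm{G}_2$ form is $\varphi\in\Lambda^3\mathfrak h^*$ equal to $x^{127}+x^{347}+x^{567}+x^{135}-x^{146}-x^{236}-x^{245}$ in some basis $\{x^i\}$ of $\mathfrak h^*$; it determines the metric $g_\varphi$ and orientation for which $\{x^i\}$ is oriented orthonormal, the Hodge star $\star_\varphi$, and $\psi=\star_\varphi\varphi$; it is coclosed if $d\psi=0$. For coclosed $\varphi$ one has uniquely $d\varphi=\tau_0\psi+\star_\varphi\tau_3$ with $\tau_0\in\mathbb R$ and $\tau_3\in\Lambda^3\mathfrak h^*$ satisfying $\tau_3\wedge\varphi=0=\tau_3\wedge\psi$. The modified Laplacian coflow with constant $A>0$ is $$\frac{d}{dt}\psi(t)=\Delta_t\psi(t)+2d\Big(\big(A-\mathrm{Tr}_t(\tau(t))\big)\varphi(t)\Big),\quad d\psi(t)=0,\quad\psi(0)=\star_{\varphi_2}\varphi_2,$$ where $\psi(t)=\star_t\varphi(t)$, $\star_t$ and $\Delta_t=dd^*+d^*d$ are with respect to $g_t=g_{\varphi(t)}$, and $\mathrm{Tr}_t(\tau(t))$ is the trace of the full torsion tensor of $\varphi(t)$,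 which for coclosed structures equals $\frac74\tau_0(t)$. ''Defined on a bounded interval'' means the maximal interval of existence $(t_-,t_+)$ satisfies $-\infty<t_-<0<t_+<+\infty$. *)

(* Defs.v *)
From HB Require Import structures.
From mathcomp Require Import all_boot all_order all_algebra.
From mathcomp Require Import all_classical all_reals all_analysis.
From Stdlib Require Import ClassicalEpsilon.
Set Implicit Arguments. Unset Strict Implicit. Unset Printing Implicit Defensive.
Import Order.TTheory GRing.Theory Num.Theory numFieldNormedType.Exports.
Local Open Scope ring_scope.

Section Forms.
Variable R : realType.

(* A left-invariant lform on H = an element of Lambda^* h^*, written in the
   basis e^I (I a subset of {0..6}, i.e. of {1..7} shifted by one) of
   increasing wedges e^{i1}/\.../\e^{ik}, i1<...<ik.  [lform] mixes all degrees. *)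
Definition lform := {set 'I_7} -> R.

Definition fzero : lform := fun _ => 0.
Definition fadd (a b : lform) : lform := fun I => a I + b I.
Definition fscale (r : R) (a : lform) : lform := fun I => r * a I.

Definition mono (I : {set 'I_7}) : lform := fun J => (J == I)%:R.

(* e^I /\ e^J = sgn I J e^(I u J) for disjoint I J *)
Definition sgn (I J : {set 'I_7}) : R :=
  (-1) ^+ #|[set p : 'I_7 * 'I_7 | [&& p.1 \in I, p.2 \in J & (p.2 < p.1)%N]]|.

Definition wedge (a b : lform) : lform := fun K =>
  \sum_(I : {set 'I_7} | I \subset K) sgn I (K :\: I) * a I * b (K :\: I).

Definition homog (k : nat) (a : lform) : Prop := forall I : {set 'I_7}, #|I| != k -> a I = 0.

(* e^{ijk} with 1-based indices *)
Definition e2 (i j : nat) : lform := mono [set (inord i.-1 : 'I_7); inord j.-1].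
Definition e3 (i j k : nat) : lform :=
  mono [set (inord i.-1 : 'I_7); inord j.-1; inord k.-1].

(* exterior derivative: d e^i = 0 (i<=6), d e^7 = sqrt6/6 (e^12+e^34+e^56),
   extended as a graded derivation (d e^i are 2-forms, hence central). *)
Definition de (i : 'I_7) : lform :=
  if (i == 6 :> nat) then
    fscale (Num.sqrt 6 / 6) (fadd (e2 1 2) (fadd (e2 3 4) (e2 5 6)))
  else fzero.

Definition dmono (I : {set 'I_7}) : lform := fun K =>
  \sum_(i in I) (-1) ^+ #|[set j in I | (j < i)%N]| * wedge (de i) (mono (I :\ i)) K.

Definition dform (a : lform) : lform := fun K => \sum_(I : {set 'I_7}) a I * dmono I K.

(* change of basis: x^i = sum_j P i j e^j.  [xmon P I] = x^I expressed in the e-basis *)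
Definition lin (v : 'I_7 -> R) : lform := fun J => \sum_j (J == [set j])%:R * v j.
Definition xmon (P : 'M[R]_7) (I : {set 'I_7}) : lform :=
  \big[wedge/mono (finset.set0 : {set 'I_7})]_(i <- enum I) lin (fun j => P i j).
Definition expr (P : 'M[R]_7) (c : lform) : lform := fun K =>
  \sum_(I : {set 'I_7}) c I * xmon P I K.

(* the standard G2 lform x^127+x^347+x^567+x^135-x^146-x^236-x^245 (x-coefficients) *)
Definition phi0 : lform := fun I =>
  e3 1 2 7 I + e3 3 4 7 I + e3 5 6 7 I + e3 1 3 5 I
  - e3 1 4 6 I - e3 2 3 6 I - e3 2 4 5 I.

Definition adapted (phi : lform) (P : 'M[R]_7) : Prop :=
  \det P != 0 /\ phi = expr P phi0.

Definition G2form (phi : lform) : Prop := exists P, adapted phi P.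

(* Hodge star of the metric/orientation making {x^i} oriented orthonormal:
   star x^I = sgn(I, I^c) x^(I^c). The x-coefficients of a are expr (invmx P) a. *)
Definition star (P : 'M[R]_7) (a : lform) : lform :=
  expr P (fun J => sgn (~: J) J * expr (invmx P) a (~: J)).

(* star_phi: computed in some adapted basis (the result does not depend on it) *)
Definition adapted_basis (phi : lform) : 'M[R]_7 :=
  epsilon (inhabits 1%:M) (adapted phi).
Definition hodge (phi : lform) (a : lform) : lform := star (adapted_basis phi) a.

(* formal adjoint of d on k-forms in dimension 7 : d^* = (-1)^k star d star *)
Definition codiff (phi : lform) (k : nat) (a : lform) : lform :=
  fscale ((-1) ^+ k) (hodge phi (dform (hodge phi a))).
Definition lap (phi : lform) (k : nat) (a : lform) : lform :=
  fadd (dform (codiff phi k a)) (codiff phi k.+1 (dform a)).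

Definition tau0 (phi : lform) : R :=
  epsilon (inhabits 0) (fun r => exists tau3 : lform,
    homog 3 tau3 /\
    dform phi = fadd (fscale r (hodge phi phi)) (hodge phi tau3) /\
    wedge tau3 phi = fzero /\ wedge tau3 (hodge phi phi) = fzero).

(* trace of the full torsion tensor of a coclosed G2 structure *)
Definition trace_torsion (phi : lform) : R := 7 / 4 * tau0 phi.

Definition phi2 : lform := fun I =>
  e3 1 2 7 I - e3 3 4 7 I - e3 5 6 7 I + e3 1 3 5 I
  - e3 1 4 6 I + e3 2 3 6 I + e3 2 4 5 I.

Definition coflow_solution (A a b : R) (phi psi : R -> lform) : Prop :=
  a < 0 < b /\ psi 0 = hodge phi2 phi2 /\
  forall t, a < t < b ->
    G2form (phi t) /\ psi t = hodge (phi t) (phi t) /\ dform (psi t) = fzero /\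
    forall I : {set 'I_7},
      is_derive t 1 (fun s => psi s I)
        (fadd (lap (phi t) 4 (psi t))
              (fscale 2 (dform (fscale (A - trace_torsion (phi t)) (phi t)))) I).

Definition phi_yz (y z : R) : lform := fun I =>
  y / z ^+ 2 * e3 1 2 7 I - y^-1 * (e3 3 4 7 I + e3 5 6 7 I)
  + y * z ^+ 2 * (e3 1 3 5 I - e3 1 4 6 I + e3 2 3 6 I + e3 2 4 5 I).

End Forms.

(* Main.v *)
(* Let s = sqrt 6 / 6 and omega = e^12 + e^34 + e^56. Then d a = s omega /\ (e_7 -| a), and every
   G2 form has an adapted frame in which only the last covector sees e_7, with value c > 0, because
   G2 is transitive on rays. In such a frame, with w = (e_7 -| phi) / c, the right-hand side of the
   coflow of a coclosed structure is 2 A c s omega /\ w - (c s)^2 omega /\ omega.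

   It has no e^7-part, so e_7 -| psi keeps its initial value, and w is Hermitian for one fixed complex
   structure. The six off-diagonal entries of w^2 / 2 have derivative 2 A c s times those of w, which
   are linear in them; they start at zero and vanish by Gronwall. The same argument makes the two
   negative diagonal entries equal. What is left is the (y, z) system, and psi together with the sign
   of (e_7 -| phi)^3 determines phi.

   In g = y z and a new time tau the system is polynomial. Forwards, z and g^2 + z^4 decrease; backwards,
   z increases and (g^2 + z^4) / z^2 decreases. Hence a coordinate reaches zero at finite tau in both
   directions, and t is a bounded function of tau in between. *)

(* Adapted frames are chosen separately at each time, and [hodge] and [tau0] are themselves choices,
   so nothing attached to a frame can be differentiated in t. Only the coefficients of psi have
   known derivatives. The uniqueness argument is therefore written in coefficient functionals of
   psi, and the frame is eliminated pointwise: w is recovered from w^2 / 2 by adjugate identities,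
   while the scale c is only bounded, through the continuous quantity c^3 = ([volume3] / 6) / Pf(w).

   Picard iteration is run on the whole line, for a globally Lipschitz field obtained by truncating
   both coordinates to [0, 2]. The monotone quantities keep a genuine solution strictly below 2, so
   the truncation is invisible until a coordinate vanishes. *)
Require Import Defs.
From HB Require Import structures.
From mathcomp Require Import all_boot all_order all_algebra.
From mathcomp Require Import all_classical all_reals all_analysis.
From mathcomp Require Import ring lra.
Set Implicit Arguments. Unset Strict Implicit. Unset Printing Implicit Defensive.
Import Order.TTheory GRing.Theory Num.Theory numFieldNormedType.Exports.
Local Open Scope ring_scope.

(** * Exterior algebra *)

Section ExteriorAlgebra.
Variable R : realType.
Implicit Types (a b c : lform R) (I J K : {set 'I_7}) (u v : 'I_7 -> R).
Implicit Types (P Q M : 'M[R]_7).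

Definition below (i : 'I_7) I := #|[set j in I | (j < i)%N]|.

(** Written as a double product, the inversion sign becomes multiplicative in each argument over
    disjoint unions ([sgnUl], [sgnUr]). *)
Lemma sgnE I J :
  sgn R I J = \prod_(i in I) \prod_(j in J) (-1) ^+ (j < i)%N.
Proof.
rewrite /sgn -prodr_const pair_big_dep /= (big_mkcond (fun p => p \in _)) /=.
rewrite [RHS]big_mkcond /=; apply: eq_bigr => -[i j] _ /=.
by rewrite inE /=; case: (i \in I); case: (j \in J); case: (j < i)%N.
Qed.

Lemma sgn_below i J : sgn R [set i] J = (-1) ^+ below i J.
Proof.
rewrite sgnE big_set1 /below -prodr_const.
rewrite [RHS]big_mkcond [LHS]big_mkcond /=.
by apply: eq_bigr => j _; rewrite inE; case: (j \in J); case: (j < i)%N.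
Qed.

Lemma sgnUl I J K : [disjoint I & J] -> sgn R (I :|: J) K = sgn R I K * sgn R J K.
Proof. by move=> dIJ; rewrite !sgnE -bigU //=; apply: eq_bigl => i; rewrite !inE. Qed.

Lemma sgnUr I J K : [disjoint J & K] -> sgn R I (J :|: K) = sgn R I J * sgn R I K.
Proof.
move=> dJK; rewrite !sgnE -big_split /=; apply: eq_bigr => i _.
by rewrite -bigU //=; apply: eq_bigl => j; rewrite !inE.
Qed.

Lemma sgn_sq I J : sgn R I J * sgn R I J = 1.
Proof. by rewrite /sgn -expr2 sqrr_sign. Qed.

Lemma lform_decomp a : a = \sum_I a I *: mono R I.
Proof.
apply: funext => K; rewrite fct_sumE (bigD1 K) //= big1 ?addr0.
  by rewrite scalrfctE /mono eqxx -[_ *: _]/(_ * _) mulr1.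
by move=> I; rewrite scalrfctE /mono eq_sym => /negbTE->; exact: mulr0.
Qed.

Lemma wedgeDl a b c : wedge (a + b) c = wedge a c + wedge b c.
Proof.
apply: funext => K; rewrite -[RHS]/(wedge a c K + wedge b c K) -big_split /=.
by apply: eq_bigr => I _; rewrite addrfctE mulrDr mulrDl.
Qed.
Lemma wedgeDr a b c : wedge a (b + c) = wedge a b + wedge a c.
Proof.
apply: funext => K; rewrite -[RHS]/(wedge a b K + wedge a c K) -big_split /=.
by apply: eq_bigr => I _; rewrite addrfctE mulrDr.
Qed.
Lemma wedgeZl (k : R) a c : wedge (k *: a) c = k *: wedge a c.
Proof.
apply: funext => K; rewrite -[RHS]/(k * wedge a c K) big_distrr /=.
by apply: eq_bigr => I _; rewrite -[(k *: a) I]/(k * a I) mulrCA !mulrA.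
Qed.
Lemma wedgeZr (k : R) a c : wedge a (k *: c) = k *: wedge a c.
Proof.
apply: funext => K; rewrite -[RHS]/(k * wedge a c K) big_distrr /=.
by apply: eq_bigr => I _; rewrite -[(k *: c) _]/(k * c _) mulrCA.
Qed.
Lemma wedge0l a : wedge 0 a = 0.
Proof. by have := wedgeZl 0 0 a; rewrite !scale0r. Qed.
Lemma wedge0r a : wedge a 0 = 0.
Proof. by have := wedgeZr 0 a 0; rewrite !scale0r. Qed.
Lemma wedgeNr a b : wedge a (- b) = - wedge a b.
Proof. by rewrite -scaleN1r wedgeZr scaleN1r. Qed.
Lemma wedge_suml (T : Type) (r : seq T) (F : T -> lform R) b :
  wedge (\sum_(i <- r) F i) b = \sum_(i <- r) wedge (F i) b.
Proof. exact: (big_morph (fun a => wedge a b) (fun x y => wedgeDl x y b) (wedge0l b)). Qed.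
Lemma wedge_sumr (T : Type) (r : seq T) (F : T -> lform R) b :
  wedge b (\sum_(i <- r) F i) = \sum_(i <- r) wedge b (F i).
Proof. exact: (big_morph (fun a => wedge b a) (wedgeDr b) (wedge0r b)). Qed.

(** Both sides are sums over flags I in L in K, with factors taken on I, L minus I and K minus L;
    the signs agree by bimultiplicativity of [sgn]. *)
Lemma wedgeA a b c : wedge a (wedge b c) = wedge (wedge a b) c.
Proof.
apply: funext => K; rewrite /wedge.
transitivity (\sum_(I : {set 'I_7} | I \subset K)
  \sum_(L : {set 'I_7} | (I \subset L) && (L \subset K))
   sgn R I (K :\: I) * a I * (sgn R (L :\: I) (K :\: L) * b (L :\: I) * c (K :\: L))).
  apply: eq_bigr => I IK; rewrite big_distrr /=.
  (* A subset J of K minus I corresponds to the middle set L = I u J of the flag. *)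
  rewrite (reindex_onto (fun L => L :\: I) (fun J => I :|: J)) /=; last first.
    move=> J; rewrite finset.subsetD => /andP[_ dJI].
    by rewrite finset.setDUl finset.setDv finset.set0U; apply/finset.setDidPl.
  apply: eq_big => [L|L].
    apply/andP/andP => [[LK /eqP IL]|[IL LK]].
      have sIL : I \subset L by rewrite -IL finset.subsetUl.
      split => //; rewrite -IL finset.subUset IK /=.
      by apply: (fintype.subset_trans LK); rewrite finset.subDset finset.subsetUr.
    by split; [exact: finset.setSD|apply/eqP/setP => x; rewrite !inE; move/fintype.subsetP: IL => /(_ x); case: (x \in I); case: (x \in L) => //= ->].
  case/andP => LK /eqP IL.
  have -> : (K :\: I) :\: (L :\: I) = K :\: L.
    by apply/setP => x; rewrite !inE; move/setP: IL => /(_ x); rewrite !inE;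
       case: (x \in I); case: (x \in L); case: (x \in K).
  by [].
rewrite (exchange_big_dep (fun L : {set 'I_7} => L \subset K)) /=; last first.
  by move=> I L _ /andP[].
apply: eq_bigr => L LK; rewrite mulrAC big_distrr /=.
rewrite [RHS]big_mkcond [LHS]big_mkcond /=; apply: eq_bigr => I _.
have [IL|nIL] /= := boolP (I \subset L); last by rewrite !andbF.
rewrite (fintype.subset_trans IL LK) LK /=.
have -> : K :\: I = (L :\: I) :|: (K :\: L).
  apply/setP => x; rewrite !inE; move/fintype.subsetP: LK => /(_ x); move/fintype.subsetP: IL => /(_ x).
  by case: (x \in I); case: (x \in L); case: (x \in K) => //= h1 h2; [have := h1 isT|have := h2 isT].
rewrite sgnUr; last first.
  by rewrite -setI_eq0; apply/eqP/setP => x; rewrite !inE; case: (x \in L); rewrite ?andbF.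
have eL : L = I :|: (L :\: I).
  by apply/setP => x; rewrite !inE; move/fintype.subsetP: IL => /(_ x); case: (x \in I); case: (x \in L) => //= ->.
have -> : sgn R L (K :\: L) = sgn R I (K :\: L) * sgn R (L :\: I) (K :\: L).
  rewrite {1}eL sgnUl //.
  by rewrite -setI_eq0; apply/eqP/setP => x; rewrite !inE; case: (x \in I); rewrite ?andbF.
ring.
Qed.

Lemma wedge_lin v a K :
  wedge (lin v) a K = \sum_(k in K) v k * (-1) ^+ below k K * a (K :\ k).
Proof.
rewrite /wedge /lin [RHS]big_mkcond /=.
transitivity (\sum_(I : {set 'I_7} | I \subset K) \sum_j
   ((I == [set j])%:R * (sgn R I (K :\: I) * v j * a (K :\: I)))).
  apply: eq_bigr => I _; rewrite big_distrr big_distrl /=.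
  by apply: eq_bigr => j _; ring.
rewrite exchange_big /=; apply: eq_bigr => j _.
have [jK|jK] := boolP (j \in K); last first.
  rewrite big1 // => I IK; case: eqP => [E|_]; last by rewrite mul0r.
  by move: IK jK; rewrite E finset.sub1set => ->.
rewrite (bigD1 [set j]) /= ?finset.sub1set // eqxx mul1r big1 ?addr0; last first.
  by move=> I /andP[_ /negbTE ->]; rewrite mul0r.
rewrite sgn_below; have -> : below j (K :\ j) = below j K; last by ring.
apply: eq_card => x; rewrite !inE; case: eqP => // ->; by rewrite ltnn !andbF.
Qed.

Definition dx (i : 'I_7) : lform R := lin (fun j => (j == i)%:R).

Lemma lin_dx v : lin v = \sum_i v i *: dx i.
Proof.
apply: funext => K; rewrite fct_sumE; apply: eq_bigr => j _.
rewrite -[RHS]/(v j * dx j K) /dx /lin (bigD1 j) //= eqxx mulr1 big1 ?addr0 1?mulrC //.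
by move=> i /negbTE ->; rewrite mulr0.
Qed.

Lemma dxE i : dx i = mono R [set i].
Proof.
apply: funext => K; rewrite /dx /lin /mono (bigD1 i) //= eqxx mulr1 big1 ?addr0 //.
by move=> j /negbTE ->; rewrite mulr0.
Qed.

Lemma wedge_dx i a K :
  wedge (dx i) a K = if i \in K then (-1) ^+ below i K * a (K :\ i) else 0.
Proof.
rewrite wedge_lin; case: ifP => iK.
  rewrite (bigD1 i) //= eqxx mul1r big1 ?addr0 // => k /andP[_ /negbTE ->].
  by rewrite !mul0r.
rewrite big1 // => k kK; case: eqP => [E|_]; last by rewrite !mul0r.
by rewrite -E kK in iK.
Qed.

Lemma belowE i K : below i K = (\sum_(j in K) (j < i))%N.
Proof.
rewrite /below -sum1_card big_mkcond [RHS]big_mkcond /=; apply: eq_bigr => j _.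
by rewrite inE; case: (j \in K) => //; case: (j < i)%N.
Qed.

Lemma below_setU1 i k K : k \notin K -> below i (k |: K) = ((k < i) + below i K)%N.
Proof. by move=> kK; rewrite !belowE big_setU1. Qed.

Lemma wedge_dx_mono i I :
  wedge (dx i) (mono R I) = if i \in I then 0 else (-1) ^+ below i I *: mono R (i |: I).
Proof.
apply: funext => K; rewrite wedge_dx /mono.
have [iI|iI] := boolP (i \in I).
  case: ifP => // iK; case: eqP => [E|_]; last by rewrite mulr0.
  by move: iI; rewrite -E !inE eqxx.
rewrite -[RHS]/(_ * _); case: ifP => iK; last first.
  case: eqP => [E|_]; last by rewrite mulr0.
  by move: iK; rewrite E !inE eqxx.
have -> : (K :\ i == I) = (K == i |: I).
  apply/eqP/eqP => [<-|->]; first by rewrite finset.setD1K.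
  by rewrite setU1K.
case: eqP => [->|_]; last by rewrite !mulr0.
by rewrite below_setU1 // ltnn.
Qed.

(** The exterior algebra is generated from 1 by linear combinations and left multiplication by basis
    covectors. Most identities on [expr], [hook] and [inner] follow by this induction, without
    handling index sets. *)
Lemma lform_ind (T : lform R -> Prop) :
  (forall a b, T a -> T b -> T (a + b)) -> (forall (k : R) a, T a -> T (k *: a)) ->
  T (mono R finset.set0) -> (forall i a, T a -> T (wedge (dx i) a)) -> forall a, T a.
Proof.
move=> TD TZ T1 Tdx.
have T0 : T 0 by rewrite -(scale0r (mono R finset.set0)); apply: TZ.
have Tm I : T (mono R I).
  move: {2}#|I| (leqnn #|I|) => n; elim: n I => [|n IH] I.
    by rewrite leqn0 cards_eq0 => /eqP ->.
  have [->//|[i iI]] := set_0Vmem I.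
  rewrite (cardsD1 i) iI add1n ltnS => /IH /(Tdx i).
  rewrite wedge_dx_mono !inE eqxx /= finset.setD1K //.
  by move/(TZ ((-1) ^+ below i (I :\ i))); rewrite scalerA -expr2 sqrr_sign scale1r.
by move=> a; rewrite (lform_decomp a); apply: big_ind => // I _; apply: TZ.
Qed.

Lemma wedge_set0l a : wedge (mono R finset.set0) a = a.
Proof.
apply: funext => K; rewrite /wedge /mono (bigD1 finset.set0) ?finset.sub0set //= eqxx mulr1.
rewrite finset.setD0 big1 ?addr0 => [|I /andP[_ /negbTE ->]]; last by rewrite mulr0 mul0r.
rewrite /sgn; set A := [set _ | _]; have -> : A = finset.set0.
  by apply/setP => p; rewrite !inE.
by rewrite cards0 mul1r.
Qed.

Lemma dx_anti i j : wedge (dx i) (dx j) = - wedge (dx j) (dx i).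
Proof.
rewrite dxE -dxE [dx j]dxE !wedge_dx_mono -dxE [dx i]dxE wedge_dx_mono !inE eq_sym.
case: eqP => [_|/eqP ij]; first by rewrite oppr0.
rewrite finset.setUC -scaleNr; congr (_ *: _).
rewrite -!sgn_below !sgnE !big_set1.
by case: (ltngtP i j) ij => [||/val_inj ->] //; rewrite ?eqxx //= ?expr0 ?expr1 ?opprK.
Qed.

Lemma lin_anti u v : wedge (lin u) (lin v) = - wedge (lin v) (lin u).
Proof.
rewrite !lin_dx !wedge_suml -sumrN.
under eq_bigr => i _ do rewrite wedge_sumr.
under [RHS]eq_bigr => i _ do rewrite wedge_sumr -sumrN.
rewrite exchange_big /=; apply: eq_bigr => i _; apply: eq_bigr => j _.
by rewrite !wedgeZl !wedgeZr dx_anti !scalerN !scalerA mulrC.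
Qed.

Lemma wedge_linC u v a : wedge (lin u) (wedge (lin v) a) = - wedge (lin v) (wedge (lin u) a).
Proof. by rewrite !wedgeA lin_anti -[- wedge _ _]scaleN1r wedgeZl scaleN1r. Qed.

Lemma wedge_lin2 u a : wedge (lin u) (wedge (lin u) a) = 0.
Proof.
have /eqP := wedge_linC u u a; rewrite -addr_eq0 -mulr2n -scaler_nat scaler_eq0.
by rewrite pnatr_eq0 => /eqP.
Qed.
End ExteriorAlgebra.

(** * Change of basis and interior product *)

Section ChangeOfBasis.
Variable R : realType.
Implicit Types (a b c : lform R) (I J K : {set 'I_7}) (u v : 'I_7 -> R).
Implicit Types (P Q M : 'M[R]_7).

(** [xmon] for an arbitrary sequence in place of a sorted enumeration, so that factors can be moved
    and repeated. *)
Definition linprod P (s : seq 'I_7) : lform R :=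
  \big[@wedge R/mono R finset.set0]_(i <- s) lin (fun j => P i j).

Lemma linprod_cons P i s : linprod P (i :: s) = wedge (lin (P i)) (linprod P s).
Proof. by rewrite /linprod big_cons. Qed.

Lemma wedge_linprod P i s1 s2 : wedge (lin (P i)) (linprod P (s1 ++ s2)) =
  (-1) ^+ size s1 *: linprod P (s1 ++ i :: s2).
Proof.
elim: s1 => [|j s1 IH]; first by rewrite scale1r linprod_cons.
by rewrite /= !linprod_cons wedge_linC IH wedgeZr exprS mulN1r scaleNr.
Qed.

Lemma linprod_dup P i s1 s2 : linprod P (s1 ++ i :: i :: s2) = 0.
Proof.
elim: s1 => [|j s1 IH] /=; rewrite !linprod_cons ?wedge_lin2 //.
by rewrite IH wedge0r.
Qed.

Local Notation ltI := (fun i j : 'I_7 => (i < j)%N).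

Lemma ltI_trans : transitive ltI. Proof. by move=> x y z; exact: ltn_trans. Qed.

Lemma enum_sorted I : sorted ltI (enum I).
Proof.
have : sorted ltI (enum 'I_7) by have := iota_ltn_sorted 0 7; rewrite -val_enum_ord sorted_map.
by rewrite enumT => h; rewrite [enum I]/enum_mem; apply: (sorted_filter ltI_trans).
Qed.

Lemma enum_pairwise I : pairwise ltI (enum I).
Proof. by rewrite -(sorted_pairwise ltI_trans) enum_sorted. Qed.

Lemma enum_split (i : 'I_7) I :
  enum I = [seq j : 'I_7 <- enum I | (j < i)%N] ++ [seq j : 'I_7 <- enum I | (i <= j)%N].
Proof.
apply: (irr_sorted_eq ltI_trans) (enum_sorted I) _ _; first by move=> x; rewrite /= ltnn.
  rewrite (sorted_pairwise ltI_trans) pairwise_cat /= !(pairwise_filter _ (enum_pairwise I)) ?andbT.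
  by apply/allrelP => x y; rewrite !mem_filter => /andP[xi _] /andP[iy _]; exact: leq_trans xi iy.
by move=> x; rewrite mem_cat !mem_filter; case: ltnP; rewrite ?andbT ?orbF.
Qed.

Lemma enum_setU1 (i : 'I_7) I : i \notin I ->
  enum (i |: I) = [seq j : 'I_7 <- enum I | (j < i)%N] ++ i :: [seq j : 'I_7 <- enum I | (i <= j)%N].
Proof.
move=> iI; apply: (irr_sorted_eq ltI_trans) (enum_sorted _) _ _; first by move=> x; rewrite /= ltnn.
  rewrite (sorted_pairwise ltI_trans) pairwise_cat /= !(pairwise_filter _ (enum_pairwise I)) ?andbT.
  apply/andP; split.
    apply/allrelP => x y; rewrite inE !mem_filter => /andP[xi _] /orP[/eqP ->//|/andP[iy _]].
    exact: leq_trans xi iy.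
  apply/allP => x; have := mem_enum I x; move: (enum I) => e eE.
  rewrite mem_filter leq_eqVlt => /andP[/orP[/eqP/val_inj ix|//]].
  by rewrite eE -ix (negbTE iI).
move=> x; rewrite mem_enum mem_cat !inE.
have := mem_enum I x; move: (enum I) => e eE; rewrite !mem_filter eE.
by case: eqP => [->|]; rewrite ?orbT //=; case: ltnP; rewrite ?andbT ?orbF.
Qed.

Lemma size_below (i : 'I_7) I : size [seq j : 'I_7 <- enum I | (j < i)%N] = below i I.
Proof.
rewrite /below cardE; apply/perm_size/uniq_perm; [exact: (filter_uniq _ (enum_uniq _))|exact: enum_uniq|].
move=> x; rewrite [RHS]mem_enum inE andbC.
by have := mem_enum I x; move: (enum I) => e eE; rewrite mem_filter eE.
Qed.

(** The new factor is carried past the [below i I] smaller ones to its sorted place; if i is already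
    in I it meets its copy and the product vanishes. *)
Lemma wedge_xmon P i I : wedge (lin (P i)) (xmon P I) =
  if i \in I then 0 else (-1) ^+ below i I *: xmon P (i |: I).
Proof.
rewrite -[xmon P I]/(linprod P (enum I)) -[xmon P (i |: I)]/(linprod P (enum (i |: I))).
case: ifP => [iI|/negbT iI].
  have -> : enum I = enum (i |: I :\ i) by rewrite finset.setD1K.
  rewrite enum_setU1 ?inE ?eqxx // wedge_linprod.
  by rewrite linprod_dup scaler0.
by rewrite {1}(enum_split i I) wedge_linprod size_below enum_setU1.
Qed.

Lemma expr_addf P a b : expr P (a + b) = expr P a + expr P b.
Proof.
apply: funext => K; rewrite -[RHS]/(expr P a K + expr P b K) -big_split /=.
by apply: eq_bigr => I _; rewrite mulrDl.
Qed.
Lemma expr_scalef P (k : R) a : expr P (k *: a) = k *: expr P a.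
Proof.
apply: funext => K; rewrite -[RHS]/(k * expr P a K) big_distrr /=.
by apply: eq_bigr => I _; rewrite mulrA.
Qed.
Lemma expr_zerof P : expr P 0 = 0.
Proof. by have := expr_scalef P 0 0; rewrite !scale0r. Qed.
Lemma expr_oppf P a : expr P (- a) = - expr P a.
Proof. by rewrite -scaleN1r expr_scalef scaleN1r. Qed.
Lemma expr_sumf P (T : Type) (r : seq T) (F : T -> lform R) :
  expr P (\sum_(i <- r) F i) = \sum_(i <- r) expr P (F i).
Proof. exact: (big_morph (expr P) (expr_addf P) (expr_zerof P)). Qed.
Lemma expr_mono P I : expr P (mono R I) = xmon P I.
Proof.
apply: funext => K; rewrite /expr (bigD1 I) //= /mono eqxx mul1r big1 ?addr0 //.
by move=> J /negbTE ->; rewrite mul0r.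
Qed.
Lemma expr_set0 P : expr P (mono R finset.set0) = mono R finset.set0.
Proof. by rewrite expr_mono /xmon enum_set0 big_nil. Qed.

(** The x^I multiply by the same signed rule as the e^I ([wedge_xmon] against [wedge_dx_mono]); this
    is what makes [expr P] an algebra morphism. *)
Lemma expr_dx_wedge P i a : expr P (wedge (dx R i) a) = wedge (lin (P i)) (expr P a).
Proof.
rewrite (lform_decomp a) wedge_sumr !expr_sumf wedge_sumr; apply: eq_bigr => I _.
rewrite wedgeZr !expr_scalef wedgeZr; congr (_ *: _).
by rewrite wedge_dx_mono expr_mono wedge_xmon; case: ifP => _; rewrite ?expr_zerof ?expr_scalef ?expr_mono.
Qed.

Lemma expr_wedge P a b : expr P (wedge a b) = wedge (expr P a) (expr P b).
Proof.
elim/lform_ind: a => [a1 a2 h1 h2|k a h| |i a h].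
- by rewrite wedgeDl !expr_addf h1 h2 wedgeDl.
- by rewrite wedgeZl !expr_scalef h wedgeZl.
- by rewrite expr_set0 !wedge_set0l.
- by rewrite -wedgeA !expr_dx_wedge h wedgeA.
Qed.

Lemma wedge_set0r a : wedge a (mono R finset.set0) = a.
Proof.
elim/lform_ind: a => [a1 a2 h1 h2|k a h| |i a h].
- by rewrite wedgeDl h1 h2.
- by rewrite wedgeZl h.
- by rewrite wedge_set0l.
- by rewrite -wedgeA h.
Qed.

Lemma expr_lin P v : expr P (lin v) = lin (fun j => \sum_k v k * P k j).
Proof.
rewrite lin_dx expr_sumf; apply: funext => K; rewrite fct_sumE /=.
have E k : expr P (v k *: dx R k) K = \sum_j (K == [set j])%:R * (v k * P k j).
  rewrite expr_scalef -(wedge_set0r (dx R k)) expr_dx_wedge expr_set0 wedge_set0r.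
  rewrite -[LHS]/(v k * lin (P k) K) /lin mulr_sumr.
  by apply: eq_bigr => j _; ring.
rewrite (eq_bigr _ (fun k _ => E k)) exchange_big /lin /=.
by apply: eq_bigr => j _; rewrite mulr_sumr.
Qed.

(** Both sides are algebra morphisms and agree on covectors. The rows of P are the new covectors, so
    the morphism applied last stands on the right of the product. *)
Lemma expr_mulmx P Q a : expr Q (expr P a) = expr (P *m Q) a.
Proof.
elim/lform_ind: a => [a1 a2 h1 h2|k a h| |i a h].
- by rewrite !expr_addf h1 h2.
- by rewrite !expr_scalef h.
- by rewrite !expr_set0.
- rewrite !expr_dx_wedge expr_wedge h expr_lin; congr (wedge (lin _) _).
  by apply: funext => j; rewrite mxE.
Qed.

Lemma expr_id a : expr 1%:M a = a.
Proof.
elim/lform_ind: a => [a1 a2 h1 h2|k a h| |i a h].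
- by rewrite !expr_addf h1 h2.
- by rewrite !expr_scalef h.
- by rewrite !expr_set0.
- rewrite !expr_dx_wedge h /dx; congr (wedge (lin _) _).
  by apply: funext => j; rewrite mxE eq_sym.
Qed.

(** Interior product of the vector u with a; the sign is that of moving e^k to the front of the
    increasing wedge on k |: K. *)
Definition hook u a : lform R := fun K =>
  \sum_(k | k \notin K) u k * (-1) ^+ below k K * a (k |: K).

Lemma hookD u a b : hook u (a + b) = hook u a + hook u b.
Proof.
apply: funext => K; rewrite -[RHS]/(hook u a K + hook u b K) -big_split /=.
by apply: eq_bigr => I _; rewrite -mulrDr.
Qed.
Lemma hookZ u (k : R) a : hook u (k *: a) = k *: hook u a.
Proof.
apply: funext => K; rewrite -[RHS]/(k * hook u a K) big_distrr /=.
by apply: eq_bigr => I _; rewrite -[(k *: a) _]/(k * a _) mulrCA.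
Qed.
Lemma hook0f u : hook u 0 = 0.
Proof. by have := hookZ u 0 0; rewrite !scale0r. Qed.
Lemma hook_sum u (T : Type) (r : seq T) (F : T -> lform R) :
  hook u (\sum_(i <- r) F i) = \sum_(i <- r) hook u (F i).
Proof. exact: (big_morph (hook u) (hookD u) (hook0f u)). Qed.

Lemma hook_set0 u : hook u (mono R finset.set0) = 0.
Proof.
apply: funext => K; rewrite /hook big1 // => k kK; rewrite /mono; case: eqP => [E|]; last by rewrite mulr0.
by move/setP/(_ k): E; rewrite !inE eqxx.
Qed.

Lemma sign_swap (k l : 'I_7) : k != l -> (-1) ^+ (l < k)%N * (-1) ^+ (k < l)%N = -1 :> R.
Proof. by case: (ltngtP k l) => [| |/val_inj ->]; rewrite ?eqxx // ?mulr1 ?mul1r. Qed.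

(** Antiderivation rule. The diagonal terms of the two double sums add up to the pairing of u and v
    times a, one sum giving the indices outside K and the other those inside. *)
Lemma hook_wedge u v a :
  hook u (wedge (lin v) a) = (\sum_i u i * v i) *: a - wedge (lin v) (hook u a).
Proof.
apply: funext => K; rewrite -[RHS]/((\sum_i u i * v i) * a K - wedge (lin v) (hook u a) K).
rewrite /hook wedge_lin.
under eq_bigr => k kK.
  rewrite wedge_lin big_setU1 //= below_setU1 // ltnn add0n setU1K // mulrDr mulr_sumr.
  rewrite (_ : u k * _ * _ = u k * v k * a K * ((-1) ^+ below k K * (-1) ^+ below k K)); last by ring.
  rewrite -expr2 sqrr_sign mulr1.
  over.
under [X in _ - X]eq_bigr => l lK.
  rewrite (bigD1 l) /= ?inE ?eqxx // finset.setD1K //.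
  have -> : below l (K :\ l) = below l K.
    by rewrite -{2}(finset.setD1K lK) below_setU1 ?inE ?eqxx // ltnn.
  rewrite mulrDr (_ : _ * (u l * _ * _) = u l * v l * a K * ((-1) ^+ below l K * (-1) ^+ below l K)); last by ring.
  rewrite -expr2 sqrr_sign mulr1 mulr_sumr.
  over.
rewrite !big_split /= opprD addrA.
have -> : \sum_(i | i \notin K) u i * v i * a K = (\sum_i u i * v i) * a K - \sum_(i in K) u i * v i * a K.
  by rewrite big_distrl /= [X in X - _](bigID (mem K)) /= addrC addrK.
congr (_ + _).
rewrite -sumrN.
under [RHS]eq_bigr => l _ do rewrite -sumrN.
under [RHS]eq_bigr => l lK.
  rewrite (eq_bigl (fun k => k \notin K)); last first.
    move=> k; rewrite !inE negb_and negbK.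
    by case: eqP => [->|_] //=; rewrite ?andbF ?andbT ?lK.
  over.
(* Off-diagonal terms: k enters K and l leaves it in either order, and the two orders differ by the
   sign of [sign_swap]. *)
rewrite [LHS](exchange_big_dep (mem K)) //=; apply: eq_bigr => l lK.
apply: eq_big => [k|k /andP[kK _]]; first by rewrite lK andbT.
have kl : k != l by apply: contraNneq kK => ->.
have -> : (k |: K) :\ l = k |: (K :\ l).
  by apply/setP => x; rewrite !inE; case: (x =P k) => [->|] //=; rewrite ?kl ?orbF ?andbT.
rewrite below_setU1 //.
have -> : below k K = ((l < k) + below k (K :\ l))%N.
  by rewrite -[in LHS](finset.setD1K lK) below_setU1 // !inE eqxx.
rewrite !exprD; have := sign_swap kl.
set A := (-1) ^+ (l < k)%N; set B := (-1) ^+ (k < l)%N.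
set C := (-1) ^+ below k _; set D := (-1) ^+ below l _; set E := a _ => AB.
by transitivity (A * B * (u k * v l * C * D * E)); [ring|rewrite AB; ring].
Qed.

End ChangeOfBasis.

(** * Volume and Hodge star *)

Section HodgeStar.
Variable R : realType.
Implicit Types (a b c : lform R) (I J K : {set 'I_7}) (u v : 'I_7 -> R).
Implicit Types (P Q M : 'M[R]_7).

Definition inner a b : R := \sum_I a I * b I.

Lemma innerDl a b c : inner (a + b) c = inner a c + inner b c.
Proof. by rewrite -big_split /=; apply: eq_bigr => I _; rewrite -mulrDl. Qed.
Lemma innerZl (k : R) a c : inner (k *: a) c = k * inner a c.
Proof. by rewrite /inner mulr_sumr; apply: eq_bigr => I _; rewrite mulrA. Qed.
Lemma inner_mono I b : inner (mono R I) b = b I.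
Proof.
rewrite /inner (bigD1 I) //= /mono eqxx mul1r big1 ?addr0 //.
by move=> J /negbTE ->; rewrite mul0r.
Qed.

Lemma inner_wedge_lin v a b : inner (wedge (lin v) a) b = inner a (hook v b).
Proof.
rewrite /inner /hook.
under eq_bigr => K _ do rewrite wedge_lin mulr_suml.
under [RHS]eq_bigr => K _ do rewrite mulr_sumr.
rewrite (exchange_big_dep predT) //= [RHS](exchange_big_dep predT) //=.
apply: eq_bigr => k _.
rewrite (reindex_onto (fun J => k |: J) (fun K => K :\ k)) /=; last first.
  by move=> K kK; rewrite finset.setD1K.
apply: eq_big => [J|J /andP[_ /eqP kJ]].
  rewrite !inE eqxx /=; apply/eqP/idP => [<-|kJ]; first by rewrite !inE eqxx.
  by rewrite setU1K.
have kJ' : k \notin J by rewrite -kJ !inE eqxx.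
by rewrite kJ below_setU1 // ltnn; ring.
Qed.

Lemma homog_wedge_lin v k a : homog k a -> homog k.+1 (wedge (lin v) a).
Proof.
move=> ha K hK; rewrite wedge_lin big1 // => j jK; rewrite ha ?mulr0 //.
by move: hK; rewrite (cardsD1 j) jK add1n eqSS.
Qed.

Lemma homog_linprod P s : homog (size s) (linprod P s).
Proof.
elim: s => [|i s IH]; last by rewrite linprod_cons; exact: homog_wedge_lin.
rewrite /linprod big_nil => K; rewrite cards_eq0 /mono => /negbTE -> //.
Qed.

Lemma homog_xmon P I : homog #|I| (xmon P I).
Proof. by rewrite cardE; exact: homog_linprod. Qed.

(** The determinant of P as its action on top-degree forms, so that multiplicativity comes directly
    from [expr_mulmx]. *)
Definition volf P : R := expr P (mono R [set: 'I_7]) [set: 'I_7].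

Lemma top_expr P a : expr P a [set: 'I_7] = volf P * a [set: 'I_7].
Proof.
rewrite /expr (bigD1 [set: 'I_7]) //= big1 ?addr0.
  by rewrite /volf expr_mono mulrC.
move=> I IT; rewrite homog_xmon ?mulr0 // eq_sym.
rewrite eqEcard finset.subsetT /= -ltnNge in IT.
by rewrite neq_ltn IT.
Qed.

(** The star of the metric in which the e^i are orthonormal; [star P] is its conjugate by
    [expr P]. *)
Definition star0 a : lform R := fun J => sgn R (~: J) J * a (~: J).

Lemma starE P a : star P a = expr P (star0 (expr (invmx P) a)).
Proof. by []. Qed.

Lemma star0D a b : star0 (a + b) = star0 a + star0 b.
Proof. by apply: funext => J; rewrite -[RHS]/(star0 a J + star0 b J) /star0 -mulrDr. Qed.
Lemma star0Z (k : R) a : star0 (k *: a) = k *: star0 a.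
Proof. by apply: funext => J; rewrite -[RHS]/(k * star0 a J) /star0 mulrCA. Qed.

Lemma wedge_star0 a b : wedge a (star0 b) [set: 'I_7] = inner a b.
Proof.
rewrite /wedge /inner big_mkcond; apply: eq_bigr => I _.
by rewrite finset.subsetT finset.setTD /star0 finset.setCK mulrACA sgn_sq mul1r.
Qed.

Lemma sgn_swap I J : [disjoint I & J] -> sgn R I J * sgn R J I = (-1) ^+ (#|I| * #|J|).
Proof.
move=> dIJ; rewrite mulnC exprM -prodr_const !sgnE [X in _ * X]exchange_big /= -big_split /=.
apply: eq_bigr => i iI; rewrite -prodr_const -big_split /=; apply: eq_bigr => j jJ.
apply: sign_swap; apply: contraTneq iI => ->.
by rewrite (disjointFl dIJ).
Qed.

Lemma star0K a : star0 (star0 a) = a.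
Proof.
apply: funext => J; rewrite /star0 finset.setCK mulrA sgn_swap.
  (* The two cardinals add up to 7, so one of them is even and the sign is +1: the star is an
     involution in dimension 7. *)
  have := congr1 odd (cardsC J); rewrite card_ord oddD -signr_odd oddM.
  by case: (odd #|J|); case: (odd #|~: J|) => //= _; rewrite mul1r.
by rewrite finset.disjoints_subset.
Qed.

Opaque wedge expr hook.

Lemma hook_wedge_dx u i a :
  hook u (wedge (dx R i) a) = u i *: a - wedge (dx R i) (hook u a).
Proof.
rewrite hook_wedge; suff -> : \sum_j u j * (j == i)%:R = u i by [].
by rewrite (bigD1 i) //= eqxx mulr1 big1 ?addr0 // => j /negbTE ->; rewrite mulr0.
Qed.

Lemma hook_expr P u a :
  hook u (expr P a) = expr P (hook (fun i => \sum_k P i k * u k) a).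
Proof.
elim/lform_ind: a => [a1 a2 h1 h2|k a h| |i a h].
- by rewrite expr_addf !hookD h1 h2 expr_addf.
- by rewrite expr_scalef !hookZ h expr_scalef.
- by rewrite expr_set0 !hook_set0 expr_zerof.
- rewrite expr_dx_wedge hook_wedge h hook_wedge_dx.
  rewrite expr_addf expr_oppf expr_scalef expr_dx_wedge.
  suff -> : \sum_k u k * P i k = \sum_k P i k * u k by [].
  by apply: eq_bigr => k _; rewrite mulrC.
Qed.

Lemma expr_at_set0 P b : expr P b finset.set0 = b finset.set0.
Proof.
elim/lform_ind: b => [a1 a2 h1 h2|k a h| |i a h].
- by rewrite expr_addf addrfctE h1 h2.
- by rewrite expr_scalef scalrfctE h.
- by rewrite expr_set0.
- by rewrite expr_dx_wedge wedge_dx wedge_lin big_set0 inE.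
Qed.

(** Induction on a: wedging with a covector is adjoint to [hook], and [hook_expr] carries the hook
    through [expr M^T]. *)
Lemma inner_expr M a b : inner (expr M a) b = inner a (expr M^T b).
Proof.
elim/lform_ind: a b => [a1 a2 h1 h2 b|k a h b|b|i a h b].
- by rewrite expr_addf !innerDl h1 h2.
- by rewrite expr_scalef !innerZl h.
- by rewrite expr_set0 !inner_mono expr_at_set0.
- rewrite expr_dx_wedge inner_wedge_lin h [dx R i]/dx inner_wedge_lin hook_expr.
  suff -> : M i = (fun j => \sum_k M^T j k * (k == i)%:R) by [].
  apply: funext => j; rewrite (bigD1 i) //= mxE eqxx mulr1 big1 ?addr0 //.
  by move=> k /negbTE ->; rewrite mulr0.
Qed.

Lemma volfM P Q : volf (P *m Q) = volf P * volf Q.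
Proof. by rewrite {1}/volf -expr_mulmx !top_expr /mono eqxx mulr1 mulrC. Qed.

Lemma volf1 : volf 1%:M = 1.
Proof. by rewrite /volf expr_id /mono eqxx. Qed.

Lemma volf_tr M : volf M^T = volf M.
Proof.
rewrite /volf -(inner_mono [set: 'I_7] (expr M^T _)) -inner_expr.
rewrite /inner (bigD1 [set: 'I_7]) //= {2}/mono eqxx mulr1 big1 ?addr0 //.
by move=> I /negbTE; rewrite {2}/mono => ->; rewrite mulr0.
Qed.

Lemma volf_neq0 P : P \in unitmx -> volf P != 0.
Proof.
move=> Pu; apply/eqP => P0; have := volfM P (invmx P).
by rewrite P0 mul0r mulmxV // volf1 => /eqP; rewrite oner_eq0.
Qed.

Lemma wedge_top_inj b c :
  (forall a, wedge a b [set: 'I_7] = wedge a c [set: 'I_7]) -> b = c.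
Proof.
move=> bc; rewrite -(star0K b) -(star0K c); congr star0; apply: funext => I.
by have := bc (mono R I); rewrite -{1}(star0K b) -{1}(star0K c) !wedge_star0 !inner_mono.
Qed.

(** Transformation law of the star, tested against wedge products into top degree: the volume form
    contributes [volf M] and the inner product contributes the inverse transpose. *)
Lemma expr_star0 M b : M \in unitmx ->
  expr M (star0 b) = volf M *: star0 (expr (invmx M)^T b).
Proof.
move=> Mu; apply: wedge_top_inj => a.
have -> : a = expr M (expr (invmx M) a) by rewrite expr_mulmx mulVmx // expr_id.
rewrite -expr_wedge top_expr wedge_star0 wedgeZr.
rewrite -[RHS]/(volf M * wedge _ _ [set: 'I_7]) wedge_star0 [in RHS]inner_expr [in RHS]expr_mulmx.
by rewrite -trmx_mul mulmxV // trmx1 expr_id.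
Qed.

Definition unitvec (i : 'I_7) : 'I_7 -> R := fun j => (j == i)%:R.

Lemma hook_unitvec i a K :
  hook (unitvec i) a K = if i \notin K then (-1) ^+ below i K * a (i |: K) else 0.
Proof.
Transparent hook.
rewrite /hook /unitvec; case: ifP => iK.
  rewrite (bigD1 i) //= eqxx mul1r big1 ?addr0 // => k /andP[_ /negbTE ->].
  by rewrite !mul0r.
rewrite big1 // => k kK; case: eqP => [E|_]; last by rewrite !mul0r.
by rewrite -E kK in iK.
Qed.
Opaque hook.

Lemma hook_unitvec_mono i I :
  hook (unitvec i) (mono R I) = if i \in I then (-1) ^+ below i I *: mono R (I :\ i) else 0.
Proof.
apply: funext => K; rewrite hook_unitvec /mono; case: ifP => iK; last first.
  case: ifP => iI; last by [].
  rewrite scalrfctE; case: eqP => [E|_]; last by rewrite scaler0.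
  by move: iK; rewrite E !inE eqxx.
case: ifP => iI.
  rewrite -[RHS]/(_ * _); have -> : (K == I :\ i) = (i |: K == I).
    by apply/eqP/eqP => [->|<-]; [rewrite finset.setD1K|rewrite setU1K].
  by case: eqP => [<-|_]; [rewrite below_setU1 // ltnn|rewrite !mulr0].
case: eqP => [E|_]; last by rewrite mulr0.
by move: iI; rewrite -E !inE eqxx.
Qed.

Definition omega_h : lform R := e2 R 1 2 + (e2 R 3 4 + e2 R 5 6).
Definition i7 : 'I_7 := inord 6.

Lemma dformE a : dform a = (Num.sqrt 6 / 6) *: wedge omega_h (hook (unitvec i7) a).
Proof.
rewrite [in RHS](lform_decomp a) hook_sum wedge_sumr scaler_sumr.
apply: funext => K; rewrite fct_sumE; apply: eq_bigr => I _.
rewrite hookZ wedgeZr scalrfctE scalrfctE -[RHS]/(_ * (_ * _)) mulrCA; congr (_ * _).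
have de0 i : i != i7 -> de R i = 0.
  move=> i6; rewrite /de; case: eqP => // E.
  by case/eqP: i6; apply: val_inj; rewrite /= inordK.
have de7 : de R i7 = (Num.sqrt 6 / 6) *: omega_h by rewrite /de inordK.
rewrite /dmono hook_unitvec_mono; case: ifP => iI.
  rewrite (bigD1 i7) //= big1 ?addr0; last by move=> i /andP[_ /de0 ->]; rewrite wedge0l mulr0.
  by rewrite de7 wedgeZl wedgeZr !scalrfctE -[_ *: _]/(_ * _) mulrCA.
rewrite wedge0r big1; first by rewrite mulr0.
by move=> i ii; rewrite de0 ?wedge0l ?mulr0 //; apply: contraFneq iI => <-.
Qed.

End HodgeStar.

(** * Computing with sparse forms *)

(* The word [i1; ...; ik] stands for e^{i1} /\ ... /\ e^{ik} with 0-based indices, in any order and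
   possibly with repetitions. All operations are structural fixpoints using [Nat.eqb] and [Nat.ltb],
   so that [sform_cbv] turns an identity between explicit forms into ring identities between
   coefficients. *)
Section SparseForms.
Variable R : realType.
Implicit Types (a b : lform R) (c : R) (I J K : {set 'I_7}).

Definition word := seq nat.
Definition sform := seq (R * word).

Definition formw (w : word) : lform R :=
  foldr (fun i a => wedge (dx R (inord i)) a) (mono R finset.set0) w.
Definition sfval (l : sform) : lform R := foldr (fun t a => t.1 *: formw t.2 + a) 0 l.

Fixpoint eqw (u w : word) : bool :=
  match u, w with
  | [::], [::] => true
  | i :: u', j :: w' => Nat.eqb i j && eqw u' w'
  | _, _ => false
  end.

(** The boolean is the parity of the transpositions made; [None] signals a repeated index, that is,
    a vanishing monomial. *)
Fixpoint ins (i : nat) (w : word) : option (bool * word) :=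
  match w with
  | [::] => Some (false, [:: i])
  | j :: w' => if Nat.ltb i j then Some (false, i :: w) else
               if Nat.eqb i j then None else
               match ins i w' with
               | Some (b, u) => Some (negb b, j :: u)
               | None => None
               end
  end.

Fixpoint nrm (w : word) : option (bool * word) :=
  match w with
  | [::] => Some (false, [::])
  | i :: w' => match nrm w' with
               | Some (b, u) => match ins i u with
                                | Some (b', u') => Some (xorb b b', u')
                                | None => None
                                end
               | None => None
               end
  end.

Fixpoint addt (c : R) (w : word) (l : sform) : sform :=
  match l with
  | [::] => [:: (c, w)]
  | (d, u) :: l' => if eqw u w then (d + c, u) :: l' else (d, u) :: addt c w l'
  end.

Fixpoint norms (l : sform) : sform :=
  match l with
  | [::] => [::]
  | (c, w) :: l' => match nrm w with
                    | Some (b, u) => addt (if b then - c else c) u (norms l')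
                    | None => norms l'
                    end
  end.

Fixpoint catw (u w : word) : word := match u with [::] => w | i :: u' => i :: catw u' w end.
Fixpoint cats (l m : sform) : sform := match l with [::] => m | t :: l' => t :: cats l' m end.
Fixpoint mult (c : R) (w : word) (m acc : sform) : sform :=
  match m with [::] => acc | (d, u) :: m' => (c * d, catw w u) :: mult c w m' acc end.
Fixpoint muls (l m : sform) : sform :=
  match l with [::] => [::] | (c, w) :: l' => mult c w m (muls l' m) end.
Fixpoint scales (c : R) (l : sform) : sform :=
  match l with [::] => [::] | (d, w) :: l' => (c * d, w) :: scales c l' end.
(** The coefficients are negated because [hookw] needs exactly the second term of the antiderivation
    rule. *)
Fixpoint consw (i : nat) (l : sform) : sform :=
  match l with [::] => [::] | (d, w) :: l' => (- d, i :: w) :: consw i l' end.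
Fixpoint hookw (k : nat) (w : word) : sform :=
  match w with
  | [::] => [::]
  | i :: w' => if Nat.eqb i k then (1, w') :: consw i (hookw k w') else consw i (hookw k w')
  end.
Fixpoint hooks (k : nat) (l : sform) : sform :=
  match l with [::] => [::] | (c, w) :: l' => cats (scales c (hookw k w)) (hooks k l') end.
(** Normalizing after every factor merges like terms before they are multiplied further. *)
Fixpoint exprw (rows : nat -> sform) (w : word) : sform :=
  match w with [::] => [:: (1, [::])] | i :: w' => norms (muls (rows i) (exprw rows w')) end.
Fixpoint exprs (rows : nat -> sform) (l : sform) : sform :=
  match l with [::] => [::] | (c, w) :: l' => cats (scales c (exprw rows w)) (exprs rows l') end.
Fixpoint memw (i : nat) (w : word) : bool :=
  match w with [::] => false | j :: w' => Nat.eqb i j || memw i w' end.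
Fixpoint compw (l w : word) : word :=
  match l with [::] => [::] | i :: l' => if memw i w then compw l' w else i :: compw l' w end.
Definition fullw : word := [:: 0; 1; 2; 3; 4; 5; 6]%N.
Fixpoint stars (l : sform) : sform :=
  match l with
  | [::] => [::]
  | (c, w) :: l' => let u := compw fullw w in
      match nrm (catw w u) with
      | Some (b, _) => ((if b then - c else c), u) :: stars l'
      | None => stars l'
      end
  end.
Fixpoint sortedw (w : word) : bool :=
  match w with
  | [::] => true
  | i :: w' => Nat.ltb i 7 && (match w' with [::] => true | j :: _ => Nat.ltb i j end) && sortedw w'
  end.
(** Validity of [stars]: every word is increasing, so that it names a set with sign +1, and together
    with its complement it is a permutation of 0, ..., 6. *)
Fixpoint starok (l : sform) : bool :=
  match l with
  | [::] => true
  | (c, w) :: l' => sortedw w && match nrm (catw w (compw fullw w)) with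
      | Some (_, v) => eqw v fullw && starok l'
      | None => false
      end
  end.
Fixpoint coefs (l : sform) (w : word) : R :=
  match l with [::] => 0 | (c, u) :: l' => if eqw u w then c + coefs l' w else coefs l' w end.
Fixpoint allz (l : sform) : Prop :=
  match l with [::] => True | (c, w) :: l' => c = 0 /\ allz l' end.
Fixpoint sorteds (l : sform) : bool :=
  match l with [::] => true | (_, w) :: l' => sortedw w && sorteds l' end.
Fixpoint okw (w : word) : bool := match w with [::] => true | i :: w' => Nat.ltb i 7 && okw w' end.
Fixpoint oks (l : sform) : bool := match l with [::] => true | (_, w) :: l' => okw w && oks l' end.

Lemma eqwP u w : reflect (u = w) (eqw u w).
Proof.
elim: u w => [|i u IH] [|j w] /=; try by constructor.
apply: (iffP andP) => [[h1 h2]|[ij uw]].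
  by rewrite ((PeanoNat.Nat.eqb_eq i j).1 h1) (elimT (IH w) h2).
by split; [exact/PeanoNat.Nat.eqb_eq|apply/IH].
Qed.
Lemma ltbE i j : Nat.ltb i j = (i < j)%N.
Proof. by apply/idP/idP => [/PeanoNat.Nat.ltb_lt /ssrnat.ltP//|/ssrnat.ltP /PeanoNat.Nat.ltb_lt]. Qed.
Lemma eqbE i j : Nat.eqb i j = (i == j).
Proof. by apply/idP/eqP => [/PeanoNat.Nat.eqb_eq//|/PeanoNat.Nat.eqb_eq]. Qed.

Lemma memwE i w : memw i w = (i \in w).
Proof. by elim: w => //= j w IH; rewrite inE IH eqbE. Qed.

Lemma formw_ins i w : wedge (dx R (inord i)) (formw w) =
  match ins i w with Some (b, u) => (-1) ^+ b *: formw u | None => 0 end.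
Proof.
elim: w => [|j w IH] /=; first by rewrite scale1r.
case: ifP => _; first by rewrite /= scale1r.
case: ifP => [/PeanoNat.Nat.eqb_eq ->|_]; first exact: wedge_lin2.
rewrite wedge_linC IH; case: (ins i w) => [[b u]|]; last by rewrite wedge0r oppr0.
by rewrite wedgeZr -scaleNr signrN.
Qed.

Lemma formw_nrm w : formw w =
  match nrm w with Some (b, u) => (-1) ^+ b *: formw u | None => 0 end.
Proof.
elim: w => [|i w /= ->] /=; first by rewrite scale1r.
case: (nrm w) => [[b u]|]; last exact: wedge0r.
rewrite wedgeZr formw_ins; case: (ins i u) => [[b' u']|]; last by rewrite scaler0.
by rewrite scalerA; case: b; case: b'; rewrite /= ?mulr1 ?mul1r // mulrNN mulr1.
Qed.

Lemma form_addt c w l : sfval (addt c w l) = c *: formw w + sfval l.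
Proof.
elim: l => [|[d u] l IH] //=; case: ifP => [/eqwP ->|_] /=.
  by rewrite scalerDl addrA [d *: _ + _]addrC.
by rewrite IH !addrA [d *: _ + _]addrC.
Qed.

Lemma form_norms l : sfval (norms l) = sfval l.
Proof.
elim: l => [|[c w] l IH] //=; rewrite [formw w]formw_nrm.
case: (nrm w) => [[b u]|]; last by rewrite scaler0 add0r.
by rewrite form_addt IH; case: b; rewrite /= ?scaleN1r ?scale1r ?scalerN ?scaleNr.
Qed.

Lemma form_cats l m : sfval (cats l m) = sfval l + sfval m.
Proof. by elim: l => [|t l IH] /=; rewrite ?add0r // IH addrA. Qed.
Lemma form_scales c l : sfval (scales c l) = c *: sfval l.
Proof. by elim: l => [|[d w] l IH] /=; rewrite ?scaler0 // IH scalerDr scalerA. Qed.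

Lemma formw_catw u w : formw (catw u w) = wedge (formw u) (formw w).
Proof. by elim: u => [|i u IH] /=; rewrite ?wedge_set0l // IH wedgeA. Qed.

Lemma form_muls l m : sfval (muls l m) = wedge (sfval l) (sfval m).
Proof.
elim: l => [|[c w] l IH] /=; first by rewrite wedge0l.
rewrite wedgeDl -IH wedgeZl; elim: m {IH} (muls l m) => [|[d u] m IH] acc /=.
  by rewrite wedge0r scaler0 add0r.
by rewrite IH formw_catw wedgeDr wedgeZr scalerDr scalerA addrA.
Qed.

(** Equality by reflection: after [sform_cbv] the hypothesis is a conjunction of scalar equations,
    one for each word left in the normalized difference. *)
Lemma form_eq l m : allz (norms (cats l (scales (-1) m))) -> sfval l = sfval m.
Proof.
move=> h; apply/eqP; rewrite -subr_eq0 -[X in _ + X]scaleN1r -form_scales -form_cats -form_norms.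
by apply/eqP; elim: (norms _) h => [|[c w] n IH] //= [-> /IH ->]; rewrite scale0r add0r.
Qed.

Lemma form_consw i l : sfval (consw i l) = - wedge (dx R (inord i)) (sfval l).
Proof.
elim: l => [|[d w] l IH] /=; first by rewrite wedge0r oppr0.
by rewrite IH wedgeDr wedgeZr opprD scaleNr.
Qed.

Lemma inord_eq i j : (i < 7)%N -> (j < 7)%N -> (inord i == inord j :> 'I_7) = (i == j).
Proof. by move=> hi hj; rewrite -val_eqE /= !inordK. Qed.

Lemma form_hookw k w : (k < 7)%N -> okw w -> hook (unitvec R (inord k)) (formw w) = sfval (hookw k w).
Proof.
move=> hk; elim: w => [|i w IH] /=; first by rewrite hook_set0.
case/andP; rewrite ltbE => hi /IH {}IH; rewrite hook_wedge_dx IH /unitvec inord_eq // eqbE.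
by case: eqP => _ /=; rewrite form_consw ?scale1r ?scale0r ?add0r.
Qed.

Lemma form_hooks k l : (k < 7)%N -> oks l -> hook (unitvec R (inord k)) (sfval l) = sfval (hooks k l).
Proof.
move=> hk; elim: l => [|[c w] l IH] /=; first by rewrite hook0f.
by case/andP => ow /IH {}IH; rewrite hookD hookZ IH form_hookw // form_cats form_scales.
Qed.

Lemma form_exprs (P : 'M[R]_7) rows l :
  (forall i, (i < 7)%N -> lin (P (inord i)) = sfval (rows i)) -> oks l ->
  expr P (sfval l) = sfval (exprs rows l).
Proof.
move=> hP; elim: l => [|[c w] l IH] /=; first by rewrite expr_zerof.
case/andP => ow /IH {}IH; rewrite expr_addf expr_scalef IH form_cats form_scales.
suff -> : expr P (formw w) = sfval (exprw rows w) by [].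
elim: w ow => [_|i w IHw] /=; first by rewrite expr_set0 scale1r addr0.
case/andP; rewrite ltbE => hi /IHw {}IHw.
by rewrite expr_dx_wedge IHw form_norms form_muls hP.
Qed.

Definition setw (w : word) : {set 'I_7} := [set x : 'I_7 | memw x w].

Lemma formw_sorted w : sortedw w -> formw w = mono R (setw w).
Proof.
elim: w => [|i w IH] /=; first by move=> _; congr mono; apply/setP => x; rewrite !inE.
case/andP => /andP[]; rewrite ltbE => hi hw sw; rewrite IH //.
have hlt j : j \in w -> (i < j)%N.
  elim: w i {IH hi} hw sw => [//|k w IH] i /=; rewrite !ltbE => ik /andP[/andP[_ kw] sw].
  by rewrite inE => /orP[/eqP ->//|/(IH _ kw sw)]; exact: ltn_trans.
rewrite wedge_dx_mono !inE memwE inordK //; case: ifP => [/hlt|_]; first by rewrite ltnn.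
have -> : below (inord i) (setw w) = 0%N.
  rewrite belowE big1 // => j; rewrite inE memwE inordK // => /hlt ij.
  by rewrite ltnNge ltnW.
rewrite scale1r; congr mono; apply/setP => x; rewrite !inE /= eqbE.
by rewrite -val_eqE /= inordK.
Qed.

Lemma setw_inj u w : sortedw u -> sortedw w -> setw u = setw w -> u = w.
Proof.
have sE v : sortedw v -> sorted ltn v /\ all (fun i => (i < 7)%N) v.
  elim: v => [//|i v IH] /= /andP[/andP[hi hv] /IH[sv av]]; rewrite -ltbE hi av.
  by split=> //; case: v sv hv {IH av} => //= j v -> ; rewrite ltbE => ->.
move=> su sw E; have [su' au] := sE _ su; have [sw' aw] := sE _ sw.
apply: (irr_sorted_eq ltn_trans ltnn su' sw') => i.
have [hi|hi] := boolP (i < 7)%N.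
  by move/setP/(_ (Ordinal hi)): E; rewrite !inE !memwE.
by apply/idP/idP => [/(allP au)|/(allP aw)]; rewrite (negbTE hi).
Qed.

Lemma form_coefs l w : sorteds l -> sortedw w -> sfval l (setw w) = coefs l w.
Proof.
move=> + sw; elim: l => [//|[c u] l IH] /= /andP[su /IH {}IH].
rewrite addrfctE scalrfctE IH formw_sorted // /mono.
case: eqwP => [->|uw]; first by rewrite eqxx -[_ *: _]/(_ * _) mulr1.
case: eqP => [/esym/(setw_inj su sw)//|_]; by rewrite scaler0 add0r.
Qed.

Lemma mono_full : mono R [set: 'I_7] = formw fullw.
Proof.
rewrite formw_sorted //; congr mono; apply/setP => x; rewrite !inE memwE.
by case: x => [[|[|[|[|[|[|[|]]]]]]]] .
Qed.

Lemma form_top l : sorteds l -> sfval l [set: 'I_7] = coefs l fullw.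
Proof.
move=> sl; rewrite -form_coefs //; congr (sfval l _); apply/setP => x; rewrite !inE memwE.
by case: x => [[|[|[|[|[|[|[|]]]]]]]] .
Qed.

Lemma star0_mono I : star0 (mono R I) = sgn R I (~: I) *: mono R (~: I).
Proof.
apply: funext => J; rewrite /star0 /mono scalrfctE -[RHS]/(_ * _).
have -> : (~: J == I) = (J == ~: I).
  by apply/eqP/eqP => [<-|->]; rewrite finset.setCK.
by case: eqP => [->|_]; rewrite ?finset.setCK ?mulr0.
Qed.

Lemma wedge_monoC I : wedge (mono R I) (mono R (~: I)) = sgn R I (~: I) *: mono R [set: 'I_7].
Proof.
Transparent wedge.
apply: funext => K; rewrite /wedge /mono scalrfctE -[RHS]/(_ * _).
have [IK|IK] := boolP (I \subset K); last first.
  rewrite big1 ?[RHS](_ : _ = 0) //.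
    by case: eqP => [E|]; rewrite ?mulr0 //; rewrite E finset.subsetT in IK.
  by move=> J JK; case: eqP => [E|_]; rewrite ?mulr0 ?mul0r // -E JK in IK *.
rewrite (bigD1 I) //= eqxx big1 ?addr0; last by move=> J /andP[_ /negbTE ->]; rewrite mulr0 mul0r.
have -> : (K :\: I == ~: I) = (K == [set: 'I_7]).
  apply/eqP/eqP => [E|->]; last by rewrite finset.setTD.
  by rewrite -(finset.setID K I) E (finset.setIidPr IK) finset.setUCr.
by case: eqP => [->|_]; rewrite ?finset.setTD ?mulr0 // !mulr1.
Qed.
Opaque wedge.

Lemma sortedwE w : sortedw w = sorted ltn w && all (fun i => i < 7)%N w.
Proof.
elim: w => [//|i w IH] /=; rewrite IH ltbE; case: w {IH} => [|j w] //=; first by rewrite !andbT.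
by rewrite ltbE; case: (i < 7)%N; rewrite ?andbF //= -!andbA.
Qed.

Lemma compwE l w : compw l w = [seq i <- l | i \notin w].
Proof. by elim: l => //= i l ->; rewrite memwE; case: (i \in w). Qed.

Lemma sortedw_comp w : sortedw (compw fullw w).
Proof.
rewrite sortedwE compwE; apply/andP; split; first by apply: sorted_filter => //; exact: ltn_trans.
by apply/allP => i; rewrite mem_filter => /andP[_]; move: i; apply/allP.
Qed.

Lemma setw_comp w : setw (compw fullw w) = ~: setw w.
Proof.
apply/setP => x; rewrite !inE compwE !memwE mem_filter andb_idr // => _.
by case: x => [[|[|[|[|[|[|[|]]]]]]]].
Qed.

Lemma form_stars l : starok l -> star0 (sfval l) = sfval (stars l).
Proof.
elim: l => [_|[c w] l IH] /=; first by have := star0Z (0 : R) 0; rewrite !scale0r.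
case/andP => sw; case E: (nrm _) => [[b v]|] // /andP[/eqwP ev /IH {}IH].
rewrite star0D star0Z IH /=.
suff -> : star0 (formw w) = (-1) ^+ b *: formw (compw fullw w).
  by case: b {E}; rewrite ?scale1r // scaleN1r scalerN scaleNr.
rewrite (formw_sorted sw) star0_mono -setw_comp -formw_sorted ?sortedw_comp //; congr (_ *: _).
(* The parity found by sorting w followed by its complement is identified with [sgn] by comparing
   top coefficients. *)
have := formw_nrm (catw w (compw fullw w)); rewrite E ev -mono_full formw_catw.
rewrite (formw_sorted sw) (formw_sorted (sortedw_comp w)) setw_comp wedge_monoC.
move/(congr1 (fun f : lform R => f [set: 'I_7])); rewrite !scalrfctE /mono eqxx.
by rewrite -![_ *: _]/(_ * _) !mulr1.
Qed.

Lemma e3E i j k : (i < j)%N -> (j < k)%N -> (k < 7)%N ->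
  e3 R i.+1 j.+1 k.+1 = formw [:: i; j; k].
Proof.
move=> ij jk k7; have j7 := ltn_trans jk k7; have i7 := ltn_trans ij j7.
rewrite formw_sorted; last by rewrite /= !ltbE i7 j7 k7 ij jk.
congr mono; apply/setP => x; rewrite !inE /= !eqbE -!val_eqE /= !inordK //.
by rewrite orbF orbA.
Qed.

Lemma e2E i j : (i < j)%N -> (j < 7)%N -> e2 R i.+1 j.+1 = formw [:: i; j].
Proof.
move=> ij j7; have i7 := ltn_trans ij j7.
rewrite formw_sorted; last by rewrite /= !ltbE i7 j7 ij.
congr mono; apply/setP => x; rewrite !inE /= !eqbE -!val_eqE /= !inordK //.
by rewrite orbF.
Qed.

Arguments formw _%_seq_scope : simpl never.

Definition phi0_s : sform := [:: (1, [:: 0; 1; 6]%N); (1, [:: 2; 3; 6]%N); (1, [:: 4; 5; 6]%N);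
  (1, [:: 0; 2; 4]%N); (-1, [:: 0; 3; 5]%N); (-1, [:: 1; 2; 5]%N); (-1, [:: 1; 3; 4]%N)].

Lemma phi0E : phi0 R = sfval phi0_s.
Proof.
rewrite /sfval /phi0_s /= -!e3E //; apply: funext => I.
by rewrite !addrfctE !scalrfctE /phi0 -![_ *: _]/(_ * _) !mulN1r !mul1r !addrA addr0.
Qed.

End SparseForms.

Arguments formw {R} w : simpl never.

Ltac sform_cbv := cbv [norms cats scales muls mult consw hookw hooks exprw exprs stars
  starok sortedw sorteds oks okw coefs allz addt nrm ins eqw catw memw compw fullw
  PeanoNat.Nat.eqb PeanoNat.Nat.ltb PeanoNat.Nat.leb Nat.eqb Nat.ltb Nat.leb andb orb negb xorb phi0_s].

(** * The group G2 *)

Section G2Algebra.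
Variable R : realType.
Implicit Types (a b : lform R) (u v : 'I_7 -> R) (P Q M : 'M[R]_7).

Lemma hook_decomp u a : hook u a = \sum_i u i *: hook (unitvec R i) a.
Proof.
elim/lform_ind: a => [a1 a2 h1 h2|k a h| |i a h].
- rewrite hookD h1 h2 -big_split /=; apply: eq_bigr => i _.
  by rewrite hookD scalerDr.
- rewrite hookZ h scaler_sumr; apply: eq_bigr => i _.
  by rewrite hookZ scalerA mulrC -scalerA.
- by rewrite hook_set0 big1 // => i _; rewrite hook_set0 scaler0.
- rewrite hook_wedge_dx h wedge_sumr.
  under [RHS]eq_bigr => j _ do rewrite hook_wedge_dx scalerBr -wedgeZr.
  rewrite sumrB; congr (_ - _).
  rewrite (bigD1 i) //= /unitvec eqxx scale1r big1 ?addr0 //.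
  by move=> j; rewrite eq_sym => /negbTE ->; rewrite scale0r scaler0.
Qed.

(* Bryant's bilinear form: it recovers [6 (u . v)] from [phi0], so stabilizers are orthogonal. *)
Definition bform a u v : R := wedge (wedge (hook u a) (hook v a)) a [set: 'I_7].

Lemma bform_expr P a u v :
  bform (expr P a) u v =
  volf P * bform a (fun i => \sum_k P i k * u k) (fun i => \sum_k P i k * v k).
Proof. by rewrite /bform !hook_expr -!expr_wedge top_expr. Qed.

Lemma bform_decomp a u v :
  bform a u v = \sum_i \sum_j u i * v j * bform a (unitvec R i) (unitvec R j).
Proof.
rewrite /bform (hook_decomp u) (hook_decomp v) !wedge_suml fct_sumE; apply: eq_bigr => i _.
rewrite wedge_sumr wedge_suml fct_sumE; apply: eq_bigr => j _.
by rewrite wedgeZl wedgeZr !wedgeZl scalerA scalrfctE.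
Qed.

Lemma inordE (i : 'I_7) : i = inord i.
Proof. by apply: val_inj; rewrite /= inordK. Qed.

Lemma bform_phi0_unit (i j : 'I_7) :
  bform (phi0 R) (unitvec R i) (unitvec R j) = 6 * (i == j)%:R.
Proof.
rewrite /bform phi0E; rewrite (inordE i) (inordE j) !form_hooks //.
rewrite -!form_muls -form_norms inord_eq //.
move: (nat_of_ord i) (ltn_ord i) => {}i hi; move: (nat_of_ord j) (ltn_ord j) => {}j hj.
case: i hi => [|[|[|[|[|[|[|i]]]]]]] // _; case: j hj => [|[|[|[|[|[|[|j]]]]]]] // _;
(rewrite form_top; [|by sform_cbv]); sform_cbv => /=; ring.
Qed.

Lemma bform_phi0 u v : bform (phi0 R) u v = 6 * \sum_i u i * v i.
Proof.
rewrite bform_decomp mulr_sumr; apply: eq_bigr => i _.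
rewrite (bigD1 i) //= bform_phi0_unit eqxx big1 ?addr0; first by rewrite mulr1 mulrC.
by move=> j; rewrite bform_phi0_unit eq_sym => /negbTE ->; rewrite mulr0 mulr0.
Qed.

Lemma expr_scalar_mx (k : R) a n : homog n a -> expr k%:M a = k ^+ n *: a.
Proof.
suff h I : expr k%:M (mono R I) = k ^+ #|I| *: mono R I.
  move=> ha; rewrite [in LHS](lform_decomp a) [in RHS](lform_decomp a) expr_sumf scaler_sumr.
  apply: eq_bigr => I _; rewrite expr_scalef h !scalerA mulrC.
  by have [<-//|/ha ->] := eqVneq #|I| n; rewrite !mulr0.
move: {2}#|I| (erefl #|I|) => m; elim: m I => [|m IH] I.
  by move/eqP; rewrite cards_eq0 => /eqP ->; rewrite expr_set0 cards0 scale1r.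
have [->|[i iI]] := set_0Vmem I; first by rewrite cards0.
move=> cI; have cI' : #|I :\ i| = m by move: cI; rewrite (cardsD1 i) iI => -[].
have -> : mono R I = (-1) ^+ below i (I :\ i) *: wedge (dx R i) (mono R (I :\ i)).
  rewrite wedge_dx_mono !inE eqxx /= finset.setD1K // scalerA -expr2 sqrr_sign scale1r //.
rewrite expr_scalef expr_dx_wedge IH // wedgeZr cI' cI.
suff -> : lin (k%:M i) = k *: dx R i.
  by rewrite wedgeZl !scalerA; congr (_ *: _); rewrite exprS; ring.
rewrite lin_dx (bigD1 i) //= mxE eqxx mulr1n big1 ?addr0 //.
by move=> j; rewrite mxE eq_sym => /negbTE ->; rewrite mulr0n scale0r.
Qed.

Lemma volf_scalar (k : R) : volf (k%:M : 'M[R]_7) = k ^+ 7.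
Proof.
rewrite /volf (@expr_scalar_mx k _ 7).
  by rewrite scalrfctE /mono eqxx -[LHS]/(_ * _) mulr1.
move=> I hI; rewrite /mono; have [E|] := eqVneq I [set: 'I_7]; last by [].
by move: hI; rewrite E cardsT card_ord.
Qed.

Lemma expn9_eq1 (x : R) : x ^+ 9 = 1 -> x = 1.
Proof.
move=> x9; have x0 : 0 <= x.
  rewrite leNgt; apply/negP => x0; have : x ^+ 9 <= 0.
    by rewrite exprS; apply: mulr_le0_ge0; [exact: ltW|exact: exprn_even_ge0].
  by rewrite x9 ler10.
by apply/eqP; rewrite -(@pexpr_eq1 _ x 9) // x9.
Qed.

Lemma hook_col M (v : 'I_7) : (fun k => \sum_l M k l * unitvec R v l) = (fun k => M k v).
Proof.
apply: funext => k; rewrite (bigD1 v) //= /unitvec eqxx mulr1 big1 ?addr0 //.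
by move=> l /negbTE ->; rewrite mulr0.
Qed.

Lemma bformZ (k : R) a u v : bform (k *: a) u v = k ^+ 3 * bform a u v.
Proof.
rewrite /bform !hookZ !wedgeZl !wedgeZr !wedgeZl !scalerA scalrfctE -[LHS]/(_ * _).
by congr (_ * _); ring.
Qed.

(** Bryant's form of [expr M (phi0 R)] is computed in two ways: by naturality ([bform_expr]) and by
    its cubic homogeneity. *)
Lemma bform_gram M (k : R) : expr M (phi0 R) = k *: phi0 R ->
  volf M *: (M^T *m M) = (k ^+ 3)%:M.
Proof.
move=> hM; apply/matrixP => i j; rewrite !mxE.
have := bform_expr M (phi0 R) (unitvec R i) (unitvec R j).
rewrite hM bformZ !hook_col bform_phi0_unit bform_phi0.
rewrite [LHS]mulrCA [RHS]mulrCA => /(mulfI _) E; rewrite -mulr_natr E.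
  by congr (_ * _); apply: eq_bigr => l _; rewrite mxE.
by rewrite pnatr_eq0.
Qed.

Lemma G2_stab M : expr M (phi0 R) = phi0 R ->
  [/\ M \in unitmx, M^T *m M = 1%:M & volf M = 1].
Proof.
move=> hM; have E : volf M *: (M^T *m M) = 1%:M.
  by rewrite (@bform_gram M 1) ?expr1n // scale1r.
have v1 : volf M = 1.
  (* The volume of the Gram identity is (volf M)^7 (volf M)^2 = 1; the odd exponent leaves only volf
     M = 1. *)
  apply: expn9_eq1; have := congr1 (@volf R) E.
  by rewrite -mul_scalar_mx !volfM volf_tr volf_scalar volf1 => <-; ring.
rewrite v1 scale1r in E; split=> //.
by case/mulmx1_unit: E.
Qed.

Lemma expr_star0_SO M a : M \in unitmx -> M^T *m M = 1%:M -> volf M = 1 ->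
  expr M (star0 a) = star0 (expr M a).
Proof.
move=> Mu MM v1; rewrite expr_star0 // v1 scale1r; congr (star0 (expr _ _)).
have -> : invmx M = M^T by rewrite -[RHS]mulmx1 -(mulmxV Mu) mulmxA MM mul1mx.
by rewrite trmxK.
Qed.

Lemma adapted_unit (phi : lform R) P : adapted phi P -> P \in unitmx.
Proof. by case; rewrite unitmxE unitfE. Qed.

(** Two adapted bases differ by a stabilizer M of [phi0], which lies in SO(7) and so commutes with
    [star0]. Hence the choice made in [adapted_basis] is harmless. *)
Lemma star_adapted (phi : lform R) P Q a : adapted phi P -> adapted phi Q -> star P a = star Q a.
Proof.
move=> aP aQ; have Pu := adapted_unit aP; have Qu := adapted_unit aQ.
have [_ eP] := aP; have [_ eQ] := aQ; rewrite !starE.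
pose M := P *m invmx Q.
have PM : P = M *m Q by rewrite -mulmxA mulVmx // mulmx1.
have Mu : M \in unitmx by rewrite unitmx_mul Pu unitmx_inv.
have hM : expr M (phi0 R) = phi0 R.
  have := congr1 (expr (invmx Q)) eQ; rewrite {1}eP !expr_mulmx mulmxV // expr_id.
  by rewrite -/M.
have [_ MM v1] := G2_stab hM.
rewrite {1}PM -expr_mulmx expr_star0_SO //.
suff -> : expr M (expr (invmx P) a) = expr (invmx Q) a by [].
by rewrite expr_mulmx /M mulmxA mulVmx // mul1mx.
Qed.

Lemma hodge_adapted (phi : lform R) P a : adapted phi P -> hodge phi a = star P a.
Proof.
move=> aP; apply: (star_adapted _ _ aP); rewrite /adapted_basis.
by apply: ClassicalEpsilon.epsilon_spec; exists P.
Qed.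

Definition psi0 : lform R := star0 (phi0 R).

Lemma hodge_phi (phi : lform R) P : adapted phi P -> hodge phi phi = expr P psi0.
Proof.
move=> aP; rewrite (hodge_adapted _ aP) starE; have Pu := adapted_unit aP.
by case: aP => _ ->; rewrite expr_mulmx mulmxV // expr_id.
Qed.

Lemma hodge_expr (phi : lform R) P a : adapted phi P -> hodge phi (expr P a) = expr P (star0 a).
Proof.
move=> aP; rewrite (hodge_adapted _ aP) starE; have Pu := adapted_unit aP.
by rewrite expr_mulmx mulmxV // expr_id.
Qed.

(** Through the star, the inverse transpose N of M multiplies [phi0] by v = 1 / volf M. Volumes in
    the Gram identity give v^9 = v^21, so v = 1; then N lies in SO(7) and equals M. The sign of the
    volume excludes -1, which fixes [psi0] but not [phi0]. *)
Lemma psi0_stab M : M \in unitmx -> 0 < volf M -> expr M psi0 = psi0 ->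
  expr M (phi0 R) = phi0 R.
Proof.
move=> Mu v0; rewrite /psi0 expr_star0 // -star0Z => /(congr1 (@star0 R)); rewrite !star0K.
set N := (invmx M)^T; have v0' : volf M != 0 by rewrite gt_eqF.
have vN : volf N = (volf M)^-1.
  apply: (mulfI v0'); rewrite mulfV // /N volf_tr -volfM mulmxV // volf1 //.
move=> E; have {}E : expr N (phi0 R) = (volf M)^-1 *: phi0 R.
  by rewrite -[in RHS]E scalerA mulVf // scale1r.
have v1 : volf M = 1.
  have := congr1 (@volf R) (bform_gram E).
  rewrite -mul_scalar_mx !volfM volf_tr !volf_scalar vN -exprM => Ew.
  have w0 : 0 < (volf M)^-1 by rewrite invr_gt0.
  have : (volf M)^-1 ^+ 9 * (volf M)^-1 ^+ 12 = (volf M)^-1 ^+ 9 * 1.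
    by rewrite mulr1 -exprD -[(9 + 12)%N]/(3 * 7)%N -Ew; ring.
  move/(mulfI (expf_neq0 9 (lt0r_neq0 w0)))/eqP.
  by rewrite (pexpr_eq1 _ (ltW w0)) // invr_eq1 => /eqP.
rewrite v1 invr1 scale1r in E; have [Nu NN _] := G2_stab E.
have NM : N = M.
  have MN : N^T *m M = 1%:M by rewrite trmxK mulVmx.
  have NTu : N^T \in unitmx by rewrite unitmx_tr.
  by apply: (can_inj (mulKmx NTu)); rewrite NN MN.
by rewrite -NM.
Qed.

Fixpoint singles (l : sform R) : bool :=
  match l with
  | [::] => true
  | (_, [:: j]) :: l' => Nat.ltb j 7 && singles l'
  | _ => false
  end.
Fixpoint evalrow (l : sform R) (u : 'I_7 -> R) : R :=
  match l with
  | (c, [:: j]) :: l' => c * u (inord j) + evalrow l' u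
  | _ => 0
  end.

Definition mxrows (rows : nat -> sform R) : 'M[R]_7 :=
  \matrix_(i, j) coefs (rows i) [:: nat_of_ord j].

Lemma lin_mxrows rows i : (i < 7)%N -> singles (rows i) ->
  lin ((mxrows rows) (inord i)) = sfval (rows i).
Proof.
move=> hi; rewrite lin_dx.
under eq_bigr => j _ do rewrite mxE inordK //.
elim: (rows i) => [_|[c [|k [|? ?]]] l IH] //=.
  by rewrite big1 // => j _; rewrite scale0r.
case/andP; rewrite ltbE => hk /IH <-; rewrite (bigD1 (inord k)) //= [in RHS](bigD1 (inord k)) //=.
rewrite inordK // eqbE eqxx /= scalerDl addrA [formw _]/(foldr _ _ _) /= wedge_set0r; congr (_ + _).
apply: eq_bigr => j jk; rewrite eqbE andbT; case: eqP => // E.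
by case/eqP: jk; apply: val_inj; rewrite /= inordK.
Qed.

Lemma mxrows_mul rows i u : (i < 7)%N -> singles (rows i) ->
  \sum_k mxrows rows (inord i) k * u k = evalrow (rows i) u.
Proof.
move=> hi.
under eq_bigr => j _ do rewrite mxE inordK //.
elim: (rows i) => [_|[c [|k [|? ?]]] l IH] //=.
  by rewrite big1 // => j _; rewrite mul0r.
case/andP; rewrite ltbE => hk /IH <-; rewrite (bigD1 (inord k)) //= [in RHS](bigD1 (inord k)) //=.
rewrite inordK // eqbE eqxx /= mulrDl addrA; congr (_ + _).
apply: eq_bigr => j jk; rewrite eqbE andbT; case: eqP => // E.
by case/eqP: jk; apply: val_inj; rewrite /= inordK.
Qed.

Definition rotrows (c s : R) (i j k l n : nat) : sform R :=
  if Nat.eqb n i then [:: (c, [:: i]); (- s, [:: j])] else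
  if Nat.eqb n j then [:: (s, [:: i]); (c, [:: j])] else
  if Nat.eqb n k then [:: (c, [:: k]); (s, [:: l])] else
  if Nat.eqb n l then [:: (- s, [:: k]); (c, [:: l])] else [:: (1, [:: n])].

(* Rotating the planes (i, j) and (k, l) by opposite angles preserves [phi0]. *)
Definition rotplanes := [:: (0, 1, 2, 3); (2, 3, 4, 5); (2, 0, 1, 3);
  (4, 5, 0, 1); (4, 2, 3, 5); (6, 4, 3, 0)]%N.

Lemma rot_phi0 (c s : R) i j k l : (i, j, k, l) \in rotplanes -> c * c + s * s = 1 ->
  expr (mxrows (rotrows c s i j k l)) (phi0 R) = phi0 R.
Proof.
move=> H h; rewrite phi0E (@form_exprs _ _ (rotrows c s i j k l)); [|move=> n hn|by sform_cbv].
  apply: form_eq.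
  (* Reductions of the cubes modulo c^2 + s^2 = 1; with them the coefficient identities are linear
     in the remaining monomials. *)
  have hc : c * c * c = c - s * s * c by rewrite -[in X in X - _](mulr1 c) -h; ring.
  have hs : s * s * s = s - c * c * s by rewrite -[in X in X - _](mulr1 s) -h; ring.
  move: H; rewrite !inE => /orP[|/orP[|/orP[|/orP[|/orP[]]]]] /eqP[-> -> -> ->];
  cbv [rotrows]; sform_cbv; do ?split; lra.
rewrite lin_mxrows //.
move: H; rewrite !inE => /orP[|/orP[|/orP[|/orP[|/orP[]]]]] /eqP[-> -> -> ->];
  by case: n hn => [|[|[|[|[|[|[|]]]]]]].
Qed.

Definition mulv M u : 'I_7 -> R := fun i => \sum_k M i k * u k.

Lemma mulv_mulmx M N u : mulv (M *m N) u = mulv M (mulv N u).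
Proof.
apply: funext => i; rewrite /mulv.
under eq_bigr => k _ do rewrite mxE mulr_suml.
rewrite exchange_big /=; apply: eq_bigr => k _; rewrite mulr_sumr.
by apply: eq_bigr => l _; rewrite mulrA.
Qed.

(** The angle turns (u_i, u_j) onto the nonnegative i-axis. The pair (k, l) is turned by the
    opposite angle, so it keeps its zeros only when both coordinates vanish. *)
Lemma rot_step i j k l u : (i, j, k, l) \in rotplanes ->
  exists M, [/\ expr M (phi0 R) = phi0 R, mulv M u (inord j) = 0, 0 <= mulv M u (inord i),
    u (inord k) = 0 -> u (inord l) = 0 -> mulv M u (inord k) = 0 /\ mulv M u (inord l) = 0 &
    forall n, n \notin [:: i; j; k; l] -> (n < 7)%N -> mulv M u (inord n) = u (inord n)].
Proof.
move=> H; set x := u (inord i); set y := u (inord j).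
have [c [s [h hy hx]]] : exists c s, [/\ c * c + s * s = 1, s * x + c * y = 0 & 0 <= c * x - s * y].
  pose r := Num.sqrt (x ^+ 2 + y ^+ 2).
  have r2 : r ^+ 2 = x ^+ 2 + y ^+ 2 by rewrite sqr_sqrtr // addr_ge0 ?sqr_ge0.
  (* If both coordinates vanish, the identity rotation serves. *)
  have [r0|r0] := eqVneq r 0.
    exists 1, 0; move: r2; rewrite r0 expr0n /= => r2.
    have y0 : y = 0 by apply/eqP; rewrite -sqrf_eq0; apply/eqP; nra.
    have x0 : x = 0 by apply/eqP; rewrite -sqrf_eq0; apply/eqP; nra.
    by rewrite x0 y0; split; lra.
  exists (x / r), (- y / r); split.
  - have -> : x / r * (x / r) + - y / r * (- y / r) = (x ^+ 2 + y ^+ 2) / r ^+ 2 by field.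
    by rewrite -r2 divff // expf_neq0.
  - by field.
  - have -> : x / r * x - - y / r * y = (x ^+ 2 + y ^+ 2) / r by field.
    by rewrite -r2 divr_ge0 ?sqr_ge0 // sqrtr_ge0.
exists (mxrows (rotrows c s i j k l)); split; first exact: rot_phi0.
all: move: H hy hx; rewrite /x /y !inE => /orP[|/orP[|/orP[|/orP[|/orP[]]]]] /eqP[-> -> -> ->] hy hx.
all: rewrite /mulv.
all: try by rewrite mxrows_mul //= addr0.
all: try by move=> k0 l0; rewrite !mxrows_mul //= k0 l0 !mulr0 !addr0.
all: try by rewrite mxrows_mul //= addr0 mulNr.
all: by case=> [|[|[|[|[|[|[|n]]]]]]] //= _ _; rewrite mxrows_mul //= mul1r addr0.
Qed.

(* Six double rotations kill the coordinates 2, 4, 1, 6, 3, 5 in turn. *)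
Lemma G2_ray u : exists M, expr M (phi0 R) = phi0 R /\
  (forall i : 'I_7, i != i7 -> mulv M u i = 0) /\ 0 <= mulv M u i7.
Proof.
have [M1 [f1 z1 _ _ _]] := @rot_step 0 1 2 3 u isT.
have [M2 [f2 z2 _ _ k2]] := @rot_step 2 3 4 5 (mulv M1 u) isT.
have [M3 [f3 z3 _ o3 k3]] := @rot_step 2 0 1 3 (mulv M2 (mulv M1 u)) isT.
have [M4 [f4 z4 _ o4 k4]] := @rot_step 4 5 0 1 (mulv M3 (mulv M2 (mulv M1 u))) isT.
have [M5 [f5 z5 _ o5 k5]] := @rot_step 4 2 3 5 (mulv M4 (mulv M3 (mulv M2 (mulv M1 u)))) isT.
have [M6 [f6 z6 p6 o6 k6]] := @rot_step 6 4 3 0 (mulv M5 (mulv M4 (mulv M3 (mulv M2 (mulv M1 u))))) isT.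
exists (M6 *m (M5 *m (M4 *m (M3 *m (M2 *m M1))))).
rewrite -!expr_mulmx f6 f5 f4 f3 f2 f1 !mulv_mulmx; split=> //; split=> // i.
(* Earlier zeros must survive each later rotation: the [o] facts keep a companion pair that is
   already zero, the [k] facts a coordinate outside both planes. *)
have [a1 a3] := o3 (etrans (k2 1%N isT isT) z1) z2.
have [b0 b1] := o4 z3 a1.
have a3' := etrans (k4 3%N isT isT) a3.
have [c3 c5] := o5 a3' z4.
have c0 := etrans (k5 0%N isT isT) b0.
have [d3 d0] := o6 c3 c0.
have d1 := etrans (k6 1%N isT isT) (etrans (k5 1%N isT isT) b1).
have d2 := etrans (k6 2%N isT isT) z5.
have d5 := etrans (k6 5%N isT isT) c5.
rewrite (inordE i); move: (nat_of_ord i) (ltn_ord i) => {i} i hi.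
by rewrite inord_eq //; case: i hi => [|[|[|[|[|[|[|i]]]]]]].
Qed.

End G2Algebra.

(** * Torsion and the right-hand side of the flow *)

Section Flow.
Variable R : realType.
Implicit Types (a b : lform R) (u v : 'I_7 -> R) (P Q M : 'M[R]_7).

Local Notation e7 := (unitvec R i7).

Lemma lform_addE a b K : (a + b) K = a K + b K. Proof. by []. Qed.
Lemma lform_scaleE (k : R) a K : (k *: a) K = k * a K. Proof. by []. Qed.

Lemma faddE a b : fadd a b = a + b. Proof. by []. Qed.
Lemma fscaleE (k : R) a : fscale k a = k *: a. Proof. by []. Qed.

Lemma homog_expr P n a : homog n a -> homog n (expr P a).
Proof.
move=> ha K hK; rewrite (lform_decomp a) expr_sumf fct_sumE big1 // => I _.
rewrite expr_scalef expr_mono scalrfctE.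
have [In|/ha ->] := eqVneq #|I| n; last by rewrite scale0r.
by rewrite homog_xmon ?scaler0 // In.
Qed.

Lemma setw_enum (K : {set 'I_7}) : K = setw [seq val x | x <- enum K].
Proof.
apply/setP => x; rewrite inE memwE mem_map ?mem_enum //; exact: val_inj.
Qed.

Lemma sortedw_enum (K : {set 'I_7}) : sortedw [seq val x | x <- enum K].
Proof.
rewrite sortedwE sorted_map enum_sorted /=; apply/allP => x /mapP[y _ ->] /=.
exact: ltn_ord.
Qed.

(** Turns an abstract form with known support into a sparse one, whose coefficients remain unknown
    scalars. *)
Lemma sfval_eq a (l : sform R) (ws : seq word) :
  l = [seq (a (setw w), w) | w <- ws] -> uniq ws -> all sortedw ws ->
  (forall w, sortedw w -> w \notin ws -> a (setw w) = 0) -> a = sfval l.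
Proof.
move=> -> uw sw ha; apply: funext => K; rewrite (setw_enum K).
have := sortedw_enum K; move: [seq val x | x <- enum K] => w hw.
rewrite form_coefs //; last by elim: ws uw sw {ha} => //= v ws IH /andP[_ uw] /andP[-> sw]; exact: IH.
have [wi|wi] := boolP (w \in ws); last rewrite ha //.
  elim: ws uw sw wi {ha} => //= v ws IH /andP[vw uw] /andP[_ sw].
  rewrite inE; case: eqwP => [vE|vn] /=.
    subst v; move=> _; rewrite -[LHS]addr0; congr (_ + _).
    elim: ws vw {IH uw sw} => //= x ws IH; rewrite inE negb_or => /andP[vx /IH <-].
    by case: eqwP => // E; case/eqP: vx; rewrite E.
  by move=> /orP[/eqP wv|]; [case: vn|exact: IH].
elim: ws wi {uw sw ha} => //= x ws IH; rewrite inE negb_or => /andP[vx /IH <-].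
by case: eqwP => // E; case/eqP: vx; rewrite E.
Qed.

Definition words2 : seq word := [:: [:: 0; 1]; [:: 0; 2]; [:: 0; 3]; [:: 0; 4]; [:: 0; 5];
  [:: 1; 2]; [:: 1; 3]; [:: 1; 4]; [:: 1; 5]; [:: 2; 3]; [:: 2; 4]; [:: 2; 5];
  [:: 3; 4]; [:: 3; 5]; [:: 4; 5]]%N.

Lemma hook7_eq0 a : hook e7 a = 0 -> forall K : {set 'I_7}, i7 \in K -> a K = 0.
Proof.
move=> ha K K7; have := congr1 (fun f : lform R => f (K :\ i7)) ha.
rewrite hook_unitvec !inE eqxx /= finset.setD1K // => /eqP.
by rewrite mulf_eq0 signr_eq0 => /eqP.
Qed.

Lemma card_setw w : sortedw w -> #|setw w| = size w.
Proof.
move=> sw; pose K := setw w.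
have -> : w = [seq val x | x <- enum K].
  by apply: setw_inj => //; [exact: sortedw_enum|rewrite -setw_enum].
by rewrite -setw_enum size_map -cardE.
Qed.

Lemma two_form_words a : homog 2 a -> hook e7 a = 0 ->
  a = sfval [seq (a (setw w), w) | w <- words2].
Proof.
move=> h2 h7; apply: (@sfval_eq a _ words2) => // w sw ww.
have [w2|w2] := eqVneq (size w) 2; last by apply: h2; rewrite card_setw.
case: w sw ww w2 => [//|i [//|j [|//]]] sw ww _.
have [j6|j6] := eqVneq j 6%N.
  by apply: (hook7_eq0 h7); rewrite j6 inE memwE /i7 inordK // !inE eqxx orbT.
case/negP: ww; move: sw; rewrite /= !andbT => /andP[/andP[hi hij] hj].
move: i j hi hij hj j6.
by case=> [|[|[|[|[|[|[|i]]]]]]] // [|[|[|[|[|[|[|j]]]]]]].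
Qed.

Lemma hook_col7 P a (c : R) : (forall i, i != i7 -> P i i7 = 0) ->
  hook e7 (expr P a) = P i7 i7 *: expr P (hook e7 a).
Proof.
move=> hP; rewrite hook_expr hook_col hook_decomp (bigD1 i7) //= big1 ?addr0 ?exprfZ.
  by rewrite expr_scalef.
by move=> i /hP ->; rewrite scale0r.
Qed.

Lemma frame_exists (phi : lform R) : G2form phi ->
  exists P, [/\ adapted phi P, forall i, i != i7 -> P i i7 = 0 & 0 < P i7 i7].
Proof.
case=> P aP; have Pu := adapted_unit aP; case: aP => _ ->.
have [M [fM [M0 M7]]] := G2_ray (fun i => P i i7).
have [Mu _ _] := G2_stab fM.
have MPu : M *m P \in unitmx by rewrite unitmx_mul Mu.
have E i : (M *m P) i i7 = mulv M (fun i => P i i7) i by rewrite mxE.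
exists (M *m P); split.
- split; last by rewrite -expr_mulmx fM.
  by move: MPu; rewrite unitmxE unitfE.
- by move=> i /M0; rewrite E.
(* If this entry vanished, so would the whole last column of the invertible matrix M P. *)
- rewrite E lt_neqAle M7 andbT eq_sym; apply/eqP => M70.
  have := congr1 (fun A : 'M[R]_7 => A i7 i7) (mulVmx MPu).
  rewrite !mxE eqxx big1 => [/esym/eqP|k _]; first by rewrite oner_eq0.
  by rewrite E; have [->|/M0 ->] := eqVneq k i7; rewrite ?M70 mulr0.
Qed.

(** One list in two roles: it is the form omega of the Lie algebra ([omega_hE]), and also e_7 -|
    phi0 ([hook7_phi0]), whose image under [expr P] is the form w of an adapted frame. *)
Definition omega_s : sform R := [:: (1, [:: 0; 1]%N); (1, [:: 2; 3]%N); (1, [:: 4; 5]%N)].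
Definition psi0_s : sform R := [:: (1, [:: 2; 3; 4; 5]%N); (1, [:: 0; 1; 4; 5]%N); (1, [:: 0; 1; 2; 3]%N);
  (-1, [:: 1; 3; 5; 6]%N); (1, [:: 1; 2; 4; 6]%N); (1, [:: 0; 3; 4; 6]%N); (1, [:: 0; 2; 5; 6]%N)].
(** Minus the imaginary part of (e^1 + i e^2) /\ (e^3 + i e^4) /\ (e^5 + i e^6). *)
Definition rho_s : sform R := [:: (1, [:: 1; 3; 5]%N); (-1, [:: 1; 2; 4]%N); (-1, [:: 0; 3; 4]%N); (-1, [:: 0; 2; 5]%N)].

Lemma psi0E : psi0 R = sfval psi0_s.
Proof.
rewrite /psi0 phi0E form_stars; last by sform_cbv.
by apply: form_eq; sform_cbv; cbv [psi0_s]; sform_cbv; do ?split; ring.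
Qed.

Lemma omega_hE : omega_h R = sfval omega_s.
Proof. by rewrite /omega_h !e2E //= !scale1r addr0. Qed.

Lemma hook7_phi0 : hook e7 (phi0 R) = sfval omega_s.
Proof.
rewrite phi0E form_hooks; [|by []|by sform_cbv].
by apply: form_eq; cbv [omega_s]; sform_cbv; do ?split; ring.
Qed.

Lemma hook7_psi0 : hook e7 (psi0 R) = sfval rho_s.
Proof.
rewrite psi0E form_hooks; [|by []|by cbv [psi0_s]; sform_cbv].
by apply: form_eq; cbv [psi0_s rho_s]; sform_cbv; do ?split; ring.
Qed.

Lemma coefs_eq0 (l : sform R) w : sfval l = 0 -> sorteds (norms l) -> sortedw w ->
  coefs (norms l) w = 0.
Proof. by move=> l0 sl sw; rewrite -form_coefs // form_norms l0. Qed.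

(** The general real 2-form of type (1,1) for the complex structure with (1,0)-covectors e^1 + i
    e^2, e^3 + i e^4, e^5 + i e^6; [hermitian] finds it as the kernel of wedging with [rho_s]. *)
Definition herm (x y z p q r s t n : R) : sform R :=
  [:: (x, [:: 0; 1]%N); (y, [:: 2; 3]%N); (z, [:: 4; 5]%N); (p, [:: 0; 2]%N); (p, [:: 1; 3]%N);
      (q, [:: 0; 3]%N); (- q, [:: 1; 2]%N); (r, [:: 0; 4]%N); (r, [:: 1; 5]%N); (s, [:: 0; 5]%N);
      (- s, [:: 1; 4]%N); (t, [:: 2; 4]%N); (t, [:: 3; 5]%N); (n, [:: 2; 5]%N); (- n, [:: 3; 4]%N)].

Definition gen2 (b01 b02 b03 b04 b05 b12 b13 b14 b15 b23 b24 b25 b34 b35 b45 : R) : sform R :=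
  [:: (b01, [:: 0; 1]%N); (b02, [:: 0; 2]%N); (b03, [:: 0; 3]%N); (b04, [:: 0; 4]%N);
      (b05, [:: 0; 5]%N); (b12, [:: 1; 2]%N); (b13, [:: 1; 3]%N); (b14, [:: 1; 4]%N);
      (b15, [:: 1; 5]%N); (b23, [:: 2; 3]%N); (b24, [:: 2; 4]%N); (b25, [:: 2; 5]%N);
      (b34, [:: 3; 4]%N); (b35, [:: 3; 5]%N); (b45, [:: 4; 5]%N)].

Lemma two_form a : homog 2 a -> hook e7 a = 0 ->
  exists b01 b02 b03 b04 b05 b12 b13 b14 b15 b23 b24 b25 b34 b35 b45 : R,
  a = sfval (gen2 b01 b02 b03 b04 b05 b12 b13 b14 b15 b23 b24 b25 b34 b35 b45).
Proof. by move=> h2 h7; do 15 eexists; exact: (two_form_words h2 h7). Qed.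

Lemma hermitian_gen (b01 b02 b03 b04 b05 b12 b13 b14 b15 b23 b24 b25 b34 b35 b45 : R) :
  wedge (sfval (gen2 b01 b02 b03 b04 b05 b12 b13 b14 b15 b23 b24 b25 b34 b35 b45))
        (sfval rho_s) = 0 ->
  [/\ b13 = b02, b12 = - b03, b15 = b04 & [/\ b14 = - b05, b35 = b24 & b34 = - b25]].
Proof.
rewrite -form_muls => h.
have {h} C w := @coefs_eq0 _ w h.
have c1 := C [:: 1; 2; 3; 4; 5]%N; have c2 := C [:: 0; 2; 3; 4; 5]%N.
have c3 := C [:: 0; 1; 3; 4; 5]%N; have c4 := C [:: 0; 1; 2; 4; 5]%N.
have c5 := C [:: 0; 1; 2; 3; 5]%N; have c6 := C [:: 0; 1; 2; 3; 4]%N.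
move: {C} c1 c2 c3 c4 c5 c6; cbv [gen2 rho_s]; sform_cbv.
move=> /(_ isT isT) c1 /(_ isT isT) c2 /(_ isT isT) c3 /(_ isT isT) c4 /(_ isT isT) c5 /(_ isT isT) c6.
by split; [lra|lra|lra|split; lra].
Qed.

Lemma hermitian a : homog 2 a -> hook e7 a = 0 -> wedge a (sfval rho_s) = 0 ->
  exists x y z p q r s t n, a = sfval (herm x y z p q r s t n).
Proof.
move=> h2 h7 h.
have [b01 [b02 [b03 [b04 [b05 [b12 [b13 [b14 [b15 [b23 [b24 [b25 [b34 [b35 [b45 E]]]]]]]]]]]]]]] :=
  two_form h2 h7.
move: h; rewrite E => /hermitian_gen[-> -> -> [-> -> ->]].
exists b01, b23, b45, b02, b03, b04, b05, b24, b25; apply: form_eq.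
by cbv [gen2 herm]; sform_cbv; do ?split; ring.
Qed.

(** * Torsion of a coclosed structure in an adapted frame *)

Section Frame.
Variables (phi : lform R) (P : 'M[R]_7).
Hypotheses (aP : adapted phi P) (P7 : forall i, i != i7 -> P i i7 = 0) (c0 : 0 < P i7 i7).
Hypothesis (cocl : dform (expr P (psi0 R)) = 0).

Let c := P i7 i7.
Let s : R := Num.sqrt 6 / 6.

Lemma sqrt6_gt0 : 0 < s.
Proof. by rewrite /s divr_gt0 // sqrtr_gt0. Qed.

Lemma expr_inj a b : expr P a = expr P b -> a = b.
Proof.
move=> /(congr1 (expr (invmx P))); have Pu := adapted_unit aP.
by rewrite !expr_mulmx mulmxV // !expr_id.
Qed.

Lemma expr_invK a : expr P (expr (invmx P) a) = a.
Proof. by rewrite expr_mulmx mulVmx ?expr_id // (adapted_unit aP). Qed.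

Lemma hook7_expr a : hook e7 (expr P a) = c *: expr P (hook e7 a).
Proof. exact: hook_col7. Qed.

Lemma hook7_psi : hook e7 (expr P (psi0 R)) = c *: expr P (sfval rho_s).
Proof. by rewrite hook7_expr hook7_psi0. Qed.

Lemma hook7_phi : hook e7 phi = c *: expr P (sfval omega_s).
Proof. by case: aP => _ ->; rewrite hook7_expr hook7_phi0. Qed.

Lemma homog_omega_s : homog 2 (sfval omega_s).
Proof.
rewrite -omega_hE => I hI; rewrite /omega_h !addrfctE /e2 /mono.
have e2c (i j : 'I_7) : i != j -> (I == [set i; j]) = false.
  by move=> ij; apply: contraNF hI => /eqP ->; rewrite cards2 ij.
rewrite !e2c ?addr0 // -val_eqE /= !inordK //.
Qed.

Lemma hook7_expr_omega : hook e7 (expr P (sfval omega_s)) = 0.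
Proof.
rewrite hook7_expr form_hooks; [|by []|by cbv [omega_s]; sform_cbv].
suff -> : sfval (hooks 6 omega_s) = 0 by rewrite expr_zerof scaler0.
by apply: (@form_eq _ _ [::]); cbv [omega_s]; sform_cbv.
Qed.

(** Since e_7 -| psi is a positive multiple of rho in the frame, d psi = 0 says omega /\ rho = 0, so
    omega is of type (1,1) for the frame. *)
Lemma beta_exists : exists x y z p q r m t n,
  omega_h R = expr P (sfval (herm x y z p q r m t n)).
Proof.
pose b := expr (invmx P) (omega_h R).
have bE : omega_h R = expr P b by rewrite expr_invK.
have b2 : homog 2 b by apply: homog_expr; rewrite omega_hE; exact: homog_omega_s.
have b7 : hook e7 b = 0.
  apply: expr_inj; apply: (scalerI (lt0r_neq0 c0)); rewrite expr_zerof scaler0 -hook7_expr -bE.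
  by rewrite omega_hE form_hooks //; cbv [omega_s]; sform_cbv.
have br : wedge b (sfval rho_s) = 0.
  apply: expr_inj; rewrite expr_zerof expr_wedge -bE; apply: (scalerI (lt0r_neq0 c0)).
  apply: (scalerI (lt0r_neq0 sqrt6_gt0)); rewrite !scaler0 -wedgeZr -hook7_psi.
  by rewrite -dformE.
by have [x [y [z [p [q [r [m [t [n E]]]]]]]]] := hermitian b2 b7 br;
  exists x, y, z, p, q, r, m, t, n; rewrite bE E.
Qed.

Lemma dphi b : omega_h R = expr P b -> dform phi = (s * c) *: expr P (wedge b (sfval omega_s)).
Proof. by move=> bE; rewrite dformE hook7_phi wedgeZr scalerA expr_wedge -bE. Qed.

(** For beta of type (1,1) on the six-dimensional part, the star of beta /\ omega0 is (tr beta)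
    omega0 - beta; the seventh covector completes it to the star in dimension 7. *)
Definition lambda_omega (x y z p q r m t n : R) : sform R :=
  muls (cats (scales (x + y + z) omega_s) (scales (-1) (herm x y z p q r m t n))) [:: (1, [:: 6]%N)].

Lemma star_beta_omega x y z p q r m t n :
  star0 (sfval (muls (herm x y z p q r m t n) omega_s)) = sfval (lambda_omega x y z p q r m t n).
Proof.
rewrite -(form_norms (muls _ _)) form_stars; last by cbv [herm omega_s]; sform_cbv.
by apply: form_eq; cbv [lambda_omega herm omega_s]; sform_cbv; do ?split; ring.
Qed.

Lemma phi0_beta_omega_top x y z p q r m t n :
  wedge (phi0 R) (wedge (sfval (herm x y z p q r m t n)) (sfval omega_s)) [set: 'I_7] =
  2 * (x + y + z).
Proof.
rewrite phi0E -!form_muls -form_norms form_top; last by cbv [herm omega_s]; sform_cbv.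
by cbv [herm omega_s]; sform_cbv; ring.
Qed.

Lemma phi0_psi0_top : wedge (phi0 R) (psi0 R) [set: 'I_7] = 7.
Proof.
rewrite phi0E psi0E -!form_muls -form_norms form_top; last by cbv [psi0_s]; sform_cbv.
by cbv [psi0_s]; sform_cbv; ring.
Qed.

Lemma sfval_nil : sfval [::] = 0 :> lform R. Proof. by []. Qed.

(** The star of d phi minus tau0 phi, in frame coordinates. The constant in tau0 = 2 k (x + y + z) /
    7 comes from the products 2 (x + y + z) and 7 of phi0 with beta /\ omega0 and psi0. *)
Definition tau3_s (k x y z p q r m t n : R) : sform R :=
  cats (scales k (lambda_omega x y z p q r m t n)) (scales (- (2 * k * (x + y + z) / 7)) (phi0_s R)).

Lemma tau3_phi0 k x y z p q r m t n :
  wedge (sfval (tau3_s k x y z p q r m t n)) (phi0 R) = 0.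
Proof.
rewrite phi0E -form_muls -sfval_nil; apply: form_eq.
by cbv [tau3_s lambda_omega herm omega_s]; sform_cbv; do ?split; field.
Qed.

Lemma tau3_psi0 k x y z p q r m t n :
  wedge (sfval (tau3_s k x y z p q r m t n)) (psi0 R) = 0.
Proof.
rewrite psi0E -form_muls -sfval_nil; apply: form_eq.
by cbv [tau3_s lambda_omega herm omega_s psi0_s]; sform_cbv; do ?split; field.
Qed.

Fixpoint sizes (k : nat) (l : sform R) : bool :=
  match l with [::] => true | (_, w) :: l' => Nat.eqb (size w) k && sizes k l' end.

Lemma homog_sfval k l : sizes k l -> homog k (sfval l).
Proof.
elim: l => [//|[d w] l IH] /= /andP[]; rewrite eqbE => /eqP wk /IH {}IH I hI.
rewrite addrfctE scalrfctE IH // addr0.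
suff -> : @formw R w I = 0 by rewrite scaler0.
elim: w k wk I hI {IH} => [|i w IH] k wk I hI.
  by rewrite /formw /= /mono -cards_eq0; move: hI; rewrite -wk => /negbTE ->.
rewrite -[formw _]/(wedge (dx R (inord i)) (formw w)).
by rewrite -wk in hI *; move: I hI; apply: homog_wedge_lin; exact: IH.
Qed.

Opaque sfval.
Section Beta.
Variables x y z p q r m t n : R.
Let b := sfval (herm x y z p q r m t n).
Hypothesis bE : omega_h R = expr P b.

Lemma hodge_dphi :
  hodge phi (dform phi) = (s * c) *: expr P (sfval (lambda_omega x y z p q r m t n)).
Proof.
by rewrite (dphi bE) -expr_scalef (hodge_expr _ aP) star0Z -form_muls star_beta_omega expr_scalef.
Qed.

(** [tau0] is a chosen number, so both halves are needed: [tau3_s] shows that this value is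
    admissible, and every admissible value is then shown to equal it. *)
Lemma tau0E : tau0 phi = 2 * (s * c) * (x + y + z) / 7.
Proof.
have Pu := adapted_unit aP; have [_ phiE] := aP.
rewrite /tau0; set T := (fun _ => _).
have T0 : T (2 * (s * c) * (x + y + z) / 7).
  exists (expr P (sfval (tau3_s (s * c) x y z p q r m t n))); split; last split; last split.
  - by apply: homog_expr; apply: homog_sfval; cbv [tau3_s lambda_omega herm omega_s]; sform_cbv.
  - rewrite (hodge_expr _ aP) (hodge_phi aP) (dphi bE).
    rewrite /tau3_s form_cats !form_scales star0D !star0Z -star_beta_omega star0K -phi0E.
    rewrite -/(psi0 R) form_muls expr_addf !expr_scalef.
    rewrite -[RHS]/(_ *: expr P (psi0 R) + (_ *: _ + _ *: _)).
    by rewrite scaleNr [in RHS]addrCA subrr addr0.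
  - by rewrite [in wedge _ _]phiE -expr_wedge tau3_phi0 expr_zerof.
  - by rewrite (hodge_phi aP) -expr_wedge tau3_psi0 expr_zerof.
have := ClassicalEpsilon.epsilon_spec (inhabits (0 : R)) T (ex_intro _ _ T0).
move: (ClassicalEpsilon.epsilon _ _) => k [tau3 [_ [E [_ Ep]]]].
have {}E : dform phi = k *: hodge phi phi + hodge phi tau3 by exact: E.
have Y0 : wedge (expr (invmx P) tau3) (psi0 R) = 0.
  apply: expr_inj; rewrite expr_zerof expr_wedge expr_invK -(hodge_phi aP).
  exact: Ep.
(* Wedging with phi isolates k: tau3 /\ psi = 0 makes tau3 orthogonal to phi, so its star
   contributes nothing. *)
move: (congr1 (fun a => wedge phi a [set: 'I_7]) E).
rewrite (dphi bE) (hodge_phi aP) -(expr_invK tau3) (hodge_expr _ aP) phiE.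
set B := wedge b _.
rewrite wedgeZr wedgeDr wedgeZr -!expr_wedge !(lform_addE, lform_scaleE) !top_expr.
rewrite /B phi0_beta_omega_top phi0_psi0_top wedge_star0.
have -> : inner (phi0 R) (expr (invmx P) tau3) = 0.
  have := congr1 (fun f : lform R => f [set: 'I_7]) Y0; rewrite /psi0 wedge_star0 -[0 _]/(0 : R) => <-.
  by apply: eq_bigr => I _; rewrite mulrC.
rewrite mulr0 addr0 => {}E; apply: (mulfI (volf_neq0 Pu)).
have -> : volf P * k = k * (volf P * 7) / 7 by field.
by rewrite -E; field.
Qed.

(** As d psi = 0 and the star of psi is phi, the Laplacian is d of the star of d phi. Its trace part
    cancels against the torsion term, because 2 (7/4) tau0 = s c (x + y + z). *)
Lemma flow_rhs (A : R) :
  fadd (lap phi 4 (expr P (psi0 R)))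
    (fscale 2 (dform (fscale (A - trace_torsion phi) phi))) =
  (2 * A * c * s) *: wedge (omega_h R) (expr P (sfval omega_s)) -
  (c ^+ 2 * s ^+ 2) *: wedge (omega_h R) (omega_h R).
Proof.
have [_ phiE] := aP.
have -> : lap phi 4 (expr P (psi0 R)) = dform (hodge phi (dform phi)).
  rewrite /lap cocl; have -> : codiff phi 5 0 = 0.
    have s0 : star0 (0 : lform R) = 0 by have := star0Z (0 : R) 0; rewrite !scale0r.
    have h0 : hodge phi 0 = 0 by rewrite (hodge_adapted _ aP) starE expr_zerof s0 expr_zerof.
    rewrite /codiff h0 dformE hook0f wedge0r scaler0 h0.
    by apply: funext => I; rewrite /fscale mulr0.
  rewrite /codiff (hodge_expr _ aP) /psi0 star0K -phiE.
  have -> : fscale ((-1) ^+ 4) (hodge phi (dform phi)) = hodge phi (dform phi).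
    by apply: funext => I; rewrite /fscale -signr_odd mul1r.
  by apply: funext => I; rewrite /fadd addr0.
rewrite hodge_dphi /trace_torsion tau0E.
set k := A - _; rewrite faddE !fscaleE.
rewrite !dformE !hookZ hook7_phi hook7_expr.
have -> : hook e7 (sfval (lambda_omega x y z p q r m t n)) = (x + y + z) *: sfval omega_s - b.
  rewrite form_hooks; [|by []|by cbv [lambda_omega herm omega_s]; sform_cbv].
  rewrite /b -form_scales -scaleN1r -form_scales -form_cats; apply: form_eq.
  by cbv [lambda_omega herm omega_s]; sform_cbv; do ?split; ring.
rewrite expr_addf expr_oppf expr_scalef -bE -/s !wedgeZr wedgeDr wedgeNr wedgeZr.
set W := wedge _ (expr _ _); set V := wedge _ _.
rewrite !scalerDr !scalerN !scalerA addrAC -scalerDl; congr (_ *: _ - _ *: _).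
  by rewrite /k; field.
ring.
Qed.

End Beta.
End Frame.

Lemma coclosed_flow_rhs (phi : lform R) P (A : R) : adapted phi P ->
  (forall i, i != i7 -> P i i7 = 0) -> 0 < P i7 i7 -> dform (expr P (psi0 R)) = 0 ->
  fadd (lap phi 4 (expr P (psi0 R)))
    (fscale 2 (dform (fscale (A - trace_torsion phi) phi))) =
  (2 * A * P i7 i7 * (Num.sqrt 6 / 6)) *: wedge (omega_h R) (expr P (sfval omega_s)) -
  (P i7 i7 ^+ 2 * (Num.sqrt 6 / 6) ^+ 2) *: wedge (omega_h R) (omega_h R).
Proof.
move=> aP P7 c0 cocl.
have [x [y [z [p [q [r [m [t [n E]]]]]]]]] := beta_exists aP P7 c0 cocl.
exact: (flow_rhs aP P7 cocl E A).
Qed.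

End Flow.

(** * Normal form of the evolving structure *)

Section Diagonal.
Variable R : realType.
Implicit Types (y z : R).

Definition phi_yz_s y z : sform R := [:: (y / z ^+ 2, [:: 0; 1; 6]%N); (- y^-1, [:: 2; 3; 6]%N);
  (- y^-1, [:: 4; 5; 6]%N); (y * z ^+ 2, [:: 0; 2; 4]%N); (- (y * z ^+ 2), [:: 0; 3; 5]%N);
  (y * z ^+ 2, [:: 1; 2; 5]%N); (y * z ^+ 2, [:: 1; 3; 4]%N)].

(** [rho_s] with e^1 replaced by - e^1: the value of e_7 -| psi at the initial structure. *)
Definition rho0_s : sform R := [:: (1, [:: 1; 3; 5]%N); (-1, [:: 1; 2; 4]%N);
  (1, [:: 0; 3; 4]%N); (1, [:: 0; 2; 5]%N)].

Definition psi_yz_s y z : sform R := [:: (z ^+ 4, [:: 2; 3; 4; 5]%N);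
  (- (y ^+ 2 * z ^+ 2), [:: 0; 1; 4; 5]%N); (- (y ^+ 2 * z ^+ 2), [:: 0; 1; 2; 3]%N);
  (-1, [:: 1; 3; 5; 6]%N); (1, [:: 1; 2; 4; 6]%N); (-1, [:: 0; 3; 4; 6]%N); (-1, [:: 0; 2; 5; 6]%N)].

Lemma phi_yzE y z : phi_yz y z = sfval (phi_yz_s y z).
Proof.
rewrite /sfval /phi_yz_s /= -!e3E //; apply: funext => I; rewrite !(lform_addE, lform_scaleE).
by rewrite /phi_yz -[0 I]/(0 : R); ring.
Qed.

Lemma phi2E : phi2 R = phi_yz 1 1.
Proof. by apply: funext => I; rewrite /phi2 /phi_yz; field. Qed.

(** A diagonal adapted coframe of [phi_yz]; the signs on e^4 and e^6 turn the sign pattern of [phi0]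
    into that of [phi2]. *)
Definition dyz y z (i : nat) : R :=
  match i with
  | 0 | 1 => y | 2 | 4 => z | 3 | 5 => - z | _ => (y * z ^+ 2)^-1
  end%N.

Definition Dyz y z : 'M[R]_7 := diag_mx (\row_i dyz y z (nat_of_ord i)).

Lemma lin_Dyz y z i : (i < 7)%N -> lin (Dyz y z (inord i)) = sfval [:: (dyz y z i, [:: i])].
Proof.
move=> hi; rewrite lin_dx (bigD1 (inord i)) //= big1 ?addr0; last first.
  by move=> j ji; rewrite !mxE eq_sym (negbTE ji) mulr0n scale0r.
rewrite !mxE eqxx mulr1n inordK // /sfval /= ?addr0.
by rewrite -[formw [:: i]]/(wedge (dx R (inord i)) (mono R finset.set0)) wedge_set0r.
Qed.

Lemma exprs_Dyz y z l : oks l ->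
  expr (Dyz y z) (sfval l) = sfval (exprs (fun i => [:: (dyz y z i, [:: i])]) l).
Proof. by move=> ol; apply: form_exprs => // i; exact: lin_Dyz. Qed.

Section Nonzero.
Variables y z : R.
Hypotheses (y0 : y != 0) (z0 : z != 0).

Lemma Dyz_phi0 : expr (Dyz y z) (phi0 R) = phi_yz y z.
Proof.
rewrite phi0E phi_yzE exprs_Dyz; last by sform_cbv.
by apply: form_eq; cbv [phi_yz_s dyz]; sform_cbv; do ?split; field; rewrite ?y0 ?z0.
Qed.

Lemma Dyz_psi0 : expr (Dyz y z) (psi0 R) = sfval (psi_yz_s y z).
Proof.
rewrite psi0E exprs_Dyz; last by cbv [psi0_s]; sform_cbv.
by apply: form_eq; cbv [psi0_s psi_yz_s dyz]; sform_cbv; do ?split; field; rewrite ?y0 ?z0.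
Qed.

Lemma volf_Dyz : volf (Dyz y z) = y * z ^+ 2.
Proof.
rewrite /volf (mono_full R); have -> : formw fullw = sfval [:: (1 : R, fullw)].
  by rewrite /= scale1r addr0.
rewrite exprs_Dyz // -form_norms form_top; last by sform_cbv.
by cbv [dyz]; sform_cbv; field; rewrite y0 z0.
Qed.

Lemma Dyz_unit : Dyz y z \in unitmx.
Proof.
rewrite unitmxE unitfE det_diag prodf_seq_neq0; apply/allP => i _; rewrite mxE /=.
by case: i => [[|[|[|[|[|[|[|i]]]]]]] hi] //=; rewrite ?oppr_eq0 // invr_eq0 mulf_neq0 ?expf_neq0.
Qed.

Lemma Dyz_adapted : adapted (phi_yz y z) (Dyz y z).
Proof. by split; [have := Dyz_unit; rewrite unitmxE unitfE|rewrite Dyz_phi0]. Qed.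

Lemma Dyz_col i : i != i7 -> Dyz y z i i7 = 0.
Proof. by move=> ii; rewrite !mxE (negbTE ii) mulr0n. Qed.

Lemma Dyz_77 : Dyz y z i7 i7 = (y * z ^+ 2)^-1.
Proof. by rewrite !mxE eqxx mulr1n /i7 inordK. Qed.

Lemma hodge_phi_yz : hodge (phi_yz y z) (phi_yz y z) = sfval (psi_yz_s y z).
Proof. by rewrite (hodge_phi Dyz_adapted) Dyz_psi0. Qed.

End Nonzero.

Lemma dform_psi_yz y z : dform (sfval (psi_yz_s y z)) = 0.
Proof.
rewrite dformE form_hooks; [|by []|by cbv [psi_yz_s]; sform_cbv].
rewrite omega_hE -form_muls -form_scales -(sfval_nil R); apply: form_eq.
by cbv [omega_s psi_yz_s]; sform_cbv; do ?split; ring.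
Qed.

Lemma hook7_psi_yz y z : hook (unitvec R i7) (sfval (psi_yz_s y z)) = sfval rho0_s.
Proof.
rewrite form_hooks; [|by []|by cbv [psi_yz_s]; sform_cbv].
by apply: form_eq; cbv [psi_yz_s rho0_s]; sform_cbv; do ?split; ring.
Qed.

(** The analogue of [herm] for the complex structure of [rho0_s], reversed on the first plane; hence
    the changed signs in p, q, r, m. *)
Definition hermD (x y z p q r m t n : R) : sform R :=
  [:: (x, [:: 0; 1]%N); (y, [:: 2; 3]%N); (z, [:: 4; 5]%N); (p, [:: 0; 2]%N); (- p, [:: 1; 3]%N);
      (q, [:: 0; 3]%N); (q, [:: 1; 2]%N); (r, [:: 0; 4]%N); (- r, [:: 1; 5]%N); (m, [:: 0; 5]%N);
      (m, [:: 1; 4]%N); (t, [:: 2; 4]%N); (t, [:: 3; 5]%N); (n, [:: 2; 5]%N); (- n, [:: 3; 4]%N)].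

Lemma hermitianD (w : lform R) : homog 2 w -> hook (unitvec R i7) w = 0 ->
  wedge w (sfval rho0_s) = 0 -> exists x y z p q r m t n, w = sfval (hermD x y z p q r m t n).
Proof.
move=> h2 h7 h.
have [b01 [b02 [b03 [b04 [b05 [b12 [b13 [b14 [b15 [b23 [b24 [b25 [b34 [b35 [b45 E]]]]]]]]]]]]]]] :=
  two_form h2 h7.
move: h; rewrite E -form_muls => h.
have {h} C v := @coefs_eq0 _ _ v h.
have c1 := C [:: 1; 2; 3; 4; 5]%N; have c2 := C [:: 0; 2; 3; 4; 5]%N.
have c3 := C [:: 0; 1; 3; 4; 5]%N; have c4 := C [:: 0; 1; 2; 4; 5]%N.
have c5 := C [:: 0; 1; 2; 3; 5]%N; have c6 := C [:: 0; 1; 2; 3; 4]%N.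
move: {C E} c1 c2 c3 c4 c5 c6; cbv [gen2 rho0_s]; sform_cbv.
move=> /(_ isT isT) c1 /(_ isT isT) c2 /(_ isT isT) c3 /(_ isT isT) c4 /(_ isT isT) c5 /(_ isT isT) c6.
exists b01, b23, b45, b02, b03, b04, b05, b24, b25; apply: form_eq.
by cbv [gen2 hermD]; sform_cbv; do ?split; lra.
Qed.

(** The Pfaffian of [hermD]: w^3 is 6 [pf] times e^123456 ([hermD_cube]). *)
Definition pf (x y z p q r m t n : R) : R :=
  x * y * z - x * (t ^+ 2 + n ^+ 2) + y * (m ^+ 2 + r ^+ 2) + z * (p ^+ 2 + q ^+ 2)
  + 2 * (p * t * m - p * n * r - q * n * m - q * r * t).

Definition row7 (a0 a1 a2 a3 a4 a5 c : R) : sform R :=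
  [:: (a0, [:: 0]%N); (a1, [:: 1]%N); (a2, [:: 2]%N); (a3, [:: 3]%N); (a4, [:: 4]%N);
      (a5, [:: 5]%N); (c, [:: 6]%N)].

Lemma hermD_cube x y z p q r m t n a0 a1 a2 a3 a4 a5 c :
  let w := sfval (hermD x y z p q r m t n) in
  wedge (wedge (wedge w w) w) (sfval (row7 a0 a1 a2 a3 a4 a5 c)) [set: 'I_7] =
  6 * c * pf x y z p q r m t n.
Proof.
move=> w; rewrite /w -form_muls -(form_norms (muls _ _)) -form_muls -(form_norms (muls _ _)) -form_muls.
rewrite -form_norms form_top; last by cbv [hermD row7]; sform_cbv.
by cbv [hermD row7]; sform_cbv; rewrite /pf; ring.
Qed.

Definition psi_struct (x y z p q r m t n a0 a1 a2 a3 a4 a5 c : R) : sform R :=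
  cats (scales 2^-1 (muls (hermD x y z p q r m t n) (hermD x y z p q r m t n)))
       (scales (- c^-1) (muls rho0_s (row7 a0 a1 a2 a3 a4 a5 c))).

Definition volume3 (phi : lform R) : R :=
  let w := hook (unitvec R i7) phi in wedge (wedge (wedge w w) w) (dx R i7) [set: 'I_7].

Lemma row7E (v : 'I_7 -> R) : lin v = sfval (row7 (v (inord 0)) (v (inord 1)) (v (inord 2))
  (v (inord 3)) (v (inord 4)) (v (inord 5)) (v i7)).
Proof.
have f1 (i : nat) : formw [:: i] = dx R (inord i).
  by rewrite -[formw [:: i]]/(wedge (dx R (inord i)) (mono R finset.set0)) wedge_set0r.
rewrite lin_dx (eq_bigr (fun i : 'I_7 => v (inord i) *: dx R (inord i))); last first.
  by move=> i _; rewrite -inordE.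
rewrite -(big_mkord xpredT (fun i => v (inord i) *: dx R (inord i))).
do 7 (rewrite big_ltn; last by []).
rewrite big_geq; last by [].
by rewrite -!f1.
Qed.

Lemma dx7w : dx R i7 = sfval [:: (1 : R, [:: 6]%N)].
Proof.
rewrite /sfval /= scale1r addr0.
by rewrite -[formw [:: 6]%N]/(wedge (dx R (inord 6)) (mono R finset.set0)) wedge_set0r.
Qed.

Lemma dx7E : dx R i7 = sfval (row7 0 0 0 0 0 0 1).
Proof. by rewrite dx7w; apply: form_eq; cbv [row7]; sform_cbv; do ?split; ring. Qed.

Lemma expr_dx (P : 'M[R]_7) i : expr P (dx R i) = lin (P i).
Proof. by rewrite -(wedge_set0r (dx R i)) expr_dx_wedge expr_set0 wedge_set0r. Qed.

Lemma omega_cube : wedge (wedge (wedge (sfval (omega_s R)) (sfval (omega_s R))) (sfval (omega_s R)))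
  (dx R i7) [set: 'I_7] = 6.
Proof.
rewrite dx7E -!form_muls -form_norms form_top; last by cbv [omega_s row7]; sform_cbv.
by cbv [omega_s row7]; sform_cbv; ring.
Qed.

Lemma psi0_split : psi0 R = sfval (scales 2^-1 (muls (omega_s R) (omega_s R))) -
  wedge (sfval (rho_s R)) (dx R i7).
Proof.
rewrite dx7w psi0E -form_muls -scaleN1r -form_scales -form_cats; apply: form_eq.
by cbv [psi0_s omega_s rho_s]; sform_cbv; do ?split; field.
Qed.

(** In the model omega0 /\ rho = 0, and the frame carries rho to a multiple of [rho0_s]; hence w /\
    rho0 = 0, which puts w in the form [hermD] whatever the frame. *)
Lemma frame_structure (phi : lform R) : G2form phi -> dform (hodge phi phi) = 0 ->
  hook (unitvec R i7) (hodge phi phi) = sfval rho0_s -> 0 < volume3 phi ->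
  exists P x y z p q r m t n a0 a1 a2 a3 a4 a5 c,
  [/\ adapted phi P, forall i, i != i7 -> P i i7 = 0, P i7 i7 = c, 0 < c &
   [/\ hook (unitvec R i7) phi = c *: sfval (hermD x y z p q r m t n),
       expr P (sfval (omega_s R)) = sfval (hermD x y z p q r m t n),
       volume3 phi = 6 * c ^+ 3 * pf x y z p q r m t n,
       volf P = c * pf x y z p q r m t n &
       hodge phi phi = sfval (psi_struct x y z p q r m t n a0 a1 a2 a3 a4 a5 c)]].
Proof.
move=> /frame_exists[P [aP P7 c0]]; rewrite (hodge_phi aP) => cocl h7 v0.
pose w := expr P (sfval (omega_s R)).
have w2 : homog 2 w by apply: homog_expr; exact: homog_omega_s.
have w7 : hook (unitvec R i7) w = 0 := hook7_expr_omega P7.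
have X7 : expr P (sfval (rho_s R)) = (P i7 i7)^-1 *: sfval rho0_s.
  by rewrite -h7 (hook7_psi P7) scalerA mulVf ?scale1r // gt_eqF.
have wr : wedge w (sfval rho0_s) = 0.
  apply: (scalerI (lt0r_neq0 (_ : 0 < (P i7 i7)^-1))); first by rewrite invr_gt0.
  rewrite -wedgeZr -X7 -expr_wedge -form_muls scaler0.
  suff -> : sfval (muls (omega_s R) (rho_s R)) = 0 by rewrite expr_zerof.
  by rewrite -(sfval_nil R); apply: form_eq; cbv [omega_s rho_s]; sform_cbv; do ?split; ring.
have [x [y [z [p [q [r [m [t [n wE]]]]]]]]] := hermitianD w2 w7 wr.
exists P, x, y, z, p, q, r, m, t, n, (P i7 (inord 0)), (P i7 (inord 1)), (P i7 (inord 2)),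
  (P i7 (inord 3)), (P i7 (inord 4)), (P i7 (inord 5)), (P i7 i7).
have phi7 := hook7_phi aP P7.
split=> //; split; rewrite -/w ?wE //.
- by rewrite phi7 -/w wE.
- rewrite /volume3 phi7 -/w wE dx7E !(wedgeZl, wedgeZr) !scalerA lform_scaleE hermD_cube.
  by ring.
(* omega0^3 /\ e^7 is 6 times the volume form, so its image w^3 /\ x^7 computes [volf P]; only the
   e^7-component of x^7 contributes. *)
- apply: (mulfI (_ : 6 != 0 :> R)); first by rewrite pnatr_eq0.
  by rewrite mulrC -[X in _ * X = _]omega_cube -top_expr !expr_wedge expr_dx -/w wE row7E hermD_cube mulrA.
- rewrite psi0_split expr_addf expr_oppf expr_wedge expr_dx X7 form_scales form_muls.
  rewrite expr_scalef expr_wedge -/w wE row7E.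
  rewrite /psi_struct form_cats !form_scales !form_muls.
  by rewrite wedgeZl scaleNr.
Qed.

End Diagonal.

Local Open Scope classical_set_scope.

(** * Calculus on the line *)

Section Calculus.
Variable R : realType.
Implicit Types (f g : R -> R) (x a b t : R).

(** These rules are for explicit functions, so that derivatives are built as terms; [der_eq] then
    leaves a single algebraic equation. *)
Lemma derC x (k : R) : is_derive x 1 (fun _ : R => k) 0.
Proof. exact: is_derive_cst. Qed.
Lemma derI x : is_derive x 1 (fun s : R => s) 1.
Proof. exact: is_derive_id. Qed.
Lemma derD x f g a b : is_derive x 1 f a -> is_derive x 1 g b ->
  is_derive x 1 (fun s => f s + g s) (a + b).
Proof. by move=> hf hg; exact: is_deriveD. Qed.
Lemma derN x f a : is_derive x 1 f a -> is_derive x 1 (fun s => - f s) (- a).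
Proof. by move=> hf; exact: is_deriveN. Qed.
Lemma derB x f g a b : is_derive x 1 f a -> is_derive x 1 g b ->
  is_derive x 1 (fun s => f s - g s) (a - b).
Proof. by move=> hf hg; exact: is_deriveB. Qed.
Lemma derM x f g a b : is_derive x 1 f a -> is_derive x 1 g b ->
  is_derive x 1 (fun s => f s * g s) (f x * b + g x * a).
Proof. by move=> hf hg; exact: is_deriveM. Qed.
Lemma derZ x (k : R) f a : is_derive x 1 f a -> is_derive x 1 (fun s => k * f s) (k * a).
Proof. by move=> hf; exact: is_deriveZ. Qed.
Lemma derX x n f a : is_derive x 1 f a ->
  is_derive x 1 (fun s => f s ^+ n.+1) (n.+1%:R * f x ^+ n * a).
Proof. by move=> hf; have := @is_deriveX _ _ f n.+1 x 1 a hf; rewrite exprfctE. Qed.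
Lemma derV x f a : f x != 0 -> is_derive x 1 f a ->
  is_derive x 1 (fun s => (f s)^-1) (- a / f x ^+ 2).
Proof.
move=> f0 hf; have [h1 h2] := @is_deriveV _ f x a 1 f0 hf; split; first exact: h1.
by apply: (etrans h2); rewrite -[_ *: _]/(_ * _) !mulNr mulrC.
Qed.
Lemma der_comp x f g a b : is_derive (g x) 1 f a -> is_derive x 1 g b ->
  is_derive x 1 (fun s => f (g s)) (a * b).
Proof. by move=> hf hg; exact: is_derive1_comp. Qed.
Lemma der_eq x f a b : is_derive x 1 f a -> a = b -> is_derive x 1 f b.
Proof. by move=> h <-. Qed.

Lemma der_cont x f a : is_derive x 1 f a -> {for x, continuous f}.
Proof. by move=> [h _]; apply/differentiable_continuous/derivable1_diffP. Qed.

Lemma der_mvt f (f' : R -> R) a b : a <= b -> (forall x, a <= x <= b -> is_derive x 1 f (f' x)) ->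
  exists2 c, a <= c <= b & f b - f a = f' c * (b - a).
Proof.
move=> ab df; have [||c hc E] := @MVT_segment R f f' a b ab.
- by move=> x; rewrite in_itv /= => /andP[ax xb]; apply: df; rewrite !ltW.
- by apply: derivable_within_continuous => x; rewrite in_itv /= => /df[].
by exists c => //; move: hc; rewrite in_itv.
Qed.

Lemma der_ge0 f (f' : R -> R) a b : a <= b -> (forall x, a <= x <= b -> is_derive x 1 f (f' x)) ->
  (forall x, a <= x <= b -> 0 <= f' x) -> f a <= f b.
Proof.
move=> ab df h; have [c hc E] := der_mvt ab df.
by rewrite -subr_ge0 E mulr_ge0 ?h // subr_ge0.
Qed.

Lemma der_gt0 f (f' : R -> R) a b : a < b -> (forall x, a <= x <= b -> is_derive x 1 f (f' x)) ->
  (forall x, a <= x <= b -> 0 < f' x) -> f a < f b.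
Proof.
move=> ab df h; have [c hc E] := der_mvt (ltW ab) df.
by rewrite -subr_gt0 E mulr_gt0 ?h // subr_gt0.
Qed.

Lemma der_bound f (f' : R -> R) g (g' : R -> R) a b : a <= b ->
  (forall x, a <= x <= b -> is_derive x 1 f (f' x)) ->
  (forall x, a <= x <= b -> is_derive x 1 g (g' x)) ->
  (forall x, a <= x <= b -> `|f' x| <= g' x) -> `|f b - f a| <= g b - g a.
Proof.
move=> ab df dg h.
have h1 : g a - f a <= g b - f b.
  apply: (@der_ge0 (fun s => g s - f s) (fun x => g' x - f' x)) => // x hx.
    by apply: derB; [exact: dg|exact: df].
  by rewrite subr_ge0 (le_trans (ler_norm _)) // h.
have h2 : g a + f a <= g b + f b.
  apply: (@der_ge0 (fun s => g s + f s) (fun x => g' x + f' x)) => // x hx.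
    by apply: derD; [exact: dg|exact: df].
  by have := h x hx; rewrite ler_norml => /andP[]; lra.
by rewrite ler_norml; apply/andP; split; lra.
Qed.

Lemma der_const f a b t : a < t < b -> a < 0 < b ->
  (forall x, a < x < b -> is_derive x 1 f 0) -> f t = f 0.
Proof.
move=> /andP[at_ tb] /andP[a0 b0] df.
have K x y : a < x -> x <= y -> y < b -> f y = f x.
  move=> ax xy yb; have [|c _] := @der_mvt f (fun _ => 0) x y xy.
    by move=> z /andP[xz zy]; apply: df; rewrite (lt_le_trans ax xz) (le_lt_trans zy yb).
  by rewrite mul0r => /eqP; rewrite subr_eq0 => /eqP.
by have [t0|t0] := leP 0 t; [apply: K|symmetry; apply: K => //; exact: ltW].
Qed.

Lemma cont_bounded f a b : a <= b -> (forall x, a <= x <= b -> {for x, continuous f}) ->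
  exists M, forall x, a <= x <= b -> f x <= M.
Proof.
move=> ab cf; have [|c _ hc] := @EVT_max R f a b ab.
  by apply: continuous_in_subspaceT => x; rewrite inE /= in_itv /= => /cf.
by exists (f c) => x hx; apply: hc; rewrite in_itv.
Qed.

(** The product of E with exp(- K t) does not increase. *)
Lemma gronwall_right (E E' : R -> R) b (K : R) : 0 <= b -> 0 <= K ->
  (forall x, 0 <= x <= b -> is_derive x 1 E (E' x)) ->
  (forall x, 0 <= x <= b -> 0 <= E x) ->
  (forall x, 0 <= x <= b -> E' x <= K * E x) -> E 0 = 0 -> E b = 0.
Proof.
move=> b0 K0 dE E0 hE E00.
have h : - (E 0 * expR (- K * 0)) <= - (E b * expR (- K * b)).
  apply: (@der_ge0 (fun s => - (E s * expR (- K * s)))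
    (fun x => (K * E x - E' x) * expR (- K * x)) 0 b b0) => x hx.
    have de : is_derive x 1 (fun s : R => expR (- K * s)) (expR (- K * x) * (- K * 1)).
      exact: (der_comp (is_derive_expR _) (derZ (- K) (derI x))).
    by apply: (der_eq (derN (derM (dE x hx) de))); ring.
  by rewrite mulr_ge0 ?expR_ge0 // subr_ge0 hE.
apply/eqP; rewrite eq_le E0 ?b0 ?lexx // andbT.
move: h; rewrite E00 mul0r oppr0 oppr_ge0 pmulr_lle0 // expR_gt0 //.
Qed.

(** The rate K may blow up at the ends of the open interval, so it is bounded only on the segment
    between 0 and t; negative t are handled by reversing time. *)
Lemma gronwall (E E' K : R -> R) a b : a < 0 < b ->
  (forall x, a < x < b -> is_derive x 1 E (E' x)) ->
  (forall x, a < x < b -> 0 <= E x) ->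
  (forall x, a < x < b -> {for x, continuous K}) ->
  (forall x, a < x < b -> `|E' x| <= K x * E x) -> E 0 = 0 ->
  forall t, a < t < b -> E t = 0.
Proof.
move=> /andP[a0 b0] dE E0 cK hE E00 t /andP[at_ tb].
have [t0|t0] := leP 0 t.
  have inI x : 0 <= x <= t -> a < x < b.
    by move=> /andP[x0 xt]; rewrite (lt_le_trans a0 x0) (le_lt_trans xt tb).
  have [M hM] := @cont_bounded K 0 t t0 (fun x hx => cK x (inI x hx)).
  apply: (@gronwall_right E E' t (Num.max 0 M)) => // [|x /inI /dE //|x /inI /E0 //|x hx].
    by rewrite le_max lexx.
  apply: le_trans (le_trans (ler_norm _) (hE x (inI x hx))) _.
  by rewrite ler_wpM2r ?E0 ?inI // le_max hM // orbT.
have inI x : t <= x <= 0 -> a < x < b.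
  by move=> /andP[tx x0]; rewrite (lt_le_trans at_ tx) (le_lt_trans x0 b0).
have [M hM] := @cont_bounded K t 0 (ltW t0) (fun x hx => cK x (inI x hx)).
have inN x : 0 <= x <= - t -> t <= - x <= 0 by move=> /andP[]; lra.
rewrite -(opprK t); apply: (@gronwall_right (fun s => E (- s)) (fun s => - E' (- s)) (- t) (Num.max 0 M)).
- lra.
- by rewrite le_max lexx.
- by move=> x hx; apply: (der_eq (der_comp (dE _ (inI _ (inN _ hx))) (derN (derI x)))); ring.
- by move=> x hx; apply/E0/inI/inN.
- move=> x hx; apply: le_trans (le_trans _ (hE _ (inI _ (inN _ hx)))) _.
    by rewrite -normrN ler_norm.
  by rewrite ler_wpM2r ?E0 ?inI ?inN // le_max hM ?inN // orbT.
- by rewrite oppr0.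
Qed.

Lemma primitive_right f (N : R) : 0 < N -> continuous f ->
  exists F, F 0 = 0 /\ forall x, - N < x -> is_derive x 1 F (f x).
Proof.
move=> N0 cf.
pose G x := (\int[lebesgue_measure]_(t in [set` `[- N, x]]) (f t))%R.
exists (fun x => G x - G 0); split; first by rewrite subrr.
move=> x Nx.
have xu : x < x + 1 by rewrite ltrDl.
have intf : lebesgue_measure.-integrable `[- N, x + 1] (EFin \o f).
  apply: continuous_compact_integrable; first exact: segment_compact.
  by apply: continuous_subspaceT => y; exact: cf.
have [h1 h2] := continuous_FTC1_closed xu intf Nx (cf x).
apply: (der_eq (derB (derivableP h1) (derC x (G 0)))).
by rewrite subr0 -h2 derive1E.
Qed.

Lemma primitive f : continuous f -> exists F, F 0 = 0 /\ forall x, is_derive x 1 F (f x).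
Proof.
move=> cf.
have /choice[F hF] : forall n : nat, exists F, F 0 = 0 /\
    forall x, - n.+1%:R < x -> is_derive x 1 F (f x).
  by move=> n; exact: primitive_right.
have same n m x : - n.+1%:R < x -> - m.+1%:R < x -> F n x = F m x.
  move=> nx mx; have [Fn dFn] := hF n; have [Fm dFm] := hF m.
  apply/eqP; rewrite -subr_eq0; apply/eqP; pose D s := F n s - F m s.
  have dD s : Num.max (- n.+1%:R) (- m.+1%:R) < s < Num.max x 0 + 1 -> is_derive s 1 D 0.
    rewrite gt_max => /andP[/andP[ns ms] _]; rewrite -(subrr (f s)).
    by apply: derB; [exact: dFn|exact: dFm].
  have hx : x <= Num.max x 0 by rewrite le_max lexx.
  have h0 : 0 <= Num.max x 0 by rewrite le_max lexx orbT.
  rewrite -[LHS]/(D x); have -> : D x = D 0.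
    apply: (der_const _ _ dD); rewrite gt_max ?nx ?mx ?oppr_lt0 ?ltr0Sn /=; lra.
  by rewrite /D Fn Fm subrr.
(* The primitive with index n is valid to the right of - (n + 1), and all of them agree where valid.
   Indices beyond |x| leave enough margin for one fixed primitive to serve on a unit ball about
   x. *)
pose N (x : R) := Num.trunc `|x|.
exists (fun x => F (N x).+1 x); split; first by have [] := hF (N 0).+1.
move=> x; have [_ dF] := hF (N x).+2.
have Nx : - (N x).+1%:R < x.
  by rewrite ltrNl (le_lt_trans (ler_norm _)) // normrN truncnS_gt.
apply: (@near_eq_is_derive _ _ _ (F (N x).+2)); last first.
  by apply: dF; apply: lt_trans Nx; rewrite ltrN2 ltr_nat.
apply: filterS (nbhsx_ballx x 1 ltr01) => a; rewrite -ball_normE /= => xa.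
apply: same; last by rewrite ltrNl (le_lt_trans (ler_norm _)) // normrN (lt_trans (truncnS_gt _)) // ltr_nat.
move: Nx xa; rewrite -[(N x).+3]addn2 natrD ltr_norml => Nx /andP[]; lra.
Qed.

Lemma lipschitz_cont2 (F : R -> R -> R) (L : R) (u v : R -> R) : 0 <= L ->
  (forall x y x' y' : R, `|F x y - F x' y'| <= L * (`|x - x'| + `|y - y'|)) ->
  continuous u -> continuous v -> continuous (fun t => F (u t) (v t)).
Proof.
move=> L0 hF cu cv t; apply/cvgrPdist_le => e e0 /=.
pose e' := e / (2 * (L + 1)).
have L1 : 0 < L + 1 by rewrite ltr_wpDl.
have e'0 : 0 < e' by rewrite divr_gt0 // mulr_gt0.
have := cu t => /cvgrPdist_le/(_ _ e'0) hu.
have := cv t => /cvgrPdist_le/(_ _ e'0) hv.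
near=> s; apply: le_trans (hF _ _ _ _) _.
have h1 : `|u t - u s| <= e' by near: s.
have h2 : `|v t - v s| <= e' by near: s.
apply: (@le_trans _ _ ((L + 1) * (e' + e'))).
  by apply: ler_pM; rewrite ?addr_ge0 ?lerDl // lerD.
suff -> : (L + 1) * (e' + e') = e by [].
by rewrite /e'; field; rewrite gt_eqF.
Unshelve. all: by end_near. Qed.

(* In the norm weighted by [exp (- K |t|)] the Picard map contracts by 1/2 on the whole line. *)
Section Picard.
Variables (F1 F2 : R -> R -> R) (L B x0 y0 : R).
Hypothesis L0 : 0 < L.
Hypothesis F1L : forall x y x' y' : R, `|F1 x y - F1 x' y'| <= L * (`|x - x'| + `|y - y'|).
Hypothesis F2L : forall x y x' y' : R, `|F2 x y - F2 x' y'| <= L * (`|x - x'| + `|y - y'|).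
Hypothesis F1B : forall x y, `|F1 x y| <= B.
Hypothesis F2B : forall x y, `|F2 x y| <= B.

(** An error d w(t) in both coordinates changes the field by at most 2 L d w(t), and integration
    divides by K: this is the factor 1/2. C / 2 = B / K bounds the first step. *)
Let K := 4 * L.
Let C := 2 * B / K.
Let w t := expR (K * `|t|).

Let K0 : 0 < K. Proof. by rewrite /K; move: L0; lra. Qed.
Let B0 : 0 <= B. Proof. exact: le_trans (normr_ge0 _) (F1B 0 0). Qed.
Let C0 : 0 <= C. Proof. by apply: divr_ge0; [apply: mulr_ge0|exact: ltW]. Qed.

Let w_ge1 t : 1 <= w t.
Proof. by rewrite /w -[leLHS]expR0 ler_expR mulr_ge0 // ltW. Qed.

Lemma weighted_bound f (f' : R -> R) (k : R) : (forall x, is_derive x 1 f (f' x)) -> f 0 = 0 ->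
  (forall x, `|f' x| <= K * k * w x) -> 0 <= k -> forall t, `|f t| <= k * w t.
Proof.
move=> df f0 hf k0 t; have pos (g g' : R -> R) : (forall x : R, is_derive x 1 g (g' x)) -> g 0 = 0 ->
    (forall x, `|g' x| <= K * k * w x) -> forall x, 0 <= x -> `|g x| <= k * w x.
  move=> dg g0 hg x xge0.
  have : `|g x - g 0| <= k * expR (K * x) - k * expR (K * 0).
    apply: (@der_bound g g' (fun s => k * expR (K * s)) (fun s => K * k * expR (K * s)) 0 x xge0).
    - by move=> s _; apply: (der_eq (derZ k (der_comp (is_derive_expR _) (derZ K (derI s))))); ring.
    - by move=> s /andP[s0 _]; have := hg s; rewrite /w (ger0_norm s0).
  rewrite g0 subr0 mulr0 expR0 mulr1 /w (ger0_norm xge0).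
  by move=> /le_trans; apply; rewrite gerBl.
have [t0|t0] := leP 0 t; first exact: pos df f0 hf t t0.
have := pos (fun s => f (- s)) (fun s => - f' (- s)) _ _ _ (- t).
rewrite opprK /w normrN; apply.
- by move=> s; apply: (der_eq (der_comp (df _) (derN (derI s)))); ring.
- by rewrite oppr0.
- by move=> s; rewrite normrN; have := hf (- s); rewrite /w normrN.
- by rewrite oppr_ge0 ltW.
Qed.

Lemma bounded_lip f (f' : R -> R) : (forall x, is_derive x 1 f (f' x)) -> (forall x, `|f' x| <= B) ->
  forall s t, `|f s - f t| <= B * `|s - t|.
Proof.
move=> df hf; have H s t : s <= t -> `|f t - f s| <= B * (t - s).
  move=> st; have [c _ ->] := @der_mvt f f' s t st (fun x _ => df x).
  by rewrite normrM (ger0_norm (_ : 0 <= t - s)) ?subr_ge0 // ler_wpM2r ?subr_ge0.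
move=> s t; have [st|/ltW ts] := leP s t.
  by rewrite distrC; apply: le_trans (H s t st) _; rewrite ler_wpM2l // distrC ler_norm.
by apply: le_trans (H t s ts) _; rewrite ler_wpM2l // ler_norm.
Qed.

Lemma lip_cont f : (forall s t, `|f s - f t| <= B * `|s - t|) -> continuous f.
Proof.
move=> hf t; apply/cvgrPdist_le => e e0 /=.
have B1 : 0 < B + 1 by rewrite ltr_wpDl.
have e1 : 0 < e / (B + 1) by rewrite divr_gt0.
have hid : (fun s : R => s) @ t --> t by exact: cvg_id.
have {}hid := (cvgrPdist_le _ _).1 hid _ e1.
near=> s; apply: le_trans (hf _ _) _; apply: (@le_trans _ _ ((B + 1) * `|t - s|)).
  by rewrite ler_wpM2r // lerDl.
by rewrite mulrC -ler_pdivlMr //; near: s.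
Unshelve. all: by end_near. Qed.

Definition prim f : R -> R := ClassicalEpsilon.epsilon (inhabits (fun _ => 0 : R))
  (fun F : R -> R => F 0 = 0 /\ forall x, is_derive x 1 F (f x)).

Lemma primP f : continuous f -> prim f 0 = 0 /\ forall x, is_derive x 1 (prim f) (f x).
Proof. move=> /primitive H; exact: ClassicalEpsilon.epsilon_spec H. Qed.

Fixpoint picard (n : nat) : (R -> R) * (R -> R) :=
  match n with
  | 0%N => (fun _ => x0, fun _ => y0)
  | n'.+1 => let u := (picard n').1 in let v := (picard n').2 in
     (fun t => x0 + prim (fun s => F1 (u s) (v s)) t, fun t => y0 + prim (fun s => F2 (u s) (v s)) t)
  end.

Let u n := (picard n).1.
Let v n := (picard n).2.

Lemma picard_cont n : continuous (u n) /\ continuous (v n).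
Proof.
elim: n => [|n [cu cv]]; first by split=> t; exact: cvg_cst.
have [_ h1] := primP (lipschitz_cont2 (ltW L0) F1L cu cv).
have [_ h2] := primP (lipschitz_cont2 (ltW L0) F2L cu cv).
by split=> t; [exact: (der_cont (derD (derC t x0) (h1 t)))|exact: (der_cont (derD (derC t y0) (h2 t)))].
Qed.

Lemma picard_der n t : is_derive t 1 (u n.+1) (F1 (u n t) (v n t)) /\
  is_derive t 1 (v n.+1) (F2 (u n t) (v n t)).
Proof.
have [cu cv] := picard_cont n.
have [_ h1] := primP (lipschitz_cont2 (ltW L0) F1L cu cv).
have [_ h2] := primP (lipschitz_cont2 (ltW L0) F2L cu cv).
by split; [apply: (der_eq (derD (derC t x0) (h1 t)))|apply: (der_eq (derD (derC t y0) (h2 t)))]; rewrite add0r.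
Qed.

Lemma picard0 n : u n 0 = x0 /\ v n 0 = y0.
Proof.
case: n => [//|n]; have [cu cv] := picard_cont n.
have [h1 _] := primP (lipschitz_cont2 (ltW L0) F1L cu cv).
have [h2 _] := primP (lipschitz_cont2 (ltW L0) F2L cu cv).
by split; [rewrite -[LHS]/(x0 + _) h1 addr0|rewrite -[LHS]/(y0 + _) h2 addr0].
Qed.

Let half n : R := 2^-1 ^+ n.
Let half_ge0 n : 0 <= half n. Proof. by rewrite exprn_ge0 // invr_ge0. Qed.
Let halfS n : half n.+1 = half n / 2. Proof. by rewrite /half exprSr. Qed.
Let Ch_ge0 n : 0 <= C / 2 * half n.
Proof. by apply: mulr_ge0 => //; apply: divr_ge0. Qed.
Let wC_ge0 t : 0 <= C * w t.
Proof. by apply: mulr_ge0 => //; exact: expR_ge0. Qed.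

Lemma picard_step n t : `|u n.+1 t - u n t| <= C / 2 * half n * w t /\
  `|v n.+1 t - v n t| <= C / 2 * half n * w t.
Proof.
elim: n t => [|n IH] t.
  have base (f f' : R -> R) : (forall x : R, is_derive x 1 f (f' x)) -> f 0 = 0 -> (forall x, `|f' x| <= B) ->
      `|f t| <= C / 2 * half 0 * w t.
    move=> df f0 hf; apply: weighted_bound df f0 _ _ t => [x|].
      apply: le_trans (hf x) _; rewrite /C /half expr0 mulr1.
      have -> : K * (2 * B / K / 2) = B by field; rewrite gt_eqF.
      by rewrite ler_peMr // w_ge1.
    exact: Ch_ge0.
  split.
    apply: (base (fun t => u 1%N t - u 0%N t) (fun t => F1 (u 0%N t) (v 0%N t))) => [x||x].
    - by apply: (der_eq (derB (picard_der 0 x).1 (derC x x0))); rewrite subr0.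
    - by rewrite !(picard0 _).1 subrr.
    - exact: F1B.
  apply: (base (fun t => v 1%N t - v 0%N t) (fun t => F2 (u 0%N t) (v 0%N t))) => [x||x].
  - by apply: (der_eq (derB (picard_der 0 x).2 (derC x y0))); rewrite subr0.
  - by rewrite !(picard0 _).2 subrr.
  - exact: F2B.
have hk := Ch_ge0 n.+1.
have st x : L * (`|u n.+1 x - u n x| + `|v n.+1 x - v n x|) <= K * (C / 2 * half n.+1) * w x.
  have [h1 h2] := IH x.
  apply: (@le_trans _ _ (L * (C / 2 * half n * w x + C / 2 * half n * w x))).
    by apply: ler_wpM2l; [exact: ltW|exact: lerD].
  by rewrite halfS /K le_eqVlt; apply/orP; left; apply/eqP; field.
split.
  apply: (weighted_bound (fun x => derB (picard_der n.+1 x).1 (picard_der n x).1)) => [|x|//].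
    by rewrite !(picard0 _).1 subrr.
  exact: le_trans (F1L _ _ _ _) (st x).
apply: (weighted_bound (fun x => derB (picard_der n.+1 x).2 (picard_der n x).2)) => [|x|//].
  by rewrite !(picard0 _).2 subrr.
exact: le_trans (F2L _ _ _ _) (st x).
Qed.

(** The intervals of radius k 2^-n about f n are nested; the limit is the infimum of their right
    ends. *)
Lemma limit_exists (f : nat -> R) (k : R) : 0 <= k ->
  (forall n, `|f n.+1 - f n| <= k / 2 * half n) ->
  exists l, forall n, `|f n - l| <= k * half n.
Proof.
move=> k0 hf.
pose a n := f n + k * half n; pose b n := f n - k * half n.
have aS n : a n.+1 <= a n.
  by rewrite /a halfS; have := hf n; rewrite ler_norml => /andP[]; lra.
have bS n : b n <= b n.+1.
  by rewrite /b halfS; have := hf n; rewrite ler_norml => /andP[]; lra.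
have anti n m : (n <= m)%N -> a m <= a n.
  by move/subnKC <-; elim: (m - n)%N => [|i IH]; rewrite ?addn0 // addnS (le_trans (aS _)).
have mono n m : (n <= m)%N -> b n <= b m.
  by move/subnKC <-; elim: (m - n)%N => [|i IH]; rewrite ?addn0 // addnS (le_trans IH).
have hp n : 0 <= k * half n by rewrite mulr_ge0.
have ba n m : b n <= a m.
  apply: (@le_trans _ _ (b (maxn n m))); first by rewrite mono ?leq_maxl.
  apply: (@le_trans _ _ (a (maxn n m))); last by rewrite anti ?leq_maxr.
  by rewrite /a /b; have := hp (maxn n m); lra.
exists (inf (range a)) => n.
have h1 : inf (range a) <= a n.
  by apply: ge_inf; [exists (b 0%N) => _ [m _ <-]|exists n].
have h2 : b n <= inf (range a).
  by apply: lb_le_inf; [exists (a 0%N); exists 0%N|move=> _ [m _ <-]].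
by rewrite ler_norml; move: h1 h2; rewrite /a /b => h1 h2; apply/andP; split; lra.
Qed.

Lemma half_small (x k : R) : (forall n, x <= k * half n) -> x <= 0.
Proof.
move=> h; have hl : (k * half n) @[n --> \oo] --> k * 0.
  apply: cvgMr; apply: cvg_expr; rewrite ger0_norm ?invr_ge0 //.
  by rewrite invf_lt1 // ltr1n.
rewrite leNgt; apply/negP => xpos.
have : k * 0 < x by rewrite mulr0.
move=> /(cvgr_lt _ hl)[n _ /(_ n (leqnn n))] /=.
by rewrite ltNge h.
Qed.

Theorem picard_global : exists f g : R -> R, f 0 = x0 /\ g 0 = y0 /\
  forall t, is_derive t 1 f (F1 (f t) (g t)) /\ is_derive t 1 g (F2 (f t) (g t)).
Proof.
have /choice[f hf] : forall t, exists l, forall n, `|u n t - l| <= C * w t * half n.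
  move=> t; apply: limit_exists => [|n]; first exact: wC_ge0.
  by have [h _] := picard_step n t; apply: le_trans h _; rewrite le_eqVlt; apply/orP; left; apply/eqP; ring.
have /choice[g hg] : forall t, exists l, forall n, `|v n t - l| <= C * w t * half n.
  move=> t; apply: limit_exists => [|n]; first exact: wC_ge0.
  by have [_ h] := picard_step n t; apply: le_trans h _; rewrite le_eqVlt; apply/orP; left; apply/eqP; ring.
(* All iterates share the Lipschitz constant B, so the limits are continuous and the limiting
   integrand has a primitive. *)
have lim_lip h (U : nat -> R -> R) : (forall t n, `|U n t - h t| <= C * w t * half n) ->
    (forall n s t, `|U n s - U n t| <= B * `|s - t|) -> forall s t, `|h s - h t| <= B * `|s - t|.
  move=> hU hL s t; rewrite -subr_le0; apply: (@half_small _ (C * w s + C * w t)) => n.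
  rewrite mulrDl lerBlDr.
  have -> : h s - h t = - (U n s - h s) + (U n t - h t) + (U n s - U n t) by ring.
  apply: le_trans (ler_normD _ _) _; apply: lerD => //.
  by apply: le_trans (ler_normD _ _) _; rewrite normrN lerD.
have Lu n s t : `|u n s - u n t| <= B * `|s - t|.
  case: n => [|n]; first by rewrite subrr normr0; apply: mulr_ge0.
  exact: (bounded_lip (fun x => (picard_der n x).1) (fun x => F1B _ _)).
have Lv n s t : `|v n s - v n t| <= B * `|s - t|.
  case: n => [|n]; first by rewrite subrr normr0; apply: mulr_ge0.
  exact: (bounded_lip (fun x => (picard_der n x).2) (fun x => F2B _ _)).
have cf := lip_cont (lim_lip _ _ hf Lu); have cg := lip_cont (lim_lip _ _ hg Lv).
(* Passage to the limit in the integral equation: the gap between h and z0 plus the primitive is at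
   most a constant times 2^-n for every n. *)
have key (G : R -> R -> R) (z0 : R) (U : nat -> R -> R) h :
    (forall x y x' y' : R, `|G x y - G x' y'| <= L * (`|x - x'| + `|y - y'|)) ->
    (forall n t, is_derive t 1 (U n.+1) (G (u n t) (v n t))) -> (forall n, U n 0 = z0) ->
    (forall t n, `|U n t - h t| <= C * w t * half n) ->
    h 0 = z0 /\ forall t, is_derive t 1 h (G (f t) (g t)).
  move=> GL dU U0 hU.
  have [P0 dP] := primP (lipschitz_cont2 (ltW L0) GL cf cg).
  set P := prim _ in P0 dP.
  have E t : h t = z0 + P t.
    apply/eqP; rewrite -subr_eq0 -normr_le0; apply: (@half_small _ (C * w t + C * w t)) => n.
    have D1 : `|U n.+1 t - (z0 + P t)| <= C * half n * w t.
      apply: (@weighted_bound (fun t => U n.+1 t - (z0 + P t))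
        (fun t => G (u n t) (v n t) - G (f t) (g t))) => [x||x|].
      - by apply: (der_eq (derB (dU n x) (derD (derC x z0) (dP x)))); rewrite add0r.
      - by rewrite U0 P0 addr0 subrr.
      - apply: le_trans (GL _ _ _ _) _.
        apply: (@le_trans _ _ (L * (C * w x * half n + C * w x * half n))).
          by apply: ler_wpM2l; [exact: ltW|exact: lerD].
        have hn : 0 <= L * (C * w x * half n) by apply: mulr_ge0; [exact: ltW|apply: mulr_ge0].
        by move: hn; rewrite /K; lra.
      - by apply: mulr_ge0.
    have D2 := hU t n.+1.
    have -> : h t - (z0 + P t) = - (U n.+1 t - h t) + (U n.+1 t - (z0 + P t)) by ring.
    apply: le_trans (ler_normD _ _) _; rewrite normrN mulrDl lerD //.
      by apply: le_trans D2 _; rewrite ler_wpM2l // halfS; have := half_ge0 n; lra.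
    by rewrite mulrAC.
  split; first by rewrite E P0 addr0.
  move=> t; have -> : h = (fun t => z0 + P t) by apply: funext.
  by apply: (der_eq (derD (derC t z0) (dP t))); rewrite add0r.
have [f0 df] := key F1 x0 u f F1L (fun n t => (picard_der n t).1) (fun n => (picard0 n).1) hf.
have [g0 dg] := key F2 y0 v g F2L (fun n t => (picard_der n t).2) (fun n => (picard0 n).2) hg.
by exists f, g; split=> //; split=> // t.
Qed.

End Picard.
End Calculus.

(** * The planar system *)

Section BoundedLipschitz.
Variable R : realType.

(** Bounds are carried with the Lipschitz constants so that the class is closed under products,
    hence contains every polynomial in the clamped coordinates. *)
Definition blip (F : R -> R -> R) := exists B L, [/\ 0 <= B, 0 <= L,
  forall x y, `|F x y| <= B &
  forall x y x' y', `|F x y - F x' y'| <= L * (`|x - x'| + `|y - y'|)].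

Lemma blip_cst (c : R) : blip (fun _ _ => c).
Proof.
exists `|c|, 0; split=> // x y x' y'; by rewrite subrr normr0 mul0r.
Qed.

Lemma blipD F G : blip F -> blip G -> blip (fun x y => F x y + G x y).
Proof.
move=> [B [L [B0 L0 FB FL]]] [B' [L' [B0' L0' GB GL]]].
exists (B + B'), (L + L'); split; [exact: addr_ge0|exact: addr_ge0|move=> x y|move=> x y x' y'].
  by apply: le_trans (ler_normD _ _) _; apply: lerD.
rewrite mulrDl (_ : _ - _ = (F x y - F x' y') + (G x y - G x' y')); last by ring.
by apply: le_trans (ler_normD _ _) _; apply: lerD.
Qed.

Lemma blipM F G : blip F -> blip G -> blip (fun x y => F x y * G x y).
Proof.
move=> [B [L [B0 L0 FB FL]]] [B' [L' [B0' L0' GB GL]]].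
exists (B * B'), (B * L' + B' * L); split; [exact: mulr_ge0|by apply: addr_ge0; apply: mulr_ge0|move=> x y|move=> x y x' y'].
  by rewrite normrM ler_pM.
rewrite mulrDl (_ : _ - _ = F x y * (G x y - G x' y') + G x' y' * (F x y - F x' y')); last by ring.
apply: le_trans (ler_normD _ _) _; rewrite !normrM -!mulrA.
by apply: lerD; apply: ler_pM.
Qed.

(** The upper limit 2 is one that positive solutions starting at (1, 1) never reach ([in_box]). *)
Definition clamp (x : R) : R := Num.max 0 (Num.min 2 x).

Lemma clamp_bound x : 0 <= clamp x <= 2.
Proof. by rewrite /clamp le_max lexx /= ge_max ge_min lexx ler0n. Qed.

Lemma clamp_id x : 0 <= x <= 2 -> clamp x = x.
Proof. by move=> /andP[x0 x2]; rewrite /clamp (min_idPr x2) (max_idPr x0). Qed.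

Lemma clamp_lip x y : `|clamp x - clamp y| <= `|x - y|.
Proof.
have m2 : Num.max 0 2 = 2 :> R by apply/max_idPr.
have cE w : clamp w = if w <= 0 then 0 else if w <= 2 then w else 2.
  rewrite /clamp; case: (leP w 0) => w0.
    by rewrite (min_idPr (le_trans w0 (ler0n _ 2))) (max_idPl w0).
  case: (leP w 2) => w2; last by rewrite m2.
  by rewrite (max_idPr (ltW w0)).
rewrite !cE; case: (leP x 0) => ?; case: (leP y 0) => ?; case: (leP x 2) => ?; case: (leP y 2) => ?;
  rewrite ler_norml; apply/andP; case: (ler0P (x - y)) => h; split; lra.
Qed.

Lemma blip_fst : blip (fun x _ => clamp x).
Proof.
exists 2, 1; split; [by []|by []|move=> x y|move=> x y x' y'].
  by have /andP[h1 h2] := clamp_bound x; rewrite ger0_norm.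
by rewrite mul1r (le_trans (clamp_lip _ _)) // lerDl.
Qed.

Lemma blip_snd : blip (fun _ y => clamp y).
Proof.
exists 2, 1; split; [by []|by []|move=> x y|move=> x y x' y'].
  by have /andP[h1 h2] := clamp_bound y; rewrite ger0_norm.
by rewrite mul1r (le_trans (clamp_lip _ _)) // lerDr.
Qed.

Lemma blipX F n : blip F -> blip (fun x y => F x y ^+ n).
Proof.
move=> hF; elim: n => [|n IH]; first exact: blip_cst.
have -> : (fun x y => F x y ^+ n.+1) = (fun x y => F x y * F x y ^+ n).
  by apply: funext => x; apply: funext => y; rewrite exprS.
exact: blipM.
Qed.

End BoundedLipschitz.

Section FirstExit.
Variable R : realType.

(** The time is the infimum of those with h nonpositive; continuity there rules out both strict
    signs. *)
Lemma first_zero (h : R -> R) (T : R) : 0 < T -> continuous h -> 0 < h 0 -> h T <= 0 ->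
  exists2 s, 0 < s <= T & h s = 0 /\ forall r, 0 <= r < s -> 0 < h r.
Proof.
move=> T0 ch h0 hT.
pose S := [set s : R | 0 <= s <= T /\ h s <= 0].
have ST : S T by split; [rewrite lexx ltW|exact: hT].
have lbS : lbound S 0 by move=> s [/andP[]].
have hasS : has_inf S by split; [exists T|exists 0].
pose s := inf S.
have s0 : 0 <= s by apply: lb_le_inf => //; exists T.
have sT : s <= T by apply: ge_inf => //; exists 0.
have pos r : 0 <= r < s -> 0 < h r.
  move=> /andP[r0 rs]; rewrite ltNge; apply/negP => hr.
  have : s <= r by apply: ge_inf; [exists 0|split=> //; rewrite r0 (le_trans (ltW rs))].
  by rewrite leNgt rs.
have hs : h s <= 0.
  rewrite leNgt; apply/negP => hs.
  have /(cvgr_gt _ (ch s))/nbhs_ballP[e /= e0 he] : 0 < h s by [].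
  have [r [/andP[r0 rT] hr] rse] := inf_adherent e0 hasS.
  have sr : s <= r by apply: ge_inf; [exists 0|split=> //; rewrite r0].
  have : 0 < h r.
    by apply: he; rewrite -ball_normE /= distrC ger0_norm ?subr_ge0 // ltrBlDl.
  by rewrite ltNge hr.
have spos : 0 < s by rewrite lt_neqAle s0 andbT; apply: contraTneq h0 => E; rewrite -leNgt [X in h X]E.
exists s; rewrite ?spos //; split=> //; apply/eqP; rewrite eq_le hs /=.
rewrite leNgt; apply/negP => hneg.
have /(cvgr_lt _ (ch s))/nbhs_ballP[e /= e0 he] : h s < 0 by [].
pose r := s - Num.min s e / 2.
have m0 : 0 < Num.min s e by rewrite lt_min spos.
have ms : Num.min s e <= s by rewrite ge_min lexx.
have me : Num.min s e <= e by rewrite ge_min lexx orbT.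
have hr : 0 < h r by apply: pos; rewrite /r; apply/andP; split; lra.
have : h r < 0 by apply: he; rewrite -ball_normE /= /r ger0_norm; lra.
by rewrite ltNge (ltW hr).
Qed.

End FirstExit.

(* With [g = y z] and the new time [dtau = dt / (12 g^3 z^5)] the system becomes the polynomial
   one [g' = Fg g z], [z' = Fz g z]. *)
Section ReducedSystem.
Variables (R : realType) (k : R).
Hypothesis k0 : 0 < k.

Definition Fg (g z : R) : R := k * g * z ^+ 6 + 2 * z ^+ 3 - k * g ^+ 3 * z ^+ 2.
Definition Fz (g z : R) : R := - (k * g * z ^+ 3 + 1) * g.
Definition Fgc (x y : R) := Fg (clamp x) (clamp y).
Definition Fzc (x y : R) := Fz (clamp x) (clamp y).

Lemma blip_Fgc : blip Fgc.
Proof.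
have hx := blip_fst R; have hy := blip_snd R.
apply: (blipD (blipD (blipM (blipM (blip_cst k) hx) (blipX 6 hy))
  (blipM (blip_cst 2) (blipX 3 hy)))).
have -> : (fun x y : R => - (k * clamp x ^+ 3 * clamp y ^+ 2)) =
          (fun x y : R => - 1 * (k * clamp x ^+ 3 * clamp y ^+ 2)).
  by apply: funext => x; apply: funext => y; rewrite mulN1r.
exact: (blipM (blip_cst (-1)) (blipM (blipM (blip_cst k) (blipX 3 hx)) (blipX 2 hy))).
Qed.

Lemma blip_Fzc : blip Fzc.
Proof.
have hx := blip_fst R; have hy := blip_snd R.
have -> : Fzc = (fun x y : R => - 1 * (k * clamp x * clamp y ^+ 3 + 1) * clamp x).
  by apply: funext => x; apply: funext => y; rewrite /Fzc /Fz mulN1r.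
exact: (blipM (blipM (blip_cst (-1)) (blipD (blipM (blipM (blip_cst k) hx) (blipX 3 hy)) (blip_cst 1))) hx).
Qed.

Lemma clamped_solution : exists L (G Z : R -> R), [/\ 0 <= L,
  forall x y x' y', `|Fgc x y - Fgc x' y'| <= L * (`|x - x'| + `|y - y'|),
  forall x y x' y', `|Fzc x y - Fzc x' y'| <= L * (`|x - x'| + `|y - y'|) &
  G 0 = 1 /\ Z 0 = 1 /\
  forall t : R, is_derive t 1 G (Fgc (G t) (Z t)) /\ is_derive t 1 Z (Fzc (G t) (Z t))].
Proof.
have [B [L [B0 L0 hB hL]]] := blip_Fgc.
have [B' [L' [B0' L0' hB' hL']]] := blip_Fzc.
have LL x y x' y' : 0 <= `|x - x'| + `|y - y'| :> R by rewrite addr_ge0.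
have h1 x y x' y' : `|Fgc x y - Fgc x' y'| <= (L + L' + 1) * (`|x - x'| + `|y - y'|).
  by apply: le_trans (hL _ _ _ _) _; apply: ler_wpM2r => //; lra.
have h2 x y x' y' : `|Fzc x y - Fzc x' y'| <= (L + L' + 1) * (`|x - x'| + `|y - y'|).
  by apply: le_trans (hL' _ _ _ _) _; apply: ler_wpM2r => //; lra.
have Lp : 0 < L + L' + 1 by lra.
have h3 x y : `|Fgc x y| <= B + B' by apply: le_trans (hB _ _) _; lra.
have h4 x y : `|Fzc x y| <= B + B' by apply: le_trans (hB' _ _) _; lra.
have [f [g [f0 [g0 fg]]]] := picard_global 1 1 Lp h1 h2 h3 h4.
by exists (L + L' + 1), f, g; split=> //; exact: ltW.
Qed.

(* A solution of the system up to a time change of nonnegative speed [m]. *)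
Section Bounds.
Variables (g z m : R -> R).

(** In the derivative of g^2 + z^4 the terms 4 g z^3 cancel, leaving - 2 k g^2 z^2 (z^4 + g^2) times
    the speed. *)
Lemma forward_bounds (T : R) : 0 <= T -> g 0 = 1 -> z 0 = 1 ->
  (forall t : R, 0 <= t <= T -> [/\ 0 <= g t, 0 <= z t, 0 <= m t,
     is_derive t 1 g (m t * Fg (g t) (z t)) & is_derive t 1 z (m t * Fz (g t) (z t))]) ->
  z T <= 1 /\ g T ^+ 2 + z T ^+ 4 <= 2.
Proof.
move=> T0 g0 z0 H; split.
  rewrite -z0 -lerN2.
  apply: (@der_ge0 _ (fun s => - z s) (fun t => m t * ((k * g t * z t ^+ 3 + 1) * g t))) => // t /H[gt zt mt dg dz].
    by apply: (der_eq (derN dz)); rewrite /Fz; ring.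
  by rewrite !mulr_ge0 // addr_ge0 // !mulr_ge0 ?exprn_ge0 // ltW.
have -> : (2 : R) = g 0 ^+ 2 + z 0 ^+ 4 by rewrite g0 z0 !expr1n.
rewrite -lerN2.
apply: (@der_ge0 _ (fun s => - (g s ^+ 2 + z s ^+ 4))
   (fun t => m t * (2 * k * (g t ^+ 2 * z t ^+ 2) * (z t ^+ 4 + g t ^+ 2)))) => // t /H[gt zt mt dg dz].
  by apply: (der_eq (derN (derD (derX 1 dg) (derX 3 dz)))); rewrite /Fg /Fz; ring.
apply: mulr_ge0 => //; apply: mulr_ge0; last by apply: addr_ge0; exact: exprn_ge0.
apply: mulr_ge0; last by apply: mulr_ge0; exact: exprn_ge0.
by apply: mulr_ge0 => //; exact: ltW.
Qed.

(** Division by z^2 cancels the terms in k: the derivative of the quotient is 2 (g^2 + z^4) g / z^3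
    times the speed, so its past values are at most 2. *)
Lemma backward_bounds (T : R) : T <= 0 -> g 0 = 1 -> z 0 = 1 ->
  (forall t : R, T <= t <= 0 -> [/\ 0 <= g t, 0 < z t, 0 <= m t,
     is_derive t 1 g (m t * Fg (g t) (z t)) & is_derive t 1 z (m t * Fz (g t) (z t))]) ->
  1 <= z T /\ g T ^+ 2 + z T ^+ 4 <= 2 * z T ^+ 2.
Proof.
move=> T0 g0 z0 H; split.
  rewrite -z0 -lerN2.
  apply: (@der_ge0 _ (fun s => - z s) (fun t => m t * ((k * g t * z t ^+ 3 + 1) * g t))) => // t /H[gt zt mt dg dz].
    by apply: (der_eq (derN dz)); rewrite /Fz; ring.
  have z3 : 0 <= z t ^+ 3 by apply: exprn_ge0; exact: ltW.
  apply: mulr_ge0 => //; apply: mulr_ge0 => //; apply: addr_ge0 => //.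
  by apply: mulr_ge0 => //; apply: mulr_ge0 => //; exact: ltW.
have zT : 0 < z T by have [|_ ? _ _ _] := H T; rewrite ?lexx.
rewrite -ler_pdivrMr ?exprn_gt0 //.
have -> : (2 : R) = (g 0 ^+ 2 + z 0 ^+ 4) / z 0 ^+ 2 by rewrite g0 z0 !expr1n; field.
apply: (@der_ge0 _ (fun s => (g s ^+ 2 + z s ^+ 4) * (z s ^+ 2)^-1)
   (fun t => m t * (2 * (g t ^+ 2 + z t ^+ 4) * g t / z t ^+ 3))) => // t /H[gt zt mt dg dz].
  have z2 : z t ^+ 2 != 0 by rewrite expf_neq0 // gt_eqF.
  apply: (der_eq (derM (derD (derX 1 dg) (derX 3 dz)) (@derV _ _ (fun s => z s ^+ 2) _ z2 (derX 1 dz)))).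
  by rewrite /Fg /Fz; field; rewrite gt_eqF.
apply: mulr_ge0 => //; apply: divr_ge0; last by apply: exprn_ge0; exact: ltW.
apply: mulr_ge0 => //; apply: mulr_ge0 => //; apply: addr_ge0; first exact: exprn_ge0.
by apply: exprn_ge0; exact: ltW.
Qed.

Lemma in_box (t : R) : 0 <= t /\ (forall s : R, 0 <= s <= t -> [/\ 0 <= g s, 0 < z s, 0 <= m s,
     is_derive s 1 g (m s * Fg (g s) (z s)) & is_derive s 1 z (m s * Fz (g s) (z s))]) \/
  t <= 0 /\ (forall s : R, t <= s <= 0 -> [/\ 0 <= g s, 0 < z s, 0 <= m s,
     is_derive s 1 g (m s * Fg (g s) (z s)) & is_derive s 1 z (m s * Fz (g s) (z s))]) ->
  g 0 = 1 -> z 0 = 1 -> g t < 2 /\ z t < 2.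
Proof.
move=> H g0 z0; case: H => -[t0 H].
  have H' s : 0 <= s <= t -> [/\ 0 <= g s, 0 <= z s, 0 <= m s,
     is_derive s 1 g (m s * Fg (g s) (z s)) & is_derive s 1 z (m s * Fz (g s) (z s))].
    by move=> /H[? /ltW].
  have [z1 gz] := forward_bounds t0 g0 z0 H'.
  have [gt zt _ _ _] := H' t (introT andP (conj t0 (lexx t))).
  by have := exprn_ge0 4 zt; split; nra.
have [z1 gz] := backward_bounds t0 g0 z0 H.
have [gt zt _ _ _] := H t (introT andP (conj (lexx t) t0)).
rewrite (_ : z t ^+ 4 = (z t ^+ 2) ^+ 2) in gz; last by rewrite -exprM.
(* From g^2 <= z^2 (2 - z^2): the right side is at most 1 and must be nonnegative. *)
have z2 : z t ^+ 2 <= 2 by nra.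
by split; nra.
Qed.

End Bounds.
End ReducedSystem.

Lemma nonzero_pos (R : realType) (f : R -> R) (a b : R) : a < 0 < b ->
  (forall t, a < t < b -> {for t, continuous f}) ->
  (forall t, a < t < b -> f t != 0) -> 0 < f 0 -> forall t, a < t < b -> 0 < f t.
Proof.
move=> /andP[a0 b0] cf fn0 f0 t /andP[at_ tb]; rewrite ltNge; apply/negP => ft.
have mm : Num.min (f t) (f 0) <= 0 <= Num.max (f t) (f 0).
  by rewrite ge_min ft le_max (ltW f0) orbT.
have IV x y : x <= y -> a < x -> y < b -> Num.min (f x) (f y) <= 0 <= Num.max (f x) (f y) -> False.
  move=> xy ax yb mxy.
  have [|c] := @IVT R f x y 0 xy _ mxy.
    apply: continuous_in_subspaceT => c; rewrite inE /= in_itv /= => /andP[xc cy].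
    by apply: cf; rewrite (lt_le_trans ax xc) (le_lt_trans cy yb).
  rewrite in_itv /= => /andP[xc cy] fc; have := fn0 c.
  by rewrite fc eqxx (lt_le_trans ax xc) (le_lt_trans cy yb) => /(_ isT).
have [t0|t0] := leP 0 t.
  by apply: (IV 0 t) => //; rewrite minC maxC.
by apply: (IV t 0) => //; exact: ltW.
Qed.

(** * Vanishing of a coordinate in finite time *)

Section Exit.
Variables (R : realType) (k : R).
Hypothesis k0 : 0 < k.
Variables (G Z : R -> R).
Hypotheses (G0 : G 0 = 1) (Z0 : Z 0 = 1).
Hypothesis dGZ : forall t : R,
  is_derive t 1 G (Fgc k (G t) (Z t)) /\ is_derive t 1 Z (Fzc k (G t) (Z t)).

(** Positive exactly inside the open box (0, 2)^2, on which the clamped and the true fields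
    agree. *)
Let h : R -> R := (G \min Z) \min ((fun s => 2 - G s) \min (fun s => 2 - Z s)).

Lemma contG : continuous G. Proof. by move=> t; exact: der_cont (dGZ t).1. Qed.
Lemma contZ : continuous Z. Proof. by move=> t; exact: der_cont (dGZ t).2. Qed.

Lemma cont_h : continuous h.
Proof.
have c2 (f : R -> R) : continuous f -> continuous (fun s => 2 - f s).
  by move=> cf t; apply: (continuousB _ (cf t)); exact: cvg_cst.
by apply: min_fun_continuous; apply: min_fun_continuous;
  [exact: contG|exact: contZ|exact: c2 contG|exact: c2 contZ].
Qed.

Lemma h_gt0 s : (0 < h s) = [&& 0 < G s, 0 < Z s, G s < 2 & Z s < 2].
Proof. by rewrite /h /= !lt_min !subr_gt0 -!andbA. Qed.

Lemma h_ge0 s : 0 <= h s -> [/\ 0 <= G s, 0 <= Z s, G s <= 2 & Z s <= 2].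
Proof. by rewrite /h /= !le_min !subr_ge0 => /andP[/andP[? ?] /andP[? ?]]. Qed.

Lemma unclamped s : 0 <= h s ->
  is_derive s 1 G (1 * Fg k (G s) (Z s)) /\ is_derive s 1 Z (1 * Fz k (G s) (Z s)).
Proof.
move=> /h_ge0[G1 Z1 G2 Z2]; have := dGZ s.
by rewrite /Fgc /Fzc !clamp_id ?G1 ?Z1 // !mul1r.
Qed.

Lemma h0_gt0 : 0 < h 0.
Proof. by rewrite h_gt0 G0 Z0 ltr01 ltr1n. Qed.

(** An exit cannot be through the walls at 2, by [forward_bounds]. Without an exit up to [T] one
    would have G >= 1 / c, so Z would fall with speed at least 1 / c and be negative at [T] = c +
    1. *)
Lemma forward_exit : exists s, [/\ 0 < s, forall r, 0 <= r < s -> 0 < h r & G s = 0 \/ Z s = 0].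
Proof.
pose c := 1 + k / 3; have c0 : 0 < c by rewrite addr_gt0 // divr_gt0.
pose T := c + 1; have T0 : 0 < T by rewrite addr_gt0.
have [[t /andP[t0 tT] ht]|noexit] := pselect (exists2 t, 0 < t <= T & h t <= 0).
  have [s /andP[s0 st] [hs pos]] := first_zero t0 cont_h h0_gt0 ht.
  exists s; split=> //.
  have ge0 r : 0 <= r <= s -> 0 <= h r.
    rewrite le_eqVlt => /andP[r0]; rewrite le_eqVlt => /orP[/eqP ->|rs]; first by rewrite hs.
    by apply/ltW/pos; rewrite rs andbT le_eqVlt.
  have H r : 0 <= r <= s -> [/\ 0 <= G r, 0 <= Z r, 0 <= (1 : R),
     is_derive r 1 G (1 * Fg k (G r) (Z r)) & is_derive r 1 Z (1 * Fz k (G r) (Z r))].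
    by move=> /ge0 hr; have [? ? _ _] := h_ge0 hr; have [? ?] := unclamped hr.
  have [z1 gz] := @forward_bounds R k k0 G Z (fun _ => 1) s (ltW s0) G0 Z0 H.
  have [gs zs _ _ _] := H s (introT andP (conj (ltW s0) (lexx s))).
  have [G0'|Gn] := eqVneq (G s) 0; first by left.
  have [Z0'|Zn] := eqVneq (Z s) 0; first by right.
  have : 0 < h s.
    rewrite h_gt0 !lt_neqAle gs zs ![0 == _]eq_sym Gn Zn /= -!lt_neqAle.
    have := exprn_ge0 4 zs => z4; rewrite (le_lt_trans z1 (ltr1n _ 2)) andbT; nra.
  by rewrite hs ltxx.
have pos t : 0 <= t <= T -> 0 < h t.
  move=> /andP[]; rewrite le_eqVlt => /orP[/eqP <- _|t0 tT]; first exact: h0_gt0.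
  by rewrite ltNge; apply/negP => ht; apply: noexit; exists t; rewrite ?t0.
have GP t : 0 <= t <= T -> c^-1 <= G t.
  move=> /andP[t0 tT].
  have sub s : 0 <= s <= t -> 0 < h s by move=> /andP[s0 st]; rewrite pos // s0 (le_trans st).
  (* The factor k / 3 makes the terms k G Z^2 cancel, so 1 / G + (k / 3) Z^3 decreases; its initial
     value is c. *)
  have W : - ((G 0)^-1 + k / 3 * Z 0 ^+ 3) <= - ((G t)^-1 + k / 3 * Z t ^+ 3).
    apply: (@der_ge0 _ (fun s => - ((G s)^-1 + k / 3 * Z s ^+ 3))
      (fun s => k * Z s ^+ 6 / G s + 2 * Z s ^+ 3 / G s ^+ 2 + k ^+ 2 * G s ^+ 2 * Z s ^+ 5)) => // s hs.
      have hps := sub s hs; have [dg dz] := unclamped (ltW hps).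
      have /and4P[g0 z0 _ _] : [&& 0 < G s, 0 < Z s, G s < 2 & Z s < 2] by rewrite -h_gt0.
      have gn0 : G s != 0 by rewrite gt_eqF.
      apply: (der_eq (derN (derD (derV gn0 dg) (derZ (k / 3) (derX 2 dz))))).
      by rewrite /Fg /Fz; field.
    have /and4P[g0 z0 _ _] : [&& 0 < G s, 0 < Z s, G s < 2 & Z s < 2] by rewrite -h_gt0 sub.
    by rewrite !addr_ge0 // ?divr_ge0 ?mulr_ge0 ?exprn_ge0 // ltW.
  have /and4P[g0 z0 _ _] : [&& 0 < G t, 0 < Z t, G t < 2 & Z t < 2] by rewrite -h_gt0 sub ?t0 ?lexx.
  rewrite -(invrK (G t)) lef_pV2 ?posrE ?invr_gt0 //.
  have z3 : 0 <= k / 3 * Z t ^+ 3 by rewrite mulr_ge0 ?divr_ge0 ?exprn_ge0 // ltW.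
  by move: W; rewrite G0 Z0 invr1 expr1n /c; lra.
have : - Z 0 - c^-1 * 0 <= - Z T - c^-1 * T.
  apply: (@der_ge0 _ (fun s => - Z s - c^-1 * s)
    (fun s => (k * G s * Z s ^+ 3 + 1) * G s - c^-1)) => // [|s hs|s hs].
  - exact: ltW.
  - have [dg dz] := unclamped (ltW (pos s hs)).
    by apply: (der_eq (derB (derN dz) (derZ c^-1 (derI s)))); rewrite /Fz; ring.
  - have := GP s hs; have /and4P[g0 z0 _ _] : [&& 0 < G s, 0 < Z s, G s < 2 & Z s < 2].
      by rewrite -h_gt0 pos.
    have : 0 <= k * G s * Z s ^+ 3 * G s.
      by rewrite !mulr_ge0 ?exprn_ge0 // ltW.
    lra.
have /and4P[_ z0 _ _] : [&& 0 < G T, 0 < Z T, G T < 2 & Z T < 2].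
  by rewrite -h_gt0 pos // lexx ltW.
rewrite Z0 mulr0 /T mulrDr mulVf ?gt_eqF // mulr1.
have : 0 < c^-1 by rewrite invr_gt0.
lra.
Qed.

Lemma backward_exit : exists s, [/\ s < 0, forall r, s < r <= 0 -> 0 < h r & G s = 0 \/ Z s = 0].
Proof.
have chN : continuous (fun s => h (- s)).
  by move=> s; apply: (@continuous_comp _ _ _ (fun s => - s) h); [exact: oppr_continuous|exact: cont_h].
have hN0 : 0 < h (- 0) by rewrite oppr0 h0_gt0.
have [[t /andP[t0 tT] ht]|noexit] := pselect (exists2 t, 0 < t <= 1 & h (- t) <= 0).
  have [s /andP[s0 st] [hs pos]] := first_zero t0 chN hN0 ht.
  exists (- s); split=> [|r /andP[sr r0]|]; first by rewrite oppr_lt0.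
    by rewrite -(opprK r) pos // oppr_ge0 r0 ltrNl.
  have ge0 r : - s < r <= 0 -> 0 < h r.
    by move=> /andP[sr r0]; rewrite -(opprK r) pos // oppr_ge0 r0 ltrNl.
  have [Z0'|Zn] := eqVneq (Z (- s)) 0; first by right.
  left; have H r : - s <= r <= 0 -> [/\ 0 <= G r, 0 < Z r, 0 <= (1 : R),
     is_derive r 1 G (1 * Fg k (G r) (Z r)) & is_derive r 1 Z (1 * Fz k (G r) (Z r))].
    move=> /andP[]; rewrite le_eqVlt => /orP[/eqP <- _|sr r0].
      have hs' : 0 <= h (- s) by rewrite hs.
      have [? ? _ _] := h_ge0 hs'; have [? ?] := unclamped hs'.
      by split=> //; rewrite lt_neqAle eq_sym Zn.
    have hr := ge0 r (introT andP (conj sr r0)); have [? ?] := unclamped (ltW hr).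
    by move: hr; rewrite h_gt0 => /and4P[? ? _ _]; split=> //; exact: ltW.
  have sN0 : - s <= 0 by rewrite oppr_le0 ltW.
  have [gs zs] := @in_box R k k0 G Z (fun _ => 1) (- s) (or_intror (conj sN0 H)) G0 Z0.
  have [g1 z1 _ _ _] := H (- s) (introT andP (conj (lexx _) sN0)).
  apply/eqP; apply: contraTT (lexx (h (- s))) => gn; rewrite -ltNge {1}hs h_gt0 z1 gs zs.
  by rewrite lt_neqAle eq_sym gn g1.
have pos t : - 1 <= t <= 0 -> 0 < h t.
  move=> /andP[t1]; rewrite le_eqVlt => /orP[/eqP ->|t0]; first exact: h0_gt0.
  rewrite ltNge; apply/negP => ht; apply: noexit; exists (- t); last by rewrite opprK.
  by rewrite oppr_gt0 t0 lerNl.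
have H t : - 1 <= t <= 0 -> [/\ 0 <= G t, 0 < Z t, 0 <= (1 : R),
     is_derive t 1 G (1 * Fg k (G t) (Z t)) & is_derive t 1 Z (1 * Fz k (G t) (Z t))].
  move=> /pos ht; have [? ?] := unclamped (ltW ht).
  by move: ht; rewrite h_gt0 => /and4P[? ? _ _]; split=> //; exact: ltW.
(* Backwards Z >= 1 and G <= 1, hence G' >= 2 Z^3 >= 2; one unit of time would bring G from 1 below
   0. *)
have : G (- 1) - 2 * (- 1) <= G 0 - 2 * 0.
  apply: (@der_ge0 _ (fun s => G s - 2 * s) (fun s => Fg k (G s) (Z s) - 2)) => // [s hs|s hs].
  - have [_ _ _ dg _] := H s hs.
    by apply: (der_eq (derB dg (derZ 2 (derI s)))); ring.
  - have /andP[s1 s0] := hs.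
    have Hs r : s <= r <= 0 -> [/\ 0 <= G r, 0 < Z r, 0 <= (1 : R),
        is_derive r 1 G (1 * Fg k (G r) (Z r)) & is_derive r 1 Z (1 * Fz k (G r) (Z r))].
      by move=> /andP[sr r0]; apply: H; rewrite r0 (le_trans s1).
    have [z1 gz] := @backward_bounds R k k0 G Z (fun _ => 1) s s0 G0 Z0 Hs.
    have [g0 z0 _ _ _] := H s hs.
    rewrite /Fg subr_ge0.
    have g2 : G s ^+ 2 <= 1 by have := sqr_ge0 (Z s ^+ 2 - 1); lra.
    have z4 : 1 <= Z s ^+ 4 by rewrite exprn_ege1.
    have z3 : 1 <= Z s ^+ 3 by rewrite exprn_ege1.
    have : 0 <= k * G s * Z s ^+ 2 * (Z s ^+ 4 - G s ^+ 2).
      by rewrite !mulr_ge0 ?exprn_ge0 ?subr_ge0 ?(le_trans g2) // ltW.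
    have -> : k * G s * Z s ^+ 2 * (Z s ^+ 4 - G s ^+ 2) =
      k * G s * Z s ^+ 6 - k * G s ^+ 3 * Z s ^+ 2 by ring.
    lra.
have [g1 _ _ _ _] := H (- 1) (introT andP (conj (lexx _) (lerN10 R))).
rewrite G0; lra.
Qed.

End Exit.

Lemma near_oo (R : realType) (a b t : R) : a < t < b -> \forall s \near t, a < s < b.
Proof.
move=> tab; have /near_in_itvoo : t \in `]a, b[%R by rewrite in_itv.
by apply: filterS => s /=; rewrite in_itv.
Qed.

(** * Return to the original time, and uniqueness for the (y, z) system *)

Section OdeSolution.
Variables (R : realType) (k : R).
Hypothesis k0 : 0 < k.

Definition is_solution (a b : R) (y z : R -> R) := y 0 = 1 /\ z 0 = 1 /\
  forall t : R, a < t < b -> [/\ 0 < y t, 0 < z t,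
    is_derive t 1 y ((k * y t * z t ^+ 6 + 2 * z t ^+ 2 + y t ^+ 2) / (12 * y t ^+ 3 * z t ^+ 8)) &
    is_derive t 1 z (- (k * y t * z t ^+ 4 + 1) / (12 * y t ^+ 2 * z t ^+ 7))].

Lemma solution_time_change a b y z : is_solution a b y z ->
  forall t : R, a < t < b ->
  let g s := y s * z s in let m := (12 * g t ^+ 3 * z t ^+ 5)^-1 in
  [/\ 0 < g t, 0 < z t, 0 < m, is_derive t 1 g (m * Fg k (g t) (z t)) &
      is_derive t 1 z (m * Fz k (g t) (z t))].
Proof.
move=> [_ [_ H]] t /H[y0 z0 dy dz] g m.
have yn : y t != 0 by rewrite gt_eqF.
have zn : z t != 0 by rewrite gt_eqF.
have gp : 0 < g t by rewrite mulr_gt0.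
split=> //.
- by rewrite invr_gt0 !mulr_gt0 // exprn_gt0.
- apply: (der_eq (derM dy dz)); rewrite /m /g /Fg; field.
  by rewrite yn zn.
- by apply: (der_eq dz); rewrite /m /g /Fz; field; rewrite yn zn.
Qed.

Lemma clamp_cont (a b : R) (f : R -> R) : a <= b ->
  (forall t, a <= t <= b -> {for t, continuous f}) ->
  continuous (fun t => f (Num.max a (Num.min b t))).
Proof.
move=> ab cf t.
have cm : continuous (fun s : R => Num.max a (Num.min b s)).
  move=> s; apply: (@continuous_max R R (fun _ => a) (fun s => Num.min b s) s); first exact: cvg_cst.
  by apply: (@continuous_min R R (fun _ => b) (fun s => s) s); [exact: cvg_cst|exact: cvg_id].
apply: (@continuous_comp _ _ _ (fun s : R => Num.max a (Num.min b s)) f); first exact: cm.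
by apply: cf; rewrite le_max lexx /= ge_max ab ge_min lexx.
Qed.

Theorem ode_solution : exists tm tp y z, [/\ tm < 0 < tp, is_solution tm tp y z &
  forall a b y' z', a < 0 < b -> is_solution a b y' z' -> forall t, a < t < b ->
    tm < t < tp /\ y' t = y t /\ z' t = z t].
Proof.
have [L [G [Z [L0 FgL FzL [G0 [Z0 dGZ]]]]]] := clamped_solution k.
have cG := contG dGZ; have cZ := contZ dGZ.
have [tup [tup0 posR zeroR]] := forward_exit k0 G0 Z0 dGZ.
have [tum [tum0 posL zeroL]] := backward_exit k0 G0 Z0 dGZ.
have pos s : tum < s < tup -> [/\ 0 < G s, 0 < Z s,
    is_derive s 1 G (Fg k (G s) (Z s)) & is_derive s 1 Z (Fz k (G s) (Z s))].
  move=> /andP[ms sp].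
  have hs : 0 < ((G \min Z) \min ((fun s => 2 - G s) \min (fun s => 2 - Z s))) s.
    by have [s0|s0] := leP 0 s; [apply: posR; rewrite s0|apply: posL; rewrite ms ltW].
  have [] := unclamped dGZ (ltW hs); rewrite !mul1r.
  by move: hs; rewrite h_gt0 => /and4P[].
have cD : continuous (fun s => 12 * G s ^+ 3 * Z s ^+ 5).
  by move=> s; exact: (der_cont (derM (derZ 12 (derX 2 (dGZ s).1)) (derX 4 (dGZ s).2))).
(* [T] is the original time as a function of tau. Being defined on the whole line, it is finite at
   both exit times, which gives the bounded interval. *)
have [T [T0 dT]] := primitive cD.
have Dpos s : tum < s < tup -> 0 < 12 * G s ^+ 3 * Z s ^+ 5.
  by move=> /pos[gs zs _ _]; rewrite !mulr_gt0 // exprn_gt0.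
have Dge0 s : tum <= s <= tup -> 0 <= 12 * G s ^+ 3 * Z s ^+ 5.
  move=> /andP[]; rewrite le_eqVlt => /orP[/eqP <- _|ms].
    by case: zeroL => ->; rewrite expr0n ?mulr0 ?mul0r.
  rewrite le_eqVlt => /orP[/eqP ->|sp]; last by apply/ltW/Dpos; rewrite ms.
  by case: zeroR => ->; rewrite expr0n ?mulr0 ?mul0r.
have Tle x y : tum <= x -> x <= y -> y <= tup -> T x <= T y.
  move=> mx xy yp; apply: (@der_ge0 _ T (fun s => 12 * G s ^+ 3 * Z s ^+ 5)) => // s /andP[xs sy].
  by apply: Dge0; rewrite (le_trans mx xs) (le_trans sy yp).
have Tlt x y : tum <= x -> x < y -> y <= tup -> T x < T y.
  (* The speed may vanish at the exit times; strict growth is taken from the middle third, which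
     avoids them. *)
  move=> mx xy yp; pose c := x + (y - x) / 3; pose d := x + 2 * (y - x) / 3.
  have xc : x < c by rewrite /c; lra.
  have cd : c < d by rewrite /c /d; lra.
  have dy : d < y by rewrite /d; lra.
  apply: le_lt_trans (Tle x c mx (ltW xc) _) _; first by apply: le_trans yp; lra.
  apply: (@lt_le_trans _ _ (T d)); last by apply: Tle => //; lra.
  apply: (@der_gt0 _ T (fun s => 12 * G s ^+ 3 * Z s ^+ 5)) => // s /andP[cs sd].
  by apply: Dpos; apply/andP; split; lra.
have cT : continuous T by move=> s; exact: der_cont (dT s).
have Tsurj t : T tum < t < T tup -> exists2 s, tum < s < tup & T s = t.
  move=> /andP[mt tp].
  have mp : tum <= tup by lra.
  have mm : Num.min (T tum) (T tup) <= t <= Num.max (T tum) (T tup).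
    by rewrite ge_min le_max (ltW mt) (ltW tp) orbT.
  have [|c] := @IVT R T tum tup t mp _ mm; first exact: continuous_subspaceT.
  rewrite in_itv /= => /andP[mc cp] Tc; exists c => //.
  rewrite !lt_neqAle mc cp !andbT; apply/andP; split.
    by apply: contraTneq mt => ->; rewrite Tc ltxx.
  by apply: contraTneq tp => <-; rewrite Tc ltxx.
have Tinj x y : tum <= x <= tup -> tum <= y <= tup -> T x = T y -> x = y.
  move=> /andP[mx xp] /andP[my yp] E; case: (ltgtP x y) => // xy.
    by have := Tlt x y mx xy yp; rewrite E ltxx.
  by have := Tlt y x my xy xp; rewrite E ltxx.
have /choice[sg hsg] : forall t, exists s, T tum < t < T tup -> tum < s < tup /\ T s = t.
  move=> t; have [tI|] := boolP (T tum < t < T tup); last by exists 0.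
  by have [s h1 h2] := Tsurj t tI; exists s.
have sgT s : tum < s < tup -> sg (T s) = s.
  move=> /andP[ms sp]; have TI : T tum < T s < T tup.
    by rewrite (Tlt _ _ (lexx _) ms (ltW sp)) (Tlt _ _ (ltW ms) sp (lexx _)).
  have [/andP[m1 p1] E] := hsg _ TI.
  by apply: Tinj => //; rewrite !ltW.
have i0 : tum < 0 < tup by rewrite tum0.
have TI0 : T tum < 0 < T tup.
  by rewrite -T0 (Tlt _ _ (lexx _) tum0 (ltW tup0)) (Tlt _ _ (ltW tum0) tup0 (lexx _)).
have sg0 : sg 0 = 0 by rewrite -[X in sg X]T0 sgT.
exists (T tum), (T tup), (fun t => G (sg t) / Z (sg t)), (fun t => Z (sg t)); split => //.
  split; first by rewrite sg0 G0 Z0 divr1.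
  split; first by rewrite sg0.
  move=> t tI; have [sI Ts] := hsg t tI.
  have [gs zs dG dZ] := pos _ sI.
  have gn : G (sg t) != 0 by rewrite gt_eqF.
  have zn : Z (sg t) != 0 by rewrite gt_eqF.
  have dsg : is_derive t 1 sg (12 * G (sg t) ^+ 3 * Z (sg t) ^+ 5)^-1.
    rewrite -[X in is_derive X]Ts; apply: is_derive_inverse.
    - by move: (near_oo sI); apply: filterS => s; exact: sgT.
    - by move: (near_oo sI); apply: filterS => s _; exact: cT.
    - by rewrite gt_eqF // Dpos.
  split; [by rewrite divr_gt0|by []| |].
    apply: (der_eq (derM (der_comp dG dsg) (@derV _ _ (fun t => Z (sg t)) _ zn (der_comp dZ dsg)))).
    by rewrite /Fg /Fz; field; rewrite gn zn.
  by apply: (der_eq (der_comp dZ dsg)); rewrite /Fz; field; rewrite gn zn.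
move=> a b y z /andP[a0 b0] sol t /andP[at_ tb].
pose g s := y s * z s; pose m s := (12 * g s ^+ 3 * z s ^+ 5)^-1.
have H s : a < s < b -> [/\ 0 < g s, 0 < z s, 0 < m s,
   is_derive s 1 g (m s * Fg k (g s) (z s)) & is_derive s 1 z (m s * Fz k (g s) (z s))].
  by move=> sI; have := solution_time_change sol sI.
have [y1 [z1 _]] := sol.
have g1 : g 0 = 1 by rewrite /g y1 z1 mulr1.
have box s : a < s < b -> g s < 2 /\ z s < 2.
  move=> /andP[as_ sb]; apply: (@in_box R k k0 g z m s) => //.
  have Hw r : a < r < b -> [/\ 0 <= g r, 0 < z r, 0 <= m r,
     is_derive r 1 g (m r * Fg k (g r) (z r)) & is_derive r 1 z (m r * Fz k (g r) (z r))].
    by move=> /H[? ? ? ? ?]; split=> //; exact: ltW.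
  have [s0|s0] := leP 0 s.
    left; split=> // r /andP[r0 rs]; apply: Hw.
    by rewrite (lt_le_trans a0 r0) (le_lt_trans rs sb).
  right; split=> [|r /andP[r0 rs]]; first exact: ltW.
  by apply: Hw; rewrite (lt_le_trans as_ r0) (le_lt_trans rs b0).
(* A compact subinterval around 0 and t, on which the speed m is continuous up to the ends and so
   has a primitive [th], the time tau of the given solution. *)
pose a' := (a + Num.min 0 t) / 2; pose b' := (b + Num.max 0 t) / 2.
have [aa' [a'0 [a't [b'b [b'0 tb']]]]] : a < a' /\ a' < 0 /\ a' < t /\ b' < b /\ 0 < b' /\ t < b'.
  by rewrite /a' /b'; clear -a0 b0 at_ tb; case: (leP 0 t) => t0; do ?split; lra.
have inab s : a' <= s <= b' -> a < s < b.
  by move=> /andP[as_ sb]; rewrite (lt_le_trans aa' as_) (le_lt_trans sb b'b).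
have cm s : a' <= s <= b' -> {for s, continuous m}.
  move=> /inab sI; have [gs zs ms dg dz] := H s sI.
  have n0 : 12 * g s ^+ 3 * z s ^+ 5 != 0.
    by rewrite gt_eqF //; apply: mulr_gt0; [apply: mulr_gt0 => //|]; exact: exprn_gt0.
  exact: (der_cont (@derV _ _ (fun s => 12 * g s ^+ 3 * z s ^+ 5) _ n0
     (derM (derZ 12 (derX 2 dg)) (derX 4 dz)))).
have a'b' := ltW (lt_trans a'0 b'0).
have [th [th0 dth']] := primitive (clamp_cont a'b' cm).
have dth s : a' < s < b' -> is_derive s 1 th (m s).
  move=> /andP[as_ sb]; have := dth' s.
  by rewrite (min_idPr (ltW sb)) (max_idPr (ltW as_)).
(* In the time tau both curves solve the same clamped system from the same point, so Gronwall's
   inequality identifies them. *)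
pose E s := (g s - G (th s)) ^+ 2 + (z s - Z (th s)) ^+ 2.
pose dg' s := m s * (Fgc k (g s) (z s) - Fgc k (G (th s)) (Z (th s))).
pose dz' s := m s * (Fzc k (g s) (z s) - Fzc k (G (th s)) (Z (th s))).
have E0 s : a' < s < b' -> E s = 0.
  apply: (@gronwall R E (fun s => 2 * (g s - G (th s)) * dg' s + 2 * (z s - Z (th s)) * dz' s)
     (fun s => 4 * L * m s) a' b').
  - by rewrite a'0.
  - move=> r rI; have rI' : a < r < b by apply: inab; case/andP: rI => *; rewrite !ltW.
    have [gr zr mr dg dz] := H r rI'; have [g2 z2] := box r rI'.
    have dGt := der_comp (dGZ (th r)).1 (dth r rI); have dZt := der_comp (dGZ (th r)).2 (dth r rI).
    apply: (der_eq (derD (derX 1 (derB dg dGt)) (derX 1 (derB dz dZt)))).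
    have -> : Fg k (g r) (z r) = Fgc k (g r) (z r) by rewrite /Fgc !clamp_id // !ltW.
    have -> : Fz k (g r) (z r) = Fzc k (g r) (z r) by rewrite /Fzc !clamp_id // !ltW.
    by rewrite /dg' /dz'; ring.
  - by move=> r _; rewrite addr_ge0 // sqr_ge0.
  - move=> r /andP[ar rb]; have := cm r; rewrite !ltW // => /(_ isT) cmr.
    by apply: continuousM => //; exact: cvg_cst.
  - move=> r /andP[ar rb]; have [] := H r; first by apply: inab; rewrite !ltW.
    move=> _ _ mr _ _.
    have l1 := FgL (g r) (z r) (G (th r)) (Z (th r)).
    have l2 := FzL (g r) (z r) (G (th r)) (Z (th r)).
    rewrite /dg' /dz' /E; set p := g r - _ in l1 l2 *; set q := z r - _ in l1 l2 *.
    set u := Fgc _ _ _ - _ in l1 *; set v := Fzc _ _ _ - _ in l2 *.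
    have -> : 2 * p * (m r * u) + 2 * q * (m r * v) = m r * (2 * (p * u + q * v)) by ring.
    rewrite normrM (gtr0_norm mr).
    have -> : 4 * L * m r * (p ^+ 2 + q ^+ 2) = m r * (4 * L * (p ^+ 2 + q ^+ 2)) by ring.
    apply: ler_wpM2l; first exact: ltW.
    (* The rate 4 L comes from 2 L (|p| + |q|)^2 <= 4 L (p^2 + q^2). *)
    rewrite normrM gtr0_norm // -[p ^+ 2]real_normK ?num_real // -[q ^+ 2]real_normK ?num_real //.
    have e1 : `|p * u + q * v| <= `|p| * `|u| + `|q| * `|v| by rewrite -!normrM ler_normD.
    have P0 := normr_ge0 p; have Q0 := normr_ge0 q.
    have e2 : `|p| * `|u| <= `|p| * (L * (`|p| + `|q|)) by apply: ler_wpM2l.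
    have e3 : `|q| * `|v| <= `|q| * (L * (`|p| + `|q|)) by apply: ler_wpM2l.
    have e4 : 0 <= L * (`|p| - `|q|) ^+ 2 by apply: mulr_ge0 => //; exact: sqr_ge0.
    clear -e1 e2 e3 e4 L0 P0 Q0; nra.
  - by rewrite /E th0 G0 Z0 g1 z1 subrr expr0n addr0.
have gz s : a' < s < b' -> g s = G (th s) /\ z s = Z (th s).
  move=> /E0 /eqP; rewrite /E paddr_eq0 ?sqr_ge0 // !sqrf_eq0 !subr_eq0.
  by move=> /andP[/eqP -> /eqP ->].
have Tth s : a' < s < b' -> T (th s) = s.
  move=> sI; pose d s := T (th s) - s.
  suff : d s = d 0 by rewrite /d th0 T0 subrr => /eqP; rewrite subr_eq0 => /eqP.
  apply: (@der_const R d a' b' s sI) => [|r rI]; first by rewrite a'0.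
  have [gr zr] := gz r rI.
  have rI' : a < r < b by apply: inab; case/andP: rI => *; rewrite !ltW.
  have [gp zp _ _ _] := H r rI'.
  apply: (der_eq (derB (der_comp (dT _) (dth r rI)) (derI r))).
  rewrite /m -gr -zr; move: gp zp; set gg := g r; set zz := z r => gp zp.
  by field; rewrite !gt_eqF.
have a0b : a' < 0 < b' by rewrite a'0.
have ctht s : a' < s < b' -> {for s, continuous th} by move=> /dth; exact: der_cont.
have notz s : a' < s < b' -> G (th s) != 0 /\ Z (th s) != 0.
  move=> sI; have [<- <-] := gz s sI; have [] := H s; last by move=> ? ? _ _ _; rewrite !gt_eqF.
  by apply: inab; case/andP: sI => *; rewrite !ltW.
(* [th] cannot reach an exit time: G or Z vanishes there, while g and z are positive. *)
have thI s : a' < s < b' -> tum < th s < tup.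
  move=> sI; rewrite -subr_gt0 -[th s < _]subr_gt0; apply/andP; split.
    apply: (@nonzero_pos R (fun s => th s - tum) a' b' a0b) => // [r rI|r rI|].
    - by apply: continuousB; [exact: ctht|exact: cvg_cst].
    - rewrite subr_eq0; apply/eqP => E'; have [] := notz r rI; rewrite E'.
      by case: zeroL => ->; rewrite eqxx.
    - by rewrite th0 sub0r oppr_gt0.
  apply: (@nonzero_pos R (fun s => tup - th s) a' b' a0b) => // [r rI|r rI|].
  - by apply: continuousB; [exact: cvg_cst|exact: ctht].
  - rewrite subr_eq0 eq_sym; apply/eqP => E'; have [] := notz r rI; rewrite E'.
    by case: zeroR => ->; rewrite eqxx.
  - by rewrite th0 subr0.
have tI : a' < t < b' by rewrite a't.
have [/andP[mth thp] Tt] := (thI t tI, Tth t tI).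
have [gt zt] := gz t tI.
split; first by rewrite -Tt (Tlt _ _ (lexx _) mth (ltW thp)) (Tlt _ _ (ltW mth) thp (lexx _)).
rewrite -[X in sg X]Tt sgT ?mth // -gt -zt /g; split=> //.
have [_ zp _ _ _] : [/\ 0 < g t, 0 < z t, 0 < m t, is_derive t 1 g (m t * Fg k (g t) (z t)) &
   is_derive t 1 z (m t * Fz k (g t) (z t))] by apply: H; rewrite at_.
by rewrite mulfK // gt_eqF.
Qed.

End OdeSolution.

(** * Uniqueness of the flow *)

Section Functionals.
Variable R : realType.
Implicit Types (a : lform R).

(* On [psi = w^2 / 2 - rho0 /\ x^7 / c], with [w = hermD ...], the functionals [fX], ..., [fN] read off
   the entries of [w^2 / 2] and [g0], ..., [g5] the components of [x^7] along e^1, ..., e^6. *)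
Definition fX a : R := a (setw [:: 2; 3; 4; 5]%N).
Definition fY a : R := a (setw [:: 0; 1; 4; 5]%N).
Definition fZ a : R := a (setw [:: 0; 1; 2; 3]%N).
Definition fP a : R := (a (setw [:: 0; 2; 4; 5]%N) - a (setw [:: 1; 3; 4; 5]%N)) / 2.
Definition fQ a : R := (a (setw [:: 0; 3; 4; 5]%N) + a (setw [:: 1; 2; 4; 5]%N)) / 2.
Definition fR a : R := (a (setw [:: 0; 2; 3; 4]%N) - a (setw [:: 1; 2; 3; 5]%N)) / 2.
Definition fM a : R := (a (setw [:: 0; 2; 3; 5]%N) + a (setw [:: 1; 2; 3; 4]%N)) / 2.
Definition fT a : R := (a (setw [:: 0; 1; 2; 4]%N) + a (setw [:: 0; 1; 3; 5]%N)) / 2.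
Definition fN a : R := (a (setw [:: 0; 1; 2; 5]%N) - a (setw [:: 0; 1; 3; 4]%N)) / 2.
Definition g0 a : R := a (setw [:: 0; 1; 3; 5]%N) - a (setw [:: 0; 1; 2; 4]%N).
Definition g1 a : R := a (setw [:: 0; 1; 2; 5]%N) + a (setw [:: 0; 1; 3; 4]%N).
Definition g2 a : R := a (setw [:: 0; 2; 3; 4]%N) + a (setw [:: 1; 2; 3; 5]%N).
Definition g3 a : R := a (setw [:: 0; 2; 3; 5]%N) - a (setw [:: 1; 2; 3; 4]%N).
Definition g4 a : R := a (setw [:: 0; 2; 4; 5]%N) + a (setw [:: 1; 3; 4; 5]%N).
Definition g5 a : R := a (setw [:: 0; 3; 4; 5]%N) - a (setw [:: 1; 2; 4; 5]%N).

Lemma functionals_struct (x y z p q r m t n a0 a1 a2 a3 a4 a5 c : R) : c != 0 ->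
  let a := sfval (psi_struct x y z p q r m t n a0 a1 a2 a3 a4 a5 c) in
  [/\ fX a = y * z - t ^+ 2 - n ^+ 2, fY a = x * z + m ^+ 2 + r ^+ 2,
      fZ a = x * y + q ^+ 2 + p ^+ 2 &
  [/\ fP a = p * z + t * m - n * r, fQ a = q * z - n * m - r * t,
      fR a = r * y - n * p - q * t, fM a = m * y + t * p - n * q &
  [/\ fT a = t * x - m * p + q * r, fN a = n * x + m * q + p * r,
      g0 a = 2 * c^-1 * a0, g1 a = - 2 * c^-1 * a1 &
  [/\ g2 a = - 2 * c^-1 * a2, g3 a = 2 * c^-1 * a3, g4 a = 2 * c^-1 * a4 &
      g5 a = - 2 * c^-1 * a5 ]]]].
Proof.
move=> c0 a; rewrite /a -form_norms /fX /fY /fZ /fP /fQ /fR /fM /fT /fN /g0 /g1 /g2 /g3 /g4 /g5.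
have so : sorteds (norms (psi_struct x y z p q r m t n a0 a1 a2 a3 a4 a5 c)).
  by cbv [psi_struct hermD rho0_s row7]; sform_cbv.
rewrite !form_coefs //; cbv [psi_struct hermD rho0_s row7]; sform_cbv.
by split; [field|field|field|split; [field|field|field|field|split; [field|field|field|field|split; field]]].
Qed.

Definition rhs_s (ka mu x y z p q r m t n : R) : sform R :=
  cats (scales ka (muls (omega_s R) (hermD x y z p q r m t n)))
       (scales (- mu) (muls (omega_s R) (omega_s R))).

Lemma functionals_rhs (ka mu x y z p q r m t n : R) :
  let a := sfval (rhs_s ka mu x y z p q r m t n) in
  [/\ fX a = ka * (y + z) - 2 * mu, fY a = ka * (x + z) - 2 * mu,
      fZ a = ka * (x + y) - 2 * mu &
  [/\ fP a = ka * p, fQ a = ka * q, fR a = ka * r, fM a = ka * m &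
  [/\ fT a = ka * t, fN a = ka * n, g0 a = 0, g1 a = 0 &
  [/\ g2 a = 0, g3 a = 0, g4 a = 0 & g5 a = 0 ]]]].
Proof.
move=> a; rewrite /a -form_norms /fX /fY /fZ /fP /fQ /fR /fM /fT /fN /g0 /g1 /g2 /g3 /g4 /g5.
have so : sorteds (norms (rhs_s ka mu x y z p q r m t n)).
  by cbv [rhs_s hermD omega_s]; sform_cbv.
rewrite !form_coefs //; cbv [rhs_s hermD omega_s]; sform_cbv.
by split; [field|field|field|split; [field|field|field|field|split; [field|field|field|field|split; field]]].
Qed.

Lemma functionals_init :
  let a := sfval (psi_yz_s 1 1) : lform R in
  [/\ fX a = 1, fY a = - 1, fZ a = - 1 &
  [/\ fP a = 0, fQ a = 0, fR a = 0, fM a = 0 &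
  [/\ fT a = 0, fN a = 0, g0 a = 0, g1 a = 0 &
  [/\ g2 a = 0, g3 a = 0, g4 a = 0 & g5 a = 0 ]]]].
Proof.
move=> a; rewrite /a -form_norms /fX /fY /fZ /fP /fQ /fR /fM /fT /fN /g0 /g1 /g2 /g3 /g4 /g5.
have so : sorteds (norms (psi_yz_s (1 : R) 1)) by cbv [psi_yz_s]; sform_cbv.
rewrite !form_coefs //; cbv [psi_yz_s]; sform_cbv.
by split; [field|field|field|split; [field|field|field|field|split; [field|field|field|field|split; field]]].
Qed.

Lemma psi_struct_diag (x y z c Y Z : R) : c != 0 -> x = Y ^+ 2 -> y = - Z ^+ 2 -> z = - Z ^+ 2 ->
  sfval (psi_struct x y z 0 0 0 0 0 0 0 0 0 0 0 0 c) = sfval (psi_yz_s Y Z).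
Proof.
move=> c0 -> -> ->; apply: form_eq; cbv [psi_struct hermD rho0_s row7 psi_yz_s].
by sform_cbv; do ?split; field.
Qed.

(** For 3 x 3 Hermitian matrices, adj(adj W) = det(W) W and det(adj W) = det(W)^2, here up to the
    signs of the reversed plane. The capitals are the entries of w^2 / 2, so w is recovered from psi
    once its Pfaffian is known. *)
Lemma pf_adjugate (x y z p q r m t n : R) :
  let X := y * z - t ^+ 2 - n ^+ 2 in let Y := x * z + m ^+ 2 + r ^+ 2 in
  let Z := x * y + q ^+ 2 + p ^+ 2 in let P := p * z + t * m - n * r in
  let Q := q * z - n * m - r * t in let S := r * y - n * p - q * t in
  let M := m * y + t * p - n * q in let T := t * x - m * p + q * r in
  let N := n * x + m * q + p * r in let D := pf x y z p q r m t n in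
  [/\ D * p = Z * P - T * M + N * S, D * q = Z * Q + N * M + S * T,
      D * r = Y * S + N * P + T * Q & [/\ D * m = Y * M - T * P + N * Q,
      D * t = X * T + M * P - S * Q, D * n = X * N - M * Q - P * S &
      D ^+ 2 = X * Y * Z - X * (T ^+ 2 + N ^+ 2) + Y * (M ^+ 2 + S ^+ 2) + Z * (P ^+ 2 + Q ^+ 2)
        + 2 * (- (P * T * M) + P * N * S + Q * N * M + Q * S * T)]].
Proof. by rewrite /pf; split; [ring|ring|ring|split; ring]. Qed.

Lemma cont_sum (I : Type) (l : seq I) (Q : pred I) (f : I -> R -> R) (t : R) :
  (forall i, {for t, continuous (f i)}) -> {for t, continuous (fun s => \sum_(i <- l | Q i) f i s)}.
Proof.
move=> hf; elim: l => [|x l IH].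
  have -> : (fun s => \sum_(i <- [::] | Q i) f i s) = (fun _ : R => 0 : R).
    by apply: funext => s; rewrite big_nil.
  exact: cvg_cst.
have -> : (fun s => \sum_(i <- x :: l | Q i) f i s) =
  (fun s => (if Q x then f x s else 0) + \sum_(i <- l | Q i) f i s).
  by apply: funext => s; rewrite big_cons; case: (Q x); rewrite ?add0r.
by apply: continuousD => //; case: (Q x); [exact: hf|exact: cvg_cst].
Qed.

Definition contf (F : R -> lform R) (t : R) := forall I : {set 'I_7}, {for t, continuous (fun s => F s I)}.

Lemma contf_cst a t : contf (fun _ => a) t.
Proof. by move=> I; exact: cvg_cst. Qed.

Lemma contf_wedge F G t : contf F t -> contf G t -> contf (fun s => wedge (F s) (G s)) t.
Proof.
Transparent wedge.
move=> hF hG K; rewrite /wedge; apply: cont_sum => I.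
by apply: continuousM; [apply: continuousM; [exact: cvg_cst|exact: hF]|exact: hG].
Qed.
Opaque wedge.

Lemma contf_hook u F t : contf F t -> contf (fun s => hook u (F s)) t.
Proof.
Transparent hook.
move=> hF K; rewrite /hook; apply: cont_sum => I.
by apply: continuousM; [exact: cvg_cst|exact: hF].
Qed.
Opaque hook.

Lemma cont_volume3 F t : contf F t -> {for t, continuous (fun s => volume3 (F s))}.
Proof.
move=> hF; have h := @contf_hook (unitvec R i7) F t hF.
have h4 := contf_wedge (contf_wedge (contf_wedge h h) h) (@contf_cst (dx R i7) t).
by rewrite /volume3; exact: (h4 [set: 'I_7]%SET).
Qed.

(* The volume coefficient vanishes nowhere, so its sign is constant along a continuous path:
   this is what excludes [- phi], which has the same [psi]. *)
Lemma volume3_neq0 (phi : lform R) : G2form phi -> volume3 phi != 0.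
Proof.
move=> /frame_exists[P [aP P7 c0]].
pose w := expr P (sfval (omega_s R)).
have w2 : homog 2 w by apply: homog_expr; exact: homog_omega_s.
have w7 : hook (unitvec R i7) w = 0 := hook7_expr_omega P7.
have [b01 [b02 [b03 [b04 [b05 [b12 [b13 [b14 [b15 [b23 [b24 [b25 [b34 [b35 [b45 E]]]]]]]]]]]]]]] :=
  two_form w2 w7.
set G := gen2 _ _ _ _ _ _ _ _ _ _ _ _ _ _ _ in E.
(* w^3 already uses e^1, ..., e^6, so only the e^7-component of the last covector counts. *)
have cube (a0 a1 a2 a3 a4 a5 c : R) :
  wedge (wedge (wedge w w) w) (sfval (row7 a0 a1 a2 a3 a4 a5 c)) [set: 'I_7]%SET =
  c * wedge (wedge (wedge w w) w) (dx R i7) [set: 'I_7]%SET.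
  rewrite E dx7E -form_muls -(form_norms (muls _ _)) -form_muls -(form_norms (muls _ _)) -!form_muls.
  rewrite -(form_norms (muls _ (row7 a0 a1 a2 a3 a4 a5 c))) -(form_norms (muls _ (row7 0 0 0 0 0 0 1))).
  rewrite !form_top; [|by rewrite /G; cbv [gen2 row7]; sform_cbv..].
  by rewrite /G; cbv [gen2 row7]; sform_cbv; ring.
have v : volf P * 6 = P i7 i7 * wedge (wedge (wedge w w) w) (dx R i7) [set: 'I_7]%SET.
  by rewrite -omega_cube -top_expr !expr_wedge expr_dx -/w row7E cube.
have cn : P i7 i7 != 0 by rewrite gt_eqF.
rewrite /volume3 (hook7_phi aP P7) -/w !(wedgeZl, wedgeZr) !scalerA lform_scaleE.
rewrite mulf_neq0 ?mulf_neq0 //.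
apply: contraTneq (volf_neq0 (adapted_unit aP)) => w0.
move: v; rewrite w0 mulr0 => /eqP; rewrite mulf_eq0 pnatr_eq0 orbF => /eqP ->.
by rewrite eqxx.
Qed.

Lemma volume3_phi2 : volume3 (phi2 R) = 6.
Proof.
rewrite phi2E phi_yzE /volume3 form_hooks; [|by []|by cbv [phi_yz_s]; sform_cbv].
rewrite dx7E -!form_muls -form_norms form_top; last by cbv [phi_yz_s row7]; sform_cbv.
by cbv [phi_yz_s row7]; sform_cbv; field.
Qed.

(* [d] produces no [e^7]-components. *)
Lemma flow_rhs_hook7 (phi : lform R) (A : R) : G2form phi -> dform (hodge phi phi) = 0 ->
  forall I : {set 'I_7}, i7 \in I ->
  fadd (lap phi 4 (hodge phi phi)) (fscale 2 (dform (fscale (A - trace_torsion phi) phi))) I = 0.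
Proof.
move=> /frame_exists[P [aP P7 c0]]; rewrite (hodge_phi aP) => cocl I I7.
rewrite (coclosed_flow_rhs A aP P7 c0 cocl).
pose w := expr P (sfval (omega_s R)).
have w2 : homog 2 w by apply: homog_expr; exact: homog_omega_s.
have w7 : hook (unitvec R i7) w = 0 := hook7_expr_omega P7.
have := two_form_words w2 w7; rewrite -/w => ->; rewrite omega_hE -!form_muls -scaleNr -!form_scales -form_cats.
apply: hook7_eq0 I7; rewrite form_hooks; [|by []|by cbv [words2 map omega_s]; sform_cbv].
by rewrite -(sfval_nil R); apply: form_eq; cbv [words2 map omega_s]; sform_cbv.
Qed.

Lemma flow_rhs_frame (phi : lform R) P (A : R) x y z p q r m t n : adapted phi P ->
  (forall i, i != i7 -> P i i7 = 0) -> 0 < P i7 i7 -> dform (hodge phi phi) = 0 ->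
  expr P (sfval (omega_s R)) = sfval (hermD x y z p q r m t n) ->
  fadd (lap phi 4 (hodge phi phi)) (fscale 2 (dform (fscale (A - trace_torsion phi) phi))) =
  sfval (rhs_s (2 * A * P i7 i7 * (Num.sqrt 6 / 6)) (P i7 i7 ^+ 2 / 6) x y z p q r m t n).
Proof.
move=> aP P7 c0; rewrite (hodge_phi aP) => cocl wE.
rewrite (coclosed_flow_rhs A aP P7 c0 cocl) wE /rhs_s form_cats !form_scales !form_muls omega_hE scaleNr.
suff -> : P i7 i7 ^+ 2 * (Num.sqrt 6 / 6) ^+ 2 = P i7 i7 ^+ 2 / 6 by [].
by rewrite expr_div_n sqr_sqrtr ?ler0n //; field.
Qed.

End Functionals.

(** * Reduction of an arbitrary solution to the (y, z) system *)

Section Uniqueness.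
Variables (R : realType) (A a b : R) (phi psi : R -> lform R).
Hypothesis A0 : 0 < A.
Hypothesis phi_init : phi 0 = phi2 R.
Hypothesis phi_cont : forall t, a < t < b -> forall I : {set 'I_7},
  (fun s : R => phi s I) @ t --> phi t I.
Hypothesis sol : coflow_solution A a b phi psi.

Let rhs t := fadd (lap (phi t) 4 (psi t))
  (fscale 2 (dform (fscale (A - trace_torsion (phi t)) (phi t)))).

Let I0 : a < 0 < b. Proof. by case: sol. Qed.
Let G2t t : a < t < b -> G2form (phi t). Proof. by case: sol => _ [_ H] /H[]. Qed.
Let psiE t : a < t < b -> psi t = hodge (phi t) (phi t). Proof. by case: sol => _ [_ H] /H[_ []]. Qed.
Let cocl t : a < t < b -> dform (psi t) = 0. Proof. by case: sol => _ [_ H] /H[_ [_ []]]. Qed.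
Let dpsi t : a < t < b -> forall I : {set 'I_7}, is_derive t 1 (fun s => psi s I) (rhs t I).
Proof. by case: sol => _ [_ H] /H[_ [_ [_ h]]]. Qed.

Let psi_init : psi 0 = sfval (psi_yz_s 1 1).
Proof. by case: sol => _ [-> _]; rewrite phi2E hodge_phi_yz ?oner_neq0. Qed.

Lemma hook7_psi_const t : a < t < b -> hook (unitvec R i7) (psi t) = sfval (rho0_s R).
Proof.
move=> tI; rewrite -(hook7_psi_yz 1 1) -psi_init; apply: funext => K.
rewrite !hook_unitvec; case: ifP => // K7; congr (_ * _).
apply: (@der_const R (fun s => psi s (i7 |: K)) a b t tI I0) => s sI.
apply: (der_eq (dpsi sI _)); rewrite /rhs psiE //.
by apply: flow_rhs_hook7; rewrite -?psiE ?cocl ?inE ?eqxx //; exact: G2t.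
Qed.

Lemma volume3_pos t : a < t < b -> 0 < volume3 (phi t).
Proof.
move: t; apply: (nonzero_pos I0) => [t tI|t tI|].
- by apply: cont_volume3 => I; exact: phi_cont.
- exact/volume3_neq0/G2t.
- by rewrite phi_init volume3_phi2.
Qed.

Let s6 : R := Num.sqrt 6 / 6.

(** The frame may still be sheared: x^7 has components a0, ..., a5 along e^1, ..., e^6, which
    [shift_zero] later removes. *)
Lemma coflow_frame_shifted t : a < t < b -> exists P x y z p q r m u n a0 a1 a2 a3 a4 a5 c,
  [/\ adapted (phi t) P, P i7 i7 = c, 0 < c, 0 < pf x y z p q r m u n &
  [/\ hook (unitvec R i7) (phi t) = c *: sfval (hermD x y z p q r m u n),
      volume3 (phi t) = 6 * c ^+ 3 * pf x y z p q r m u n,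
      volf P = c * pf x y z p q r m u n,
      psi t = sfval (psi_struct x y z p q r m u n a0 a1 a2 a3 a4 a5 c) &
      rhs t = sfval (rhs_s (2 * A * c * s6) (c ^+ 2 / 6) x y z p q r m u n)]].
Proof.
move=> tI; have cl : dform (hodge (phi t) (phi t)) = 0 by rewrite -psiE // cocl.
have h7 : hook (unitvec R i7) (hodge (phi t) (phi t)) = sfval (rho0_s R) by rewrite -psiE // hook7_psi_const.
have [P [x [y [z [p [q [r [m [u [n [a0 [a1 [a2 [a3 [a4 [a5 [c H]]]]]]]]]]]]]]]]] :=
  frame_structure (G2t tI) cl h7 (volume3_pos tI).
have [aP P7 Pc c0 [h1 h2 h3 h4 h5]] := H.
exists P, x, y, z, p, q, r, m, u, n, a0, a1, a2, a3, a4, a5, c; split => //.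
  have := volume3_pos tI; rewrite h3 pmulr_rgt0 // mulr_gt0 // exprn_gt0 //.
split=> //; first by rewrite psiE.
by rewrite /rhs psiE // -Pc; apply: flow_rhs_frame => //; rewrite Pc.
Qed.

Definition der_at (t : R) (f : lform R -> R) (d : R) := is_derive t 1 (fun s => f (psi s)) d.

Lemma functional_der t : a < t < b ->
  [/\ der_at t (@fX R) (fX (rhs t)), der_at t (@fY R) (fY (rhs t)), der_at t (@fZ R) (fZ (rhs t)) &
  [/\ der_at t (@fP R) (fP (rhs t)), der_at t (@fQ R) (fQ (rhs t)), der_at t (@fR R) (fR (rhs t)),
      der_at t (@fM R) (fM (rhs t)) &
  [/\ der_at t (@fT R) (fT (rhs t)), der_at t (@fN R) (fN (rhs t)), der_at t (@g0 R) (g0 (rhs t)),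
      der_at t (@g1 R) (g1 (rhs t)) &
  [/\ der_at t (@g2 R) (g2 (rhs t)), der_at t (@g3 R) (g3 (rhs t)), der_at t (@g4 R) (g4 (rhs t)) &
      der_at t (@g5 R) (g5 (rhs t))]]]].
Proof.
move=> tI; have d I := dpsi tI I.
have D1 I J : is_derive t 1 (fun s => (psi s I - psi s J) / 2) ((rhs t I - rhs t J) / 2).
  by apply: (der_eq (derM (derB (d I) (d J)) (derC t 2^-1))); ring.
have D2 I J : is_derive t 1 (fun s => (psi s I + psi s J) / 2) ((rhs t I + rhs t J) / 2).
  by apply: (der_eq (derM (derD (d I) (d J)) (derC t 2^-1))); ring.
have D3 I J := derB (d I) (d J). have D4 I J := derD (d I) (d J).
by split; [exact: d|exact: d|exact: d|split; [exact: D1|exact: D2|exact: D1|exact: D2|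
  split; [exact: D2|exact: D1|exact: D3|exact: D4|split; [exact: D4|exact: D3|exact: D4|exact: D3]]]].
Qed.

Lemma functional_const t (f : lform R -> R) : a < t < b -> (forall s, a < s < b -> der_at s f 0) ->
  f (psi t) = f (psi 0).
Proof. by move=> tI H; exact: (@der_const R (fun s => f (psi s)) a b t tI I0 H). Qed.

(** These functionals vanish on omega /\ w and omega /\ omega, so they are constant in time and keep
    their initial value 0. *)
Lemma shift_zero t : a < t < b -> [/\ g0 (psi t) = 0, g1 (psi t) = 0, g2 (psi t) = 0 &
  [/\ g3 (psi t) = 0, g4 (psi t) = 0 & g5 (psi t) = 0]].
Proof.
move=> tI.
have [_ _ _ [_ _ _ _ [_ _ i0 i1 [i2 i3 i4 i5]]]] := functionals_init R.
rewrite -psi_init in i0 i1 i2 i3 i4 i5.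
have H s : a < s < b -> [/\ der_at s (@g0 R) 0, der_at s (@g1 R) 0, der_at s (@g2 R) 0 &
    [/\ der_at s (@g3 R) 0, der_at s (@g4 R) 0 & der_at s (@g5 R) 0]].
  move=> sI; have [_ _ _ [_ _ _ _ [_ _ d0 d1 [d2 d3 d4 d5]]]] := functional_der sI.
  have [P [x [y [z [p [q [r [m [u [n [a0 [a1 [a2 [a3 [a4 [a5 [c [_ _ _ _ [_ _ _ _ E]]]]]]]]]]]]]]]]]]] :=
    coflow_frame_shifted sI.
  have [_ _ _ [_ _ _ _ [_ _ e0 e1 [e2 e3 e4 e5]]]] :=
    functionals_rhs (2 * A * c * s6) (c ^+ 2 / 6) x y z p q r m u n.
  rewrite -E in e0 e1 e2 e3 e4 e5.
  by rewrite e0 in d0; rewrite e1 in d1; rewrite e2 in d2; rewrite e3 in d3; rewrite e4 in d4; rewrite e5 in d5.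
split; [rewrite -i0|rewrite -i1|rewrite -i2|split; [rewrite -i3|rewrite -i4|rewrite -i5]].
all: by apply: functional_const => // s /H[? ? ? [? ? ?]].
Qed.

(* [w^2 / 2] is the adjugate of [w], so its determinant [mdet] is the square of the Pfaffian [mpf] of
   [w]; positivity of [volume3] selects the sign. *)
Definition mdet t : R :=
  fX (psi t) * fY (psi t) * fZ (psi t) - fX (psi t) * (fT (psi t) ^+ 2 + fN (psi t) ^+ 2)
  + fY (psi t) * (fM (psi t) ^+ 2 + fR (psi t) ^+ 2)
  + fZ (psi t) * (fP (psi t) ^+ 2 + fQ (psi t) ^+ 2)
  + 2 * (- (fP (psi t) * fT (psi t) * fM (psi t)) + fP (psi t) * fN (psi t) * fR (psi t)
         + fQ (psi t) * fN (psi t) * fM (psi t) + fQ (psi t) * fR (psi t) * fT (psi t)).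
Definition mpf t : R := Num.sqrt (mdet t).
Definition mvol t : R := volume3 (phi t) / 6.

Lemma coflow_frame t : a < t < b -> exists P x y z p q r m u n c,
  [/\ adapted (phi t) P, P i7 i7 = c, 0 < c, 0 < mpf t &
  [/\ mpf t = pf x y z p q r m u n, mvol t = c ^+ 3 * mpf t, volf P = c * mpf t,
      hook (unitvec R i7) (phi t) = c *: sfval (hermD x y z p q r m u n) &
  [/\ psi t = sfval (psi_struct x y z p q r m u n 0 0 0 0 0 0 c), 0 < mdet t,
   [/\ fX (psi t) = y * z - u ^+ 2 - n ^+ 2, fY (psi t) = x * z + m ^+ 2 + r ^+ 2,
      fZ (psi t) = x * y + q ^+ 2 + p ^+ 2 &
    [/\ der_at t (@fX R) (2 * A * c * s6 * (y + z) - c ^+ 2 / 3),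
        der_at t (@fY R) (2 * A * c * s6 * (x + z) - c ^+ 2 / 3) &
        der_at t (@fZ R) (2 * A * c * s6 * (x + y) - c ^+ 2 / 3)]],
   [/\ mpf t * p = fZ (psi t) * fP (psi t) - fT (psi t) * fM (psi t) + fN (psi t) * fR (psi t),
       mpf t * q = fZ (psi t) * fQ (psi t) + fN (psi t) * fM (psi t) + fR (psi t) * fT (psi t),
       mpf t * r = fY (psi t) * fR (psi t) + fN (psi t) * fP (psi t) + fT (psi t) * fQ (psi t) &
     [/\ mpf t * m = fY (psi t) * fM (psi t) - fT (psi t) * fP (psi t) + fN (psi t) * fQ (psi t),
       mpf t * u = fX (psi t) * fT (psi t) + fM (psi t) * fP (psi t) - fR (psi t) * fQ (psi t) &
       mpf t * n = fX (psi t) * fN (psi t) - fM (psi t) * fQ (psi t) - fP (psi t) * fR (psi t)]] &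
   [/\ der_at t (@fP R) (2 * A * c * s6 * p), der_at t (@fQ R) (2 * A * c * s6 * q),
       der_at t (@fR R) (2 * A * c * s6 * r) &
    [/\ der_at t (@fM R) (2 * A * c * s6 * m), der_at t (@fT R) (2 * A * c * s6 * u) &
        der_at t (@fN R) (2 * A * c * s6 * n)]]]]].
Proof.
move=> tI.
have [P [x [y [z [p [q [r [m [u [n [a0 [a1 [a2 [a3 [a4 [a5 [c [aP Pc c0 pf0 [h1 h2 h3 h4 h5]]]]]]]]]]]]]]]]]]] :=
  coflow_frame_shifted tI.
have cn : c != 0 by rewrite gt_eqF.
have [eX eY eZ [eP eQ eR eM [eT eN eg0 eg1 [eg2 eg3 eg4 eg5]]]] :=
  functionals_struct x y z p q r m u n a0 a1 a2 a3 a4 a5 cn.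
rewrite -h4 in eX eY eZ eP eQ eR eM eT eN eg0 eg1 eg2 eg3 eg4 eg5.
have [kX kY kZ [kP kQ kR kM [kT kN _ _ _]]] :=
  functionals_rhs (2 * A * c * s6) (c ^+ 2 / 6) x y z p q r m u n.
rewrite -h5 in kX kY kZ kP kQ kR kM kT kN.
have [dX dY dZ [dP dQ dR dM [dT dN _ _ _]]] := functional_der tI.
have [z0 z1 z2 [z3 z4 z5]] := shift_zero tI.
have ci : 2 * c^-1 != 0 by rewrite mulf_neq0 ?invr_eq0 ?pnatr_eq0.
have ci' : - 2 * c^-1 != 0 by rewrite mulNr oppr_eq0.
rewrite z0 in eg0; rewrite z1 in eg1; rewrite z2 in eg2; rewrite z3 in eg3; rewrite z4 in eg4; rewrite z5 in eg5.
have kill (k x' : R) : k != 0 -> 0 = k * x' -> x' = 0.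
  by move=> k0 /esym/eqP; rewrite mulf_eq0 (negbTE k0) => /eqP.
have b0 := kill _ _ ci eg0; have b1 := kill _ _ ci' eg1; have b2 := kill _ _ ci' eg2.
have b3 := kill _ _ ci eg3; have b4 := kill _ _ ci eg4; have b5 := kill _ _ ci' eg5.
have [j1 j2 j3 [j4 j5 j6 j7]] := pf_adjugate x y z p q r m u n.
rewrite -eX -eY -eZ -eP -eQ -eR -eM -eT -eN in j1 j2 j3 j4 j5 j6 j7.
have md : mdet t = pf x y z p q r m u n ^+ 2 by rewrite j7 /mdet; ring.
have mp : mpf t = pf x y z p q r m u n by rewrite /mpf md sqrtr_sqr gtr0_norm.
exists P, x, y, z, p, q, r, m, u, n, c; split; rewrite ?mp //; split=> //.
- by rewrite /mvol h2; field.
- split.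
  + by rewrite h4 b0 b1 b2 b3 b4 b5.
  + by rewrite md exprn_gt0.
  + split=> //; split; [rewrite kX in dX|rewrite kY in dY|rewrite kZ in dZ].
    * by apply: (der_eq dX); field.
    * by apply: (der_eq dY); field.
    * by apply: (der_eq dZ); field.
  + by split=> //; rewrite ?j1 ?j2 ?j3; try ring; split; rewrite ?j4 ?j5 ?j6; ring.
  + by rewrite -kP -kQ -kR -kM -kT -kN; split.
Qed.

Lemma functional_cont t : a < t < b ->
  [/\ {for t, continuous (fun s => fX (psi s))}, {for t, continuous (fun s => fY (psi s))},
      {for t, continuous (fun s => fZ (psi s))} &
  [/\ {for t, continuous (fun s => fP (psi s))}, {for t, continuous (fun s => fQ (psi s))},
      {for t, continuous (fun s => fR (psi s))} &
  [/\ {for t, continuous (fun s => fM (psi s))}, {for t, continuous (fun s => fT (psi s))} &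
      {for t, continuous (fun s => fN (psi s))}]]].
Proof.
move=> /functional_der[dX dY dZ [dP dQ dR dM [dT dN _ _ _]]].
split; [exact: der_cont dX|exact: der_cont dY|exact: der_cont dZ|].
split; [exact: der_cont dP|exact: der_cont dQ|exact: der_cont dR|].
by split; [exact: der_cont dM|exact: der_cont dT|exact: der_cont dN].
Qed.

Definition energy t : R := fP (psi t) ^+ 2 + fQ (psi t) ^+ 2 + fR (psi t) ^+ 2 +
  fM (psi t) ^+ 2 + fT (psi t) ^+ 2 + fN (psi t) ^+ 2.

(* Dominates the logarithmic derivatives of [energy] and of [(fZ - fY)^2]; the unknown scale [c]
   is controlled by [c <= 1 + c^3 = 1 + mvol / mpf]. *)
Definition rate t : R := 4 * A * s6 * (1 + mvol t / mpf t) / mpf t *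
  (fX (psi t) ^+ 2 + fY (psi t) ^+ 2 + fZ (psi t) ^+ 2 + 4 + energy t).

Lemma cont_exp (f : R -> R) n t : {for t, continuous f} -> {for t, continuous (fun s => f s ^+ n)}.
Proof.
move=> cf; elim: n => [|n IH]; first exact: cvg_cst.
have -> : (fun s => f s ^+ n.+1) = (fun s => f s * f s ^+ n) by apply: funext => s; rewrite exprS.
exact: continuousM.
Qed.

(** Each of X, Y, Z is bounded by 1 plus its square, and each of the four cubic terms by (1 + E) E /
    4; the contributions add up to the factor with 4 + E. *)
Lemma cubic_form_bound (X Y Z p q r m u n E : R) :
  E = p ^+ 2 + q ^+ 2 + r ^+ 2 + m ^+ 2 + u ^+ 2 + n ^+ 2 ->
  `|Z * (p ^+ 2 + q ^+ 2) + Y * (r ^+ 2 + m ^+ 2) + X * (u ^+ 2 + n ^+ 2) +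
    (- (p * u * m) + p * n * r + q * n * m + q * r * u)| <= (X ^+ 2 + Y ^+ 2 + Z ^+ 2 + 4 + E) * E.
Proof.
move=> EE; have E0 : 0 <= E by rewrite EE !addr_ge0 ?sqr_ge0.
have sq (v : R) := sqr_ge0 v.
have lin (v e : R) : 0 <= e -> `|v * e| <= (1 + v ^+ 2) * e.
  move=> e0; rewrite normrM (ger0_norm e0) ler_wpM2r // ler_norml.
  by apply/andP; split; have := sq (v + 1); have := sq (v - 1); have := sq v; lra.
have cub (v1 v2 v3 : R) : v1 ^+ 2 + v2 ^+ 2 <= E -> v3 ^+ 2 <= E ->
    `|v1 * v2 * v3| <= (1 + E) * E / 4.
  move=> l1 l2.
  have k1 : `|v1 * v2| <= E / 2.
    by rewrite ler_norml; apply/andP; split; have := sq (v1 + v2); have := sq (v1 - v2); lra.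
  have k2 : `|v3| <= (1 + E) / 2.
    by rewrite ler_norml; apply/andP; split; have := sq (v3 + 1); have := sq (v3 - 1); lra.
  have -> : (1 + E) * E / 4 = E / 2 * ((1 + E) / 2) by field.
  by rewrite normrM; apply: ler_pM.
have := sq p; have := sq q; have := sq r; have := sq m; have := sq u; have := sq n => s1 s2 s3 s4 s5 s6'.
have c1 : `|p * m * u| <= (1 + E) * E / 4 by apply: cub; rewrite EE; lra.
have c2 : `|p * r * n| <= (1 + E) * E / 4 by apply: cub; rewrite EE; lra.
have c3 : `|q * m * n| <= (1 + E) * E / 4 by apply: cub; rewrite EE; lra.
have c4 : `|q * u * r| <= (1 + E) * E / 4 by apply: cub; rewrite EE; lra.
have l1 := lin Z (p ^+ 2 + q ^+ 2) (addr_ge0 s6' s5).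
have l2 := lin Y (r ^+ 2 + m ^+ 2) (addr_ge0 s4 s3).
have l3 := lin X (u ^+ 2 + n ^+ 2) (addr_ge0 s2 s1).
have m1 : (1 + Z ^+ 2) * (p ^+ 2 + q ^+ 2) <= (1 + Z ^+ 2) * E.
  by apply: ler_wpM2l; [have := sq Z; lra|rewrite EE; lra].
have m2 : (1 + Y ^+ 2) * (r ^+ 2 + m ^+ 2) <= (1 + Y ^+ 2) * E.
  by apply: ler_wpM2l; [have := sq Y; lra|rewrite EE; lra].
have m3 : (1 + X ^+ 2) * (u ^+ 2 + n ^+ 2) <= (1 + X ^+ 2) * E.
  by apply: ler_wpM2l; [have := sq X; lra|rewrite EE; lra].
rewrite (_ : (X ^+ 2 + Y ^+ 2 + Z ^+ 2 + 4 + E) * E = (1 + Z ^+ 2) * E + (1 + Y ^+ 2) * E +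
   (1 + X ^+ 2) * E + 4 * ((1 + E) * E / 4)); last by field.
apply: (le_trans (ler_normD _ _)); apply: lerD.
  apply: (le_trans (ler_normD _ _)); apply: lerD; last exact: (le_trans l3).
  by apply: (le_trans (ler_normD _ _)); apply: lerD; [exact: (le_trans l1)|exact: (le_trans l2)].
rewrite (_ : - (p * u * m) = - (p * m * u)); last by ring.
rewrite (_ : p * n * r = p * r * n); last by ring.
rewrite (_ : q * n * m = q * m * n); last by ring.
rewrite (_ : q * r * u = q * u * r); last by ring.
apply: (le_trans (ler_normD _ _)).
have := ler_normD (- (p * m * u) + p * r * n) (q * m * n).
have := ler_normD (- (p * m * u)) (p * r * n); rewrite normrN; lra.
Qed.

Lemma energy_der t : a < t < b -> exists d, is_derive t 1 energy d /\ `|d| <= rate t * energy t.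
Proof.
move=> tI; have [P [x [y [z [p [q [r [m [u [n [c [aP Pc c0 mp [h1 h2 h3 h4 [h5 h6 [eX eY eZ _]
  [jp jq jr [jm ju jn]] [dP dQ dR [dM dT dN]]]]]]]]]]]]]]]] := coflow_frame tI.
set ka := 2 * A * c * s6 in dP dQ dR dM dT dN.
pose d := 2 * ka * (fP (psi t) * p + fQ (psi t) * q + fR (psi t) * r + fM (psi t) * m +
  fT (psi t) * u + fN (psi t) * n).
exists d; split.
  apply: (der_eq (derD (derD (derD (derD (derD (derX 1 dP) (derX 1 dQ)) (derX 1 dR)) (derX 1 dM)) (derX 1 dT)) (derX 1 dN))).
  by rewrite /d; ring.
set X := fX (psi t) in jp jq jr jm ju jn *; set Y := fY (psi t) in jp jq jr jm ju jn *.
set Z := fZ (psi t) in jp jq jr jm ju jn *; set p' := fP (psi t) in jp jq jr jm ju jn d *.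
set q' := fQ (psi t) in jp jq jr jm ju jn d *; set r' := fR (psi t) in jp jq jr jm ju jn d *.
set m' := fM (psi t) in jp jq jr jm ju jn d *; set u' := fT (psi t) in jp jq jr jm ju jn d *.
set n' := fN (psi t) in jp jq jr jm ju jn d *; set D := mpf t in jp jq jr jm ju jn mp h2 *.
(* The pairing of the off-diagonal entries of w^2 / 2 with those of w, times the Pfaffian: the
   adjugate identities express it through psi alone. *)
pose Q := Z * (p' ^+ 2 + q' ^+ 2) + Y * (r' ^+ 2 + m' ^+ 2) + X * (u' ^+ 2 + n' ^+ 2) +
  (- (p' * u' * m') + p' * n' * r' + q' * n' * m' + q' * r' * u').
have Dn : D != 0 by rewrite gt_eqF.
have dE : d = 2 * ka / D * Q.
  apply: (mulfI Dn); rewrite (_ : D * (2 * ka / D * Q) = 2 * ka * Q); last by field.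
  rewrite /d (_ : D * (2 * ka * _) = 2 * ka * (p' * (D * p) + q' * (D * q) + r' * (D * r) +
    m' * (D * m) + u' * (D * u) + n' * (D * n))); last by ring.
  by rewrite jp jq jr jm ju jn /Q; ring.
have E0 : 0 <= energy t by rewrite /energy !addr_ge0 ?sqr_ge0.
have EE : energy t = p' ^+ 2 + q' ^+ 2 + r' ^+ 2 + m' ^+ 2 + u' ^+ 2 + n' ^+ 2 by [].
set E := energy t in E0 EE *.
have sq (v : R) := sqr_ge0 v.
have QE : `|Q| <= (X ^+ 2 + Y ^+ 2 + Z ^+ 2 + 4 + E) * E by exact: cubic_form_bound.
have s60 : 0 < s6 by rewrite /s6 divr_gt0 // sqrtr_gt0.
have ka0 : 0 < ka by rewrite /ka !mulr_gt0.
have kD : 0 <= 2 * ka / D by rewrite divr_ge0 ?mulr_ge0 // ltW.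
rewrite dE normrM (ger0_norm kD) /rate.
apply: (@le_trans _ _ (2 * ka / D * ((X ^+ 2 + Y ^+ 2 + Z ^+ 2 + 4 + E) * E))).
  exact: ler_wpM2l.
rewrite mulrA; apply: ler_wpM2r => //; apply: ler_wpM2r.
  by rewrite !addr_ge0 ?sq.
rewrite -/D h2 mulfK //; apply: ler_wpM2r; first by rewrite invr_ge0 ltW.
have c3 : c <= 1 + c ^+ 3 by have := sq (c - 1); have := sq c; nra.
rewrite /ka; have -> : 2 * (2 * A * c * s6) = 4 * A * s6 * c by ring.
by apply: ler_wpM2l => //; rewrite !mulr_ge0 // ltW.
Qed.

Lemma rate_cont t : a < t < b -> {for t, continuous rate}.
Proof.
move=> tI; have [cX cY cZ [cP cQ cR [cM cT cN]]] := functional_cont tI.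
have [P [x [y [z [p [q [r [m [u [n [c [_ _ _ mp _]]]]]]]]]]]] := coflow_frame tI.
have k (v : R) : {for t, continuous (fun _ : R => v)} by exact: cvg_cst.
have cD : {for t, continuous mdet}.
  apply: continuousD; [apply: continuousD; [apply: continuousD; [apply: continuousB|]|]|].
  - by apply: continuousM => //; exact: continuousM.
  - by apply: continuousM => //; apply: continuousD; exact: cont_exp.
  - by apply: continuousM => //; apply: continuousD; exact: cont_exp.
  - by apply: continuousM => //; apply: continuousD; exact: cont_exp.
  - apply: continuousM => //; apply: continuousD; [apply: continuousD; [apply: continuousD|]|].
    + by apply: continuousN; do 2 apply: continuousM => //.
    + by do 2 apply: continuousM => //.
    + by do 2 apply: continuousM => //.
    + by do 2 apply: continuousM => //.
have cF : {for t, continuous mpf}.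
  by apply: (@continuous_comp _ _ _ mdet Num.sqrt) => //; exact: sqrt_continuous.
have cI : {for t, continuous (fun s => (mpf s)^-1)} by apply: continuousV => //; rewrite gt_eqF.
have cV : {for t, continuous mvol}.
  by apply: continuousM => //; apply: cont_volume3 => I; exact: phi_cont.
have cE : {for t, continuous energy} by do 5 (apply: continuousD; last exact: cont_exp); exact: cont_exp.
apply: continuousM; first apply: continuousM => //.
  by apply: continuousM => //; apply: continuousD => //; exact: continuousM.
apply: continuousD => //; apply: continuousD => //.
by do 2 (apply: continuousD; last exact: cont_exp); exact: cont_exp.
Qed.

Lemma offdiag_zero t : a < t < b ->
  [/\ fP (psi t) = 0, fQ (psi t) = 0, fR (psi t) = 0 &
  [/\ fM (psi t) = 0, fT (psi t) = 0 & fN (psi t) = 0]].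
Proof.
move=> tI.
have E0 : energy t = 0.
  have H : forall s, exists d, a < s < b -> is_derive s 1 energy d /\ `|d| <= rate s * energy s.
    move=> s; have [/energy_der[d hd]|ns] := boolP (a < s < b); first by exists d.
    by exists 0.
  have /choice[E' HE] := H.
  apply: (@gronwall _ energy E' rate a b I0) => //.
  - by move=> s /HE[].
  - by move=> s _; rewrite !addr_ge0 ?sqr_ge0.
  - by move=> s sI; exact: rate_cont.
  - by move=> s /HE[].
  - have [_ _ _ [p0 q0 r0 m0 [u0 n0 _ _ _]]] := functionals_init R.
    by rewrite /energy psi_init p0 q0 r0 m0 u0 n0 !expr0n /= !addr0.
have sq (v : R) := sqr_ge0 v.
have {E0} : fP (psi t) ^+ 2 + fQ (psi t) ^+ 2 + fR (psi t) ^+ 2 +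
  fM (psi t) ^+ 2 + fT (psi t) ^+ 2 + fN (psi t) ^+ 2 = 0 by exact: E0.
move: (sq (fP (psi t))) (sq (fQ (psi t))) (sq (fR (psi t))) (sq (fM (psi t))) (sq (fT (psi t))) (sq (fN (psi t))).
move=> s1 s2 s3 s4 s5 s6' E0.
have z (v : R) : v ^+ 2 <= 0 -> v = 0.
  by move=> h; apply/eqP; rewrite -sqrf_eq0; apply/eqP/le_anti; rewrite h sq.
by split; [apply: z; lra|apply: z; lra|apply: z; lra|split; apply: z; lra].
Qed.

Lemma coflow_frame_diag t : a < t < b -> exists P x y z c,
  [/\ adapted (phi t) P, P i7 i7 = c, 0 < c, volf P = c * mpf t &
  [/\ mpf t = x * y * z, 0 < mpf t, mvol t = c ^+ 3 * mpf t &
  [/\ hook (unitvec R i7) (phi t) = c *: sfval (hermD x y z 0 0 0 0 0 0),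
      psi t = sfval (psi_struct x y z 0 0 0 0 0 0 0 0 0 0 0 0 c) &
  [/\ fX (psi t) = y * z, fY (psi t) = x * z, fZ (psi t) = x * y &
  [/\ der_at t (@fX R) (2 * A * c * s6 * (y + z) - c ^+ 2 / 3),
      der_at t (@fY R) (2 * A * c * s6 * (x + z) - c ^+ 2 / 3) &
      der_at t (@fZ R) (2 * A * c * s6 * (x + y) - c ^+ 2 / 3)]]]]].
Proof.
move=> tI; have [P [x [y [z [p [q [r [m [u [n [c [aP Pc c0 mp [h1 h2 h3 h4 [h5 h6 [eX eY eZ [dX dY dZ]]
  [jp jq jr [jm ju jn]] _]]]]]]]]]]]]]] := coflow_frame tI.
have [zP zQ zR [zM zT zN]] := offdiag_zero tI.
have kill (v : R) : mpf t * v = 0 -> v = 0.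
  by move/eqP; rewrite mulf_eq0 gt_eqF //= => /eqP.
rewrite zP zQ zR zM zT zN !(mulr0, mul0r, subr0, addr0) in jp jq jr jm ju jn.
have := (kill _ jp, kill _ jq, kill _ jr, (kill _ jm, kill _ ju, kill _ jn)).
case=> -[[[p0 q0] r0] [[m0 u0] n0]]; subst p q r m u n.
exists P, x, y, z, c; split=> //; split=> //; first by rewrite h1 /pf; ring.
split=> //; split; [by rewrite eX; ring|by rewrite eY; ring|by rewrite eZ; ring|].
by split.
Qed.

(** In the diagonal frame fZ - fY = x (y - z), and its derivative is 2 A c s (y - z). As fX = y z
    and the Pfaffian is x y z, y - z equals fX (fZ - fY) / Pf: a linear equation with zero initial
    value. *)
Lemma fY_eq_fZ t : a < t < b -> fY (psi t) = fZ (psi t).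
Proof.
move=> tI; pose F s := (fZ (psi s) - fY (psi s)) ^+ 2.
suff : F t = 0 by move/eqP; rewrite sqrf_eq0 subr_eq0 eq_sym => /eqP.
have H : forall s, exists d, a < s < b -> is_derive s 1 F d /\ `|d| <= rate s * F s.
  move=> s; have [sI|ns] := boolP (a < s < b); last by exists 0.
  have [P [x [y [z [c [_ _ c0 _ [mE mp vE [_ _ [eX eY eZ [_ dY dZ]]]]]]]]]] := coflow_frame_diag sI.
  have xn : x != 0 by apply: contraTneq mp => x0; rewrite mE x0 !mul0r ltxx.
  exists (2 * (2 * A * c * s6) * (y - z) * (fZ (psi s) - fY (psi s))) => _; split.
    by apply: (der_eq (derX 1 (derB dZ dY))); ring.
  have s60 : 0 < s6 by rewrite /s6 divr_gt0 // sqrtr_gt0.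
  have kE : 2 * (2 * A * c * s6) * (y - z) * (fZ (psi s) - fY (psi s)) =
     4 * A * s6 * c / mpf s * (fX (psi s) * F s).
    have mn : mpf s != 0 by rewrite gt_eqF.
    have yn : y != 0 by apply: contraTneq mp => y0; rewrite mE y0 mulr0 mul0r ltxx.
    have zn : z != 0 by apply: contraTneq mp => z0; rewrite mE z0 mulr0 ltxx.
    by rewrite /F eX eY eZ mE; field; rewrite xn yn zn.
  rewrite kE normrM ger0_norm; last by rewrite divr_ge0 ?mulr_ge0 // ltW.
  have F0 : 0 <= F s := sqr_ge0 _.
  have sq (v : R) := sqr_ge0 v.
  rewrite normrM (ger0_norm F0) mulrA; apply: ler_wpM2r => //.
  have c3 : c <= 1 + c ^+ 3 by have := sq (c - 1); have := sq c; nra.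
  apply: ler_pM => //.
  - by rewrite divr_ge0 ?mulr_ge0 // ltW.
  - apply: ler_wpM2r; first by rewrite invr_ge0 ltW.
    by rewrite vE mulfK ?gt_eqF //; apply: ler_wpM2l => //; rewrite !mulr_ge0 // ltW.
  have := sq (fX (psi s) - 1); have := sq (fX (psi s) + 1); have := sq (fY (psi s)).
  have := sq (fZ (psi s)); have : 0 <= energy s by rewrite !addr_ge0 ?sq.
  by rewrite ler_norml => *; apply/andP; split; lra.
have /choice[E' HE] := H.
apply: (@gronwall _ F E' rate a b I0) => //.
- by move=> s /HE[].
- by move=> s _; exact: sqr_ge0.
- by move=> s sI; exact: rate_cont.
- by move=> s /HE[].
- have [_ yE zE _] := functionals_init R.
  by rewrite /F psi_init yE zE subrr expr0n.
Qed.

Lemma coflow_frame_reduced t : a < t < b -> exists P x y c,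
  [/\ adapted (phi t) P, 0 < c, 0 < x, y < 0 &
  [/\ 0 < volf P, hook (unitvec R i7) (phi t) = c *: sfval (hermD x y y 0 0 0 0 0 0),
      psi t = sfval (psi_struct x y y 0 0 0 0 0 0 0 0 0 0 0 0 c) &
  [/\ fX (psi t) = y ^+ 2, fY (psi t) = x * y,
      der_at t (@fX R) (4 * A * c * s6 * y - c ^+ 2 / 3) &
      der_at t (@fY R) (2 * A * c * s6 * (x + y) - c ^+ 2 / 3)]]].
Proof.
have H s : a < s < b -> exists P x y c,
  [/\ adapted (phi s) P, 0 < c, 0 < x, y != 0 &
  [/\ 0 < volf P, hook (unitvec R i7) (phi s) = c *: sfval (hermD x y y 0 0 0 0 0 0),
      psi s = sfval (psi_struct x y y 0 0 0 0 0 0 0 0 0 0 0 0 c) &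
  [/\ fX (psi s) = y ^+ 2, fY (psi s) = x * y,
      der_at s (@fX R) (4 * A * c * s6 * y - c ^+ 2 / 3) &
      der_at s (@fY R) (2 * A * c * s6 * (x + y) - c ^+ 2 / 3)]]].
  move=> sI; have [P [x [y [z [c [aP _ c0 vP [mE mp _ [hE pE [eX eY eZ [dX dY _]]]]]]]]]] := coflow_frame_diag sI.
  have xn : x != 0 by apply: contraTneq mp => x0; rewrite mE x0 !mul0r ltxx.
  have yn : y != 0 by apply: contraTneq mp => y0; rewrite mE y0 mulr0 mul0r ltxx.
  have zy : z = y by apply: (mulfI xn); rewrite -eY -eZ fY_eq_fZ.
  subst z; exists P, x, y, c; split=> //.
    move: mp; rewrite mE -mulrA pmulr_lgt0 // -expr2 lt_neqAle eq_sym expf_neq0 //=.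
    exact: sqr_ge0.
  split=> //; first by rewrite vP mulr_gt0.
  by split=> //; apply: (der_eq dX); rewrite /s6; ring.
(* The Pfaffian x y^2 gives only x > 0. The sign of y follows by continuity: fY = x y never vanishes
   and starts at -1. *)
have fYn : forall s, a < s < b -> 0 < - fY (psi s).
  apply: (nonzero_pos I0) => [s sI|s sI|].
  - by have [_ cY _ _] := functional_cont sI; exact: continuousN.
  - have [P [x [y [c [_ _ x0 yn [_ _ _ [_ -> _ _]]]]]]] := H s sI.
    by rewrite oppr_eq0 mulf_neq0 // gt_eqF.
  - by rewrite psi_init; have [_ -> _ _] := functionals_init R; rewrite opprK.
move=> tI; have [P [x [y [c [aP c0 x0 yn [vP hE pE [eX eY dX dY]]]]]]] := H t tI.
exists P, x, y, c; split=> //.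
by have := fYn t tI; rewrite eY oppr_gt0 pmulr_rlt0.
Qed.

(** Inverts fX = z^4 and fY = - y^2 z^2 from [psi_yz_s]. Being functions of psi, [zsol] and [ysol]
    can be differentiated. *)
Definition zsol t : R := Num.sqrt (Num.sqrt (fX (psi t))).
Definition ysol t : R := Num.sqrt (- fY (psi t) / Num.sqrt (fX (psi t))).

Lemma coflow_reduced t : a < t < b ->
  [/\ 0 < ysol t, 0 < zsol t, phi t = phi_yz (ysol t) (zsol t) &
  [/\ is_derive t 1 ysol ((2 * A * Num.sqrt 6 * ysol t * zsol t ^+ 6 + 2 * zsol t ^+ 2 + ysol t ^+ 2)
        / (12 * ysol t ^+ 3 * zsol t ^+ 8)) &
      is_derive t 1 zsol (- (2 * A * Num.sqrt 6 * ysol t * zsol t ^+ 4 + 1)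
        / (12 * ysol t ^+ 2 * zsol t ^+ 7))]].
Proof.
move=> tI; have [P [x [y [c [aP c0 x0 y0 [vP hE pE [eX eY dX dY]]]]]]] := coflow_frame_reduced tI.
have sX : Num.sqrt (fX (psi t)) = - y by rewrite eX sqrtr_sqr ltr0_norm.
have zE : zsol t = Num.sqrt (- y) by rewrite /zsol sX.
have yE : ysol t = Num.sqrt x.
  by rewrite /ysol sX eY; congr Num.sqrt; field; rewrite lt_eqF.
have Y0 : 0 < ysol t by rewrite yE sqrtr_gt0.
have Z0 : 0 < zsol t by rewrite zE sqrtr_gt0 oppr_gt0.
have xE : x = ysol t ^+ 2 by rewrite yE sqr_sqrtr // ltW.
have {}yE' : y = - zsol t ^+ 2 by rewrite zE sqr_sqrtr ?opprK // oppr_ge0 ltW.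
set Y := ysol t in Y0 xE *; set Z := zsol t in Z0 yE' *.
have Yn : Y != 0 by rewrite gt_eqF.
have Zn : Z != 0 by rewrite gt_eqF.
have cn : c != 0 by rewrite gt_eqF.
pose D := Dyz Y Z; have Du : D \in unitmx by exact: Dyz_unit.
(* The unknown frame P and the diagonal frame D give the same psi and both have positive volume, so
   [psi0_stab] makes their 3-forms agree. *)
have psP : expr P (psi0 R) = expr D (psi0 R).
  by rewrite -(hodge_phi aP) -psiE // pE (psi_struct_diag cn xE yE' yE') Dyz_psi0.
have vD : 0 < volf D by rewrite volf_Dyz // mulr_gt0 // exprn_gt0.
have vI : 0 < volf (invmx D).
  by rewrite -(pmulr_rgt0 _ vD) mulrC -volfM mulVmx // volf1.
have phE : phi t = phi_yz Y Z.
  have fix0 : expr (P *m invmx D) (phi0 R) = phi0 R.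
    apply: psi0_stab.
    - by rewrite unitmx_mul (adapted_unit aP) unitmx_inv.
    - by rewrite volfM mulr_gt0.
    - by rewrite -expr_mulmx psP expr_mulmx mulmxV // expr_id.
  have [_ ->] := aP; rewrite -Dyz_phi0 // -/D -[in RHS]fix0 expr_mulmx -mulmxA mulVmx //.
  by rewrite mulmx1.
(* The scale is read off from the coefficient of e^12 in e_7 -| phi. *)
have cE : c = (Y * Z ^+ 2)^-1.
  have : Y / Z ^+ 2 = c * x.
    have := congr1 (fun f => f (setw [:: 0; 1]%N)) hE.
    rewrite phE phi_yzE form_hooks; [|by []|by cbv [phi_yz_s]; sform_cbv].
    rewrite -form_scales -form_norms -[sfval (scales _ _)]form_norms.
    have so1 : sorteds (norms (hooks 6 (phi_yz_s Y Z))) by cbv [phi_yz_s]; sform_cbv.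
    have so2 : sorteds (norms (scales c (hermD x y y 0 0 0 0 0 0))) by cbv [hermD]; sform_cbv.
    rewrite !form_coefs //; cbv [phi_yz_s hermD]; sform_cbv.
    by rewrite opprK mulr1 !addr0.
  rewrite xE => h; apply: (mulIf (expf_neq0 2 Yn)); rewrite -h.
  by field; rewrite Yn Zn.
split=> //.
have X0 : 0 < fX (psi t) by rewrite eX lt_neqAle eq_sym sqrf_eq0 lt_eqF //= sqr_ge0.
have dS := @der_comp _ t Num.sqrt (fun s => fX (psi s)) _ _ (is_derive1_sqrt X0) dX.
have dZ : is_derive t 1 zsol (- (2 * A * Num.sqrt 6 * Y * Z ^+ 4 + 1) / (12 * Y ^+ 2 * Z ^+ 7)).
  have S0 : 0 < Num.sqrt (fX (psi t)) by rewrite sqrtr_gt0.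
  apply: (der_eq (@der_comp _ t Num.sqrt (fun s => Num.sqrt (fX (psi s))) _ _ (is_derive1_sqrt S0) dS)).
  rewrite -/(zsol t) -/Z sX yE' cE /s6; field.
  by rewrite Yn Zn.
split=> //.
have Sn : Num.sqrt (fX (psi t)) != 0 by rewrite gt_eqF // sqrtr_gt0.
have dQ := derM (derN (dY : is_derive t 1 (fun s => fY (psi s)) _)) (@derV _ t (fun s => Num.sqrt (fX (psi s))) _ Sn dS).
have Q0 : 0 < - fY (psi t) / Num.sqrt (fX (psi t)).
  by rewrite divr_gt0 ?sqrtr_gt0 // eY -mulrN mulr_gt0 // oppr_gt0.
apply: (der_eq (@der_comp _ t Num.sqrt (fun s => - fY (psi s) / Num.sqrt (fX (psi s))) _ _ (is_derive1_sqrt Q0) dQ)).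
rewrite -/(ysol t) -/Y sX eY xE yE' cE /s6; field.
by rewrite Yn Zn.
Qed.

Lemma solution_reduced : is_solution (2 * A * Num.sqrt 6) a b ysol zsol.
Proof.
have [xE yE _ _] := functionals_init R; split; first by rewrite /ysol psi_init xE yE opprK sqrtr1 divr1 sqrtr1.
split; first by rewrite /zsol psi_init xE !sqrtr1.
by move=> t /coflow_reduced[? ? _ [? ?]]; split.
Qed.

End Uniqueness.

(** * Existence and maximality *)

Section Existence.
Variables (R : realType) (A a b : R) (y z : R -> R).
Hypothesis I0 : a < 0 < b.
Hypothesis yz : is_solution (2 * A * Num.sqrt 6) a b y z.

Lemma flow_rhs_yz (Y Z : R) : 0 < Y -> 0 < Z -> let phi := phi_yz Y Z in
  fadd (lap phi 4 (hodge phi phi)) (fscale 2 (dform (fscale (A - trace_torsion phi) phi))) =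
  sfval (rhs_s (2 * A * (Y * Z ^+ 2)^-1 * (Num.sqrt 6 / 6)) ((Y * Z ^+ 2)^-1 ^+ 2 / 6)
    (Y ^+ 2) (- Z ^+ 2) (- Z ^+ 2) 0 0 0 0 0 0).
Proof.
move=> Y0 Z0 phi; have Yn : Y != 0 by rewrite gt_eqF.
have Zn : Z != 0 by rewrite gt_eqF.
rewrite (flow_rhs_frame A (Dyz_adapted Yn Zn) (@Dyz_col _ Y Z) (x := Y ^+ 2) (y := - Z ^+ 2)
  (z := - Z ^+ 2) (p := 0) (q := 0) (r := 0) (m := 0) (t := 0) (n := 0)) ?Dyz_77 //.
- by rewrite invr_gt0 mulr_gt0 // exprn_gt0.
- by rewrite hodge_phi_yz // dform_psi_yz.
- rewrite exprs_Dyz; last by cbv [omega_s]; sform_cbv.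
  by apply: form_eq; cbv [omega_s hermD dyz]; sform_cbv; do ?split; ring.
Qed.

Lemma solution_coflow : coflow_solution A a b (fun t => phi_yz (y t) (z t))
  (fun t => hodge (phi_yz (y t) (z t)) (phi_yz (y t) (z t))).
Proof.
have [y1 [z1 H]] := yz; split=> //; split; first by rewrite y1 z1 phi2E.
move=> t tI; have [y0 z0 dy dz] := H t tI.
have yn : y t != 0 by rewrite gt_eqF.
have zn : z t != 0 by rewrite gt_eqF.
split; first by exists (Dyz (y t) (z t)); exact: Dyz_adapted.
split=> //; split; first by rewrite hodge_phi_yz // dform_psi_yz.
move=> I; rewrite flow_rhs_yz //.
(* The explicit formula for psi holds where y and z are nonzero, hence near t. *)
apply: (@near_eq_is_derive _ _ _ (fun s => sfval (psi_yz_s (y s) (z s)) I)).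
  near=> s; have sI : a < s < b by near: s; exact: near_oo.
  have [ys zs _ _] := H s sI.
  by rewrite hodge_phi_yz // gt_eqF.
have dI (f g : R -> R) (d e : R) (w : word) : is_derive t 1 f d -> is_derive t 1 g e ->
  is_derive t 1 (fun s => f s * formw w I + g s) (d * formw w I + e).
  by move=> df dg; apply: (der_eq (derD (derM df (derC t (formw w I))) dg)); ring.
have dE := derN (derM (derX 1 dy) (derX 1 dz)).
(* The e^7-part of psi, constant in time. *)
pose tl := sfval [:: (-1, [:: 1; 3; 5; 6]%N); (1, [:: 1; 2; 4; 6]%N); (-1, [:: 0; 3; 4; 6]%N);
  (-1, [:: 0; 2; 5; 6]%N)] : lform R.
have h := dI _ _ _ _ [:: 2; 3; 4; 5]%N (derX 3 dz) (dI _ _ _ _ [:: 0; 1; 4; 5]%N dE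
   (dI _ _ _ _ [:: 0; 1; 2; 3]%N dE (derC t (tl I)))).
have E s : sfval (psi_yz_s (y s) (z s)) I = z s ^+ 4 * formw [:: 2; 3; 4; 5]%N I +
  (- (y s ^+ 2 * z s ^+ 2) * formw [:: 0; 1; 4; 5]%N I +
  (- (y s ^+ 2 * z s ^+ 2) * formw [:: 0; 1; 2; 3]%N I + tl I)) by [].
have -> : (fun s => sfval (psi_yz_s (y s) (z s)) I) = _ := funext E.
apply: (der_eq h).
have F (d1 d2 d3 : R) : d1 * formw [:: 2; 3; 4; 5]%N I + (d2 * formw [:: 0; 1; 4; 5]%N I +
  (d3 * formw [:: 0; 1; 2; 3]%N I + 0)) =
  sfval [:: (d1, [:: 2; 3; 4; 5]%N); (d2, [:: 0; 1; 4; 5]%N); (d3, [:: 0; 1; 2; 3]%N)] I by [].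
rewrite F; congr (_ I); apply: form_eq; cbv [rhs_s omega_s hermD]; sform_cbv.
by do ?split; field; rewrite yn zn.
Unshelve. all: by end_near.
Qed.
End Existence.

Theorem theorem5p4 (R : realType) (A : R) (hA : 0 < A) :
  exists (tm tp : R) (y z : R -> R),
    tm < 0 < tp /\ y 0 = 1 /\ z 0 = 1 /\
    (forall t, tm < t < tp ->
       0 < y t /\ 0 < z t /\
       is_derive t 1 y
         ((2 * A * Num.sqrt 6 * y t * z t ^+ 6 + 2 * z t ^+ 2 + y t ^+ 2)
            / (12 * y t ^+ 3 * z t ^+ 8)) /\
       is_derive t 1 z
         (- (2 * A * Num.sqrt 6 * y t * z t ^+ 4 + 1) / (12 * y t ^+ 2 * z t ^+ 7))) /\
    coflow_solution A tm tp (fun t => phi_yz (y t) (z t))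
      (fun t => hodge (phi_yz (y t) (z t)) (phi_yz (y t) (z t))) /\
    (* (tm, tp) is the maximal interval of existence, and the solution is unique *)
    (forall (a b : R) (phi psi : R -> lform R),
       phi 0 = @phi2 R ->
       (forall t, a < t < b -> forall I : {set 'I_7}, (fun s : R => phi s I) @ t --> phi t I) ->
       coflow_solution A a b phi psi ->
       tm <= a /\ b <= tp /\
       forall t, a < t < b ->
         phi t = phi_yz (y t) (z t) /\
         psi t = hodge (phi_yz (y t) (z t)) (phi_yz (y t) (z t))).
Proof.
have k0 : 0 < 2 * A * Num.sqrt 6 by rewrite !mulr_gt0 // sqrtr_gt0.
have [tm [tp [y [z [I0 yz uniq]]]]] := ode_solution k0.
exists tm, tp, y, z; have [y1 [z1 H]] := yz.
do 3 split=> //; split; first by move=> t /H[].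
split; first exact: solution_coflow.
move=> a b phi psi p0 pc sol.
have J0 : a < 0 < b by case: sol.
have ode := solution_reduced hA p0 pc sol.
have {}uniq t : a < t < b -> tm < t < tp /\
    phi t = phi_yz (y t) (z t) /\ psi t = hodge (phi_yz (y t) (z t)) (phi_yz (y t) (z t)).
  move=> tI; have [? [yE zE]] := uniq a b _ _ J0 ode t tI.
  have [_ _ pE _] := coflow_reduced hA p0 pc sol tI.
  have [_ [_ /(_ t tI)[_ [sE _]]]] := sol.
  by rewrite sE pE yE zE.
have /andP[a0 b0] := J0; have /andP[m0 p0'] := I0.
split; [|split; last by move=> t /uniq[]].
  (* If a < tm, the time tm would lie in (a, b), and [uniq] would place it strictly inside (tm, tp);
     likewise for tp below. *)
  rewrite leNgt; apply/negP => h.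
  by have [] := uniq tm; rewrite ?ltxx // h (lt_trans m0 b0).
rewrite leNgt; apply/negP => h.
by have [] := uniq tp; rewrite ?ltxx ?andbF // h (lt_trans a0 p0').
Qed.
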